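(* Let $E=\{\zeta_j\}_{j=1}^n$ and $F=\{\xi_k\}_{k=1}^m$ be two disjoint finite sets of distinct points on the unit circle $\mathbb{T}$. Let $f$ be analytic on the unit disk $\mathbb{D}$ with $|f(0)|=1$, and suppose that for some constant $K>0$ and exponents $p,q_k,r_j\ge 0$, $$\log|f(z)|\le\frac{K}{(1-|z|)^p}\,\frac{\prod_{j=1}^n |z-\zeta_j|^{r_j}}{\prod_{k=1}^m |z-\xi_k|^{q_k}}, \qquad z\in\mathbb{D}.$$ Then for every $\varepsilon>0$ there is a positive number $C_3=C_3(E,F,p,\{q_k\},\{r_j\},\varepsilon)$ such that $$\sum_{\zeta\in Z(f)} (1-|\zeta|)^{p+1+\varepsilon}\,\frac{\prod_{k=1}^m |\zeta-\xi_k|^{(q_k-1+\varepsilon)_+}}{\prod_{j=1}^n |\zeta-\zeta_j|^{\min(p,r_j)}}\le C_3\cdot K.$$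
   Context: $Z(f)$ denotes the zero set of $f$ in $\mathbb{D}$, counted with multiplicities. $a_+:=\max(a,0)$. *)

(* Defs.v *)
From HB Require Import structures.
From mathcomp Require Import all_boot all_order all_algebra.
From mathcomp Require Import complex.
From mathcomp Require Import all_classical all_reals all_analysis.
Set Implicit Arguments. Unset Strict Implicit. Unset Printing Implicit Defensive.
Import Order.TTheory GRing.Theory Num.Theory numFieldNormedType.Exports.
Local Open Scope ring_scope.
Local Open Scope classical_set_scope.

Definition cabs (R : realType) (z : R[i]) : R := Normc.normc z.

Definition pseries_at (R : realType) (f : R[i] -> R[i]) (a : R[i])
    (c : nat -> R[i]) (rho : R) : Prop :=
  0 < rho /\
  forall z : R[i], cabs (z - a) < rho ->
    (fun N : nat => cabs (f z - \sum_(i < N) c i * (z - a) ^+ i)) @ \oo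
      --> (0 : R).

Definition analytic_on_disc (R : realType) (f : R[i] -> R[i]) : Prop :=
  forall a : R[i], cabs a < 1 -> exists c rho, pseries_at f a c rho.

Definition vanishes_to (R : realType) (f : R[i] -> R[i]) (a : R[i])
    (k : nat) : Prop :=
  exists c rho, pseries_at f a c rho /\ forall i, (i < k)%N -> c i = 0.

(* The zero set Z(f) in D counted with multiplicities: a zero a of
   multiplicity m is represented by the m pairs (a,1), ..., (a,m). *)
Definition zeros_mult (R : realType) (f : R[i] -> R[i]) : set (R[i] * nat) :=
  [set ak | cabs ak.1 < 1 /\ (0 < ak.2)%N /\ vanishes_to f ak.1 ak.2].

(* Main.v *)
Require Import Defs.
From HB Require Import structures.
From mathcomp Require Import all_boot all_order all_algebra.
From mathcomp Require Import complex.
From mathcomp Require Import all_classical all_reals all_analysis.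
From mathcomp Require Import ring lra.
Import Order.TTheory GRing.Theory Num.Theory numFieldNormedType.Exports.
Local Open Scope ring_scope.
Local Open Scope classical_set_scope.
Set Implicit Arguments.
Unset Strict Implicit.

(* Jensen's formula with a subharmonic weight: if [phi >= 0] vanishes near the
   circle, the sum of [phi] over the zeros of [f] is at most [(1/2pi) int log|f| lap phi],
   hence at most a multiple of [int u (lap phi)_+] when [log|f| <= u], up to a
   correction near the origin where [|f(0)| = 1] bounds [log|f|] from below. We take
   [phi] to be a truncation at a small level of the explicit weight
   [V = Y^a prod |z - xi_k|^beta_k |z - zeta_j|^(-b)], [Y = 1 - |z|^2], [a = p + 1 + eps],
   [beta_k = (q_k - 1 + eps)_+], [b = min (p, r_j)], which (after smoothing
   the last factor) is subharmonic near the circle, because the radial derivative of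
   [log V] dominates, and has [lap phi = O(V / Y^2)]. Then
   [u lap phi = O(K Y^(eps - 1) prod |z - xi_k|^(beta_k - q_k))] is integrable. Only one
   zeta_j is treated at a time, since the factors are far from each other.
   All integrals are replaced by sums over a square lattice and the Laplacian by
   second differences, so Green's formula is a discrete summation by parts; [log|f|]
   is regularized to [1/2 log(|f|^2 + d)] factor by factor. *)

(** * Uniform second-order Taylor expansions *)

(** The exponents come from two requirements. Near the circle a positive power [Y^d] is subharmonic
    only for [d > 1]; the factor at [zeta_j] can lower the effective exponent from [a] to [a - b],
    and [b <= p] keeps [a - b >= 1 + eps]. In [u lap phi] the powers at [zeta_j] cancel because
    [b <= r_j]. The smoothing of that factor is forced: on the radius ending at [zeta_j],
    [a log Y - b log |z - zeta_j|] has squared gradient about [4 (a - b)^2 / Y^2] but Laplacian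
    [- 4 a / Y^2], and [(a - b)^2 >= a] fails for large [p]. The obstacle is uniformity. Constants
    for the jets of [log|f|], the regularization and the lattice errors depend on [f] and on the
    finite list of zeros, while the final constant may not. They are therefore confined to errors
    that are pushed below an arbitrary tolerance by choosing, in this order, the truncation level,
    [d], the width of the correction at the origin and the mesh. What survives is the lattice sum of
    [u (lap phi)_+], whose bound does not see the truncation level. *)

Lemma mean_bound {R : realType} (g dg : R -> R) (a b B : R) :
  (forall x, `|x - a| <= `|b - a| -> is_derive x 1 g (dg x)) ->
  (forall x, `|x - a| <= `|b - a| -> `|dg x| <= B) ->
  `|g b - g a| <= B * `|b - a|.
Proof.
move=> gd gB.
have Hin (x c d : R) : x \in `[c, d]%R -> c <= x <= d by rewrite in_itv.
have cont (c d : R) : (forall x, x \in `[c, d]%R -> `|x - a| <= `|b - a|) ->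
  {within `[c, d], continuous g}.
  move=> H; apply: derivable_within_continuous => x xcd.
  by case: (gd x (H _ xcd)).
have [ab|ba|->] := ltgtP a b; last by rewrite !subrr normr0 mulr0.
- have H x : x \in `[a, b]%R -> `|x - a| <= `|b - a|.
    by move=> /Hin /andP[ax xb]; rewrite !ger0_norm; lra.
  have [c cab ->] : exists2 c, c \in `[a, b]%R & g b - g a = dg c * (b - a).
    apply: MVT_segment (ltW ab) _ (cont _ _ H) => x xab; apply: gd; apply: H.
    exact: subset_itv_oo_cc xab.
  by rewrite normrM ler_wpM2r// gB// H.
- have H x : x \in `[b, a]%R -> `|x - a| <= `|b - a|.
    move=> /Hin /andP[bx xa]; rewrite !ler0_norm; lra.
  have [c cab E] : exists2 c, c \in `[b, a]%R & g a - g b = dg c * (a - b).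
    apply: MVT_segment (ltW ba) _ (cont _ _ H) => x xab; apply: gd; apply: H.
    exact: subset_itv_oo_cc xab.
  by rewrite distrC E normrM [`|a - b|]distrC ler_wpM2r// gB// H.
Qed.

(** The mean value bound is applied first to [f1] minus its tangent, then to [f] minus its quadratic
    expansion. A Lipschitz bound on [f2] at [a] replaces a third derivative. *)
Lemma taylor2 {R : realType} (f f1 f2 : R -> R) (a b M : R) : 0 <= M ->
  (forall x, `|x - a| <= `|b - a| -> is_derive x 1 f (f1 x)) ->
  (forall x, `|x - a| <= `|b - a| -> is_derive x 1 f1 (f2 x)) ->
  (forall x, `|x - a| <= `|b - a| -> `|f2 x - f2 a| <= M * `|x - a|) ->
  `|f b - f a - f1 a * (b - a) - f2 a / 2 * (b - a) ^+ 2| <= M * `|b - a| ^+ 3.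
Proof.
move=> M0 d1 d2 L2.
have step1 x : `|x - a| <= `|b - a| ->
   `|f1 x - f1 a - f2 a * (x - a)| <= M * `|b - a| ^+ 2.
  move=> xa.
  have := @mean_bound R (fun x => f1 x - f2 a * (x - a)) (fun x => f2 x - f2 a)
    a x (M * `|b - a|).
  rewrite subrr mulr0 subr0.
  have -> : f1 x - f2 a * (x - a) - f1 a = f1 x - f1 a - f2 a * (x - a) by ring.
  move=> H; apply: le_trans (H _ _) _.
  - move=> y ya; have := d2 y (le_trans ya xa) => ?.
    apply: is_derive_eq.
    by rewrite /GRing.scale/= ; ring.
  - move=> y ya; apply: le_trans (L2 _ (le_trans ya xa)) _.
    by rewrite ler_wpM2l// (le_trans ya xa).
  - by rewrite expr2 mulrA ler_wpM2l// mulr_ge0.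
have := @mean_bound R (fun x => f x - f1 a * (x - a) - f2 a / 2 * (x - a) ^+ 2)
  (fun x => f1 x - f1 a - f2 a * (x - a)) a b (M * `|b - a| ^+ 2).
rewrite subrr expr0n/= !mulr0 !subr0.
have -> : f b - f1 a * (b - a) - f2 a / 2 * (b - a) ^+ 2 - f a =
  f b - f a - f1 a * (b - a) - f2 a / 2 * (b - a) ^+ 2 by ring.
have -> : M * `|b - a| ^+ 3 = M * `|b - a| ^+ 2 * `|b - a| by ring.
apply => // x xa.
have ? := d1 x xa.
apply: is_derive_eq.
by rewrite /GRing.scale/= ?expr1; field.
Qed.

(** The single constant [D] bounds the jet, the remainder and the inverse of the admissible radius,
    so estimates are combined by enlarging it. Only the base point [a] has to lie in [I]; [b] may
    leave it. *)
Definition utay {R : realType} (I : R -> Prop) (X X1 X2 : R -> R) :=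
  exists2 D, 1 <= D & forall a b, I a -> `|b - a| * D <= 1 ->
   [/\ `|X a| <= D, `|X1 a| <= D, `|X2 a| <= D &
   `|X b - X a - X1 a * (b - a) - X2 a / 2 * (b - a) ^+ 2| <= D * `|b - a| ^+ 3].

Lemma utay_deriv {R : realType} (I J : R -> Prop) (X X1 X2 : R -> R) (M : R) :
  1 <= M ->
  (forall a b, I a -> `|b - a| * M <= 1 -> J b) ->
  (forall x, J x -> is_derive x 1 X (X1 x)) ->
  (forall x, J x -> is_derive x 1 X1 (X2 x)) ->
  (forall x, J x -> [/\ `|X x| <= M, `|X1 x| <= M & `|X2 x| <= M]) ->
  (forall x y, J x -> J y -> `|X2 y - X2 x| <= M * `|y - x|) ->
  utay I X X1 X2.
Proof.
move=> M1 IJ d1 d2 B L; exists M => // a b Ia ab.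
have Ja : J a by apply: (IJ a) => //; rewrite subrr normr0 mul0r.
have [B0 B1 B2] := B a Ja; split => //.
have Jx x : `|x - a| <= `|b - a| -> J x.
  move=> xa; apply: (IJ a) => //; apply: le_trans ab.
  by rewrite ler_wpM2r//; lra.
apply: taylor2 => [|x xa|x xa|x xa]; first lra.
- by apply: d1; exact: Jx.
- by apply: d2; exact: Jx.
- by apply: L => //; exact: Jx.
Qed.

(* Precomposition with the positive part costs no regularity when the function
   vanishes to third order at 0. *)
Lemma utay_pos {R : realType} (B M : R) (X X1 X2 : R -> R) :
  X 0 = 0 -> X1 0 = 0 -> X2 0 = 0 -> 0 <= B -> 0 <= M ->
  (forall b, 0 <= b <= B -> `|X1 b| <= M * b ^+ 2 /\ `|X2 b| <= M * b) ->
  utay (fun a => 0 <= a <= B) X X1 X2 ->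
  utay (fun a => a <= B) (fun a => X (Num.max a 0)) (fun a => X1 (Num.max a 0))
    (fun a => X2 (Num.max a 0)).
Proof.
move=> X0 X10 X20 B0 M0 HX [D D1 H].
have D0 : 0 <= D by exact: le_trans D1.
exists (2 * D + 2 * M) => [|a b aB ab]; first lra.
have ab1 : `|b - a| * D <= 1.
  by apply: le_trans ab; rewrite ler_wpM2l//; lra.
have mB : 0 <= Num.max a 0 <= B by rewrite le_max lexx orbT/= ge_max aB.
have [B1 B2 B3 _] : [/\ `|X (Num.max a 0)| <= D, `|X1 (Num.max a 0)| <= D,
   `|X2 (Num.max a 0)| <= D & True].
  by have [] := H _ (Num.max a 0) mB; rewrite ?subrr ?normr0 ?mul0r ?ler01.
have D2 : D <= 2 * D + 2 * M by clear -D0 M0; lra.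
split; [exact: le_trans D2|exact: le_trans D2|exact: le_trans D2|].
have n3 : 0 <= `|b - a| ^+ 3 by rewrite exprn_ge0.
have DB : D * `|b - a| ^+ 3 <= (2 * D + 2 * M) * `|b - a| ^+ 3.
  by rewrite ler_wpM2r//; lra.
have I0 : 0 <= (0 : R) <= B by rewrite lexx.
have [a0|a0] := leP 0 a.
  rewrite (max_idPl a0) in mB *.
  have [b0|b0] := leP 0 b.
    by apply: le_trans DB; have [] := H a b mB ab1.
  (* For [b < 0 <= a] one has [a <= |b - a|], so each term of the expansion at [a] is itself cubic
     in [|b - a|]: [X a] by the expansion at 0, the other two by [HX]. *)
  have E : `|b - a| = a - b by rewrite ler0_norm; clear -a0 b0; lra.
  rewrite X0 E.
  have aab : a * D <= 1.
    by apply: le_trans ab1; rewrite E ler_wpM2r//; lra.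
  have [|_ _ _] := H 0 a I0; first by rewrite subr0 ger0_norm.
  rewrite X0 X10 X20 !subr0 mul0r !mul0r !subr0 (ger0_norm a0) => XA.
  have [X1a X2a] := HX a mB.
  have -> : b - a = - (a - b) by ring.
  set t := a - b in E *.
  have t0 : 0 <= t by rewrite -E.
  have at' : a <= t by rewrite /t; clear -b0; lra.
  have -> : 0 - X a - X1 a * - t - X2 a / 2 * (- t) ^+ 2 =
     - (X a - X1 a * t + X2 a / 2 * t ^+ 2) by ring.
  rewrite normrN.
  apply: le_trans (ler_normD _ _) _; apply: le_trans (lerD (ler_normB _ _) (lexx _)) _.
  have -> : `|X1 a * t| = `|X1 a| * t by rewrite normrM (ger0_norm t0).
  have -> : `|X2 a / 2 * t ^+ 2| = `|X2 a| * t ^+ 2 / 2.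
    by rewrite mulrAC normrM normrM (ger0_norm (exprn_ge0 2 t0)) (@ger0_norm _ 2^-1) ?invr_ge0.
  have e2 : a ^+ 2 <= t ^+ 2 by rewrite lerXn2r.
  have e3 : a ^+ 3 <= t ^+ 3 by rewrite lerXn2r.
  have h1 : `|X1 a| * t <= M * t ^+ 3.
    rewrite [t ^+ 3]exprSr mulrA ler_wpM2r//; apply: le_trans X1a _.
    by rewrite ler_wpM2l.
  have h2 : `|X2 a| * t ^+ 2 <= M * t ^+ 3.
    rewrite [t ^+ 3]exprS mulrA ler_wpM2r ?exprn_ge0//; apply: le_trans X2a _.
    by rewrite ler_wpM2l.
  have h3 : `|X a| <= D * t ^+ 3.
    by apply: le_trans XA _; rewrite ler_wpM2l//; lra.
  have h4 : 0 <= `|X2 a| * t ^+ 2 by rewrite mulr_ge0 ?exprn_ge0.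
  have h5 : 0 <= D * t ^+ 3 by rewrite mulr_ge0 ?exprn_ge0//; lra.
  have -> : (2 * D + 2 * M) * t ^+ 3 = 2 * (D * t ^+ 3) + 2 * (M * t ^+ 3) by ring.
  clear -h1 h2 h3 h4 h5; lra.
rewrite X0 X10 X20 !mul0r !subr0.
have [b0|b0] := leP b 0.
  by rewrite X0 normr0 mulr_ge0//; lra.
have E : `|b - a| = b - a by rewrite gtr0_norm; clear -a0 b0; lra.
have bD : b * D <= 1.
  by apply: le_trans ab1; rewrite E ler_wpM2r//; lra.
have [|_ _ _] := H 0 b I0; first by rewrite subr0 gtr0_norm.
rewrite X0 X10 X20 !subr0 mul0r !mul0r !subr0 (gtr0_norm b0) => XA.
apply: le_trans XA _; apply: le_trans DB.
by rewrite ler_wpM2l// lerXn2r ?nnegrE ?(ltW b0)// E; lra.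
Qed.

(* A family of real functions with second-order Taylor expansions at 0 whose
   remainders are uniform over [P]; [F0] stands for the values at 0. *)
Definition gjet {R : realType} (I : Type) (P : I -> Prop) (F : I -> R -> R)
    (F0 F1 F2 : I -> R) :=
  exists2 C, 1 <= C & forall i, P i ->
    [/\ `|F0 i| <= C, `|F1 i| <= C, `|F2 i| <= C &
     forall t, `|t| * C <= 1 ->
      `|F i t - F0 i - F1 i * t - F2 i / 2 * t ^+ 2| <= C * `|t| ^+ 3].

Lemma cube_le {R : realType} (C D t : R) : C <= D -> C * `|t| ^+ 3 <= D * `|t| ^+ 3.
Proof. by move=> CD; rewrite ler_wpM2r// exprn_ge0. Qed.

Lemma scaled_le {R : realType} (C D t : R) : C <= D -> `|t| * D <= 1 -> `|t| * C <= 1.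
Proof. by move=> CD; apply: le_trans; rewrite ler_wpM2l. Qed.

Lemma gjet_ext {R : realType} I (P : I -> Prop) (F G : I -> R -> R) F0 F1 F2 G0 G1 G2 :
  (forall i t, F i t = G i t) -> (forall i, P i -> F0 i = G0 i) ->
  (forall i, P i -> F1 i = G1 i) -> (forall i, P i -> F2 i = G2 i) ->
  gjet P F F0 F1 F2 -> gjet P G G0 G1 G2.
Proof.
move=> E E0 E1 E2 [C C1 H]; exists C => // i Pi.
have := H i Pi; rewrite E0// E1// E2// => -[? ? ? K]; split => // t /K.
by rewrite E.
Qed.

(** Agreement for small [t] is enough; this is how the cut-off [0 < Y] in [ptest] is ignored away
    from the circle. *)
Lemma gjet_eqloc {R : realType} I (P : I -> Prop) (F G : I -> R -> R) F0 F1 F2 C0 :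
  0 <= C0 -> (forall i t, P i -> `|t| * C0 <= 1 -> F i t = G i t) ->
  gjet P F F0 F1 F2 -> gjet P G F0 F1 F2.
Proof.
move=> C00 E [C C1 H]; exists (C + C0) => [|i Pi]; first lra.
have [h0 h1 h2 h3] := H i Pi; split; [lra|lra|lra|].
move=> t tC; rewrite -E//; last by apply: scaled_le tC; lra.
apply: le_trans (h3 t _) _; first by apply: scaled_le tC; lra.
by apply: cube_le; lra.
Qed.

Lemma gjet_cst {R : realType} I (P : I -> Prop) (c : R) :
  gjet P (fun _ _ => c) (fun=> c) (fun=> 0) (fun=> 0).
Proof.
exists (1 + `|c|) => [|i _]; first by rewrite lerDl.
rewrite normr0; have := normr_ge0 c; split; [lra|lra|lra|].
move=> t _; rewrite subrr !mul0r !subr0 normr0 mulr_ge0 ?exprn_ge0//; lra.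
Qed.

Lemma gjetD {R : realType} I (P : I -> Prop) (F G : I -> R -> R) F0 F1 F2 G0 G1 G2 :
  gjet P F F0 F1 F2 -> gjet P G G0 G1 G2 ->
  gjet P (fun i t => F i t + G i t) (fun i => F0 i + G0 i)
    (fun i => F1 i + G1 i) (fun i => F2 i + G2 i).
Proof.
move=> [C C1 H] [D D1 K]; exists (C + D) => [|i Pi]; first lra.
have [h0 h1 h2 h3] := H i Pi; have [k0 k1 k2 k3] := K i Pi.
split; [| | |move=> t tC].
- by apply: le_trans (ler_normD _ _) _; lra.
- by apply: le_trans (ler_normD _ _) _; lra.
- by apply: le_trans (ler_normD _ _) _; lra.
have -> : F i t + G i t - (F0 i + G0 i) - (F1 i + G1 i) * t -
  (F2 i + G2 i) / 2 * t ^+ 2 =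
  (F i t - F0 i - F1 i * t - F2 i / 2 * t ^+ 2) +
  (G i t - G0 i - G1 i * t - G2 i / 2 * t ^+ 2) by ring.
apply: le_trans (ler_normD _ _) _; rewrite mulrDl; apply: lerD.
  by apply: h3; apply: scaled_le tC; lra.
by apply: k3; apply: scaled_le tC; lra.
Qed.

Lemma gjetZ {R : realType} I (P : I -> Prop) (F : I -> R -> R) F0 F1 F2 (c : R) :
  gjet P F F0 F1 F2 ->
  gjet P (fun i t => c * F i t) (fun i => c * F0 i) (fun i => c * F1 i)
    (fun i => c * F2 i).
Proof.
move=> [C C1 H]; exists ((1 + `|c|) * C) => [|i Pi].
  by rewrite mulrDl mul1r ler_wpDr// mulr_ge0//; lra.
have cC : C <= (1 + `|c|) * C by rewrite mulrDl mul1r lerDl mulr_ge0//; lra.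
have hc x : `|x| <= C -> `|c * x| <= (1 + `|c|) * C.
  move=> xC; rewrite normrM; apply: ler_pM => //; lra.
have [h0 h1 h2 h3] := H i Pi; split; [exact: hc|exact: hc|exact: hc|].
move=> t tC.
have -> : c * F i t - c * F0 i - c * F1 i * t - c * F2 i / 2 * t ^+ 2 =
   c * (F i t - F0 i - F1 i * t - F2 i / 2 * t ^+ 2) by ring.
rewrite normrM -(mulrA (1 + `|c|)); apply: ler_pM => //; first lra.
by apply: h3; apply: scaled_le tC.
Qed.

Lemma gjet_sum {R : realType} I (P : I -> Prop) (K : Type) (s : seq K)
    (F : K -> I -> R -> R) (F0 F1 F2 : K -> I -> R) :
  (forall k, gjet P (F k) (F0 k) (F1 k) (F2 k)) ->
  gjet P (fun i t => \sum_(k <- s) F k i t) (fun i => \sum_(k <- s) F0 k i)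
    (fun i => \sum_(k <- s) F1 k i) (fun i => \sum_(k <- s) F2 k i).
Proof.
move=> H; elim: s => [|k s IH].
  by apply: gjet_ext (gjet_cst P 0) => *; rewrite big_nil.
by apply: gjet_ext (gjetD (H k) IH) => *; rewrite big_cons.
Qed.

Lemma gjet_comp {R : realType} I (P : I -> Prop) (J : R -> Prop) X X1 X2
    (F : I -> R -> R) F0 F1 F2 :
  utay J X X1 X2 -> (forall i, P i -> J (F0 i)) -> gjet P F F0 F1 F2 ->
  gjet P (fun i t => X (F i t)) (fun i => X (F0 i)) (fun i => X1 (F0 i) * F1 i)
   (fun i => X1 (F0 i) * F2 i + X2 (F0 i) * F1 i ^+ 2).
Proof.
move=> [D D1 T] IF [C C1 H].
have C0 : 0 <= C by exact: le_trans C1.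
have D0 : 0 <= D by exact: le_trans D1.
have C3 : 1 <= C ^+ 3 by rewrite exprn_ege1.
have CC2 : C <= C ^+ 2 by rewrite ler_eXnr.
have CC3 : C ^+ 2 <= C ^+ 3 by rewrite ler_weXn2l.
have DC3 : D <= D * C ^+ 3 by rewrite ler_peMr//; lra.
have CD3 : C ^+ 3 <= D * C ^+ 3 by rewrite ler_peMl//; lra.
have DC : D * C <= D * C ^+ 3 by rewrite ler_wpM2l//; lra.
have DC2 : D * C ^+ 2 <= D * C ^+ 3 by rewrite ler_wpM2l//; lra.
(* The constant is generous: the three remainders below add up to [36 D C^3 |t|^3], and [3 C |t|],
   which bounds the increment of [F i], must stay below [1 / D]. *)
exists (100 * (D * C ^+ 3)) => [|i Pi]; first by lra.
have [h0 h1 h2 h3] := H i Pi.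
have [a0 a1 a2 _] := T (F0 i) (F0 i) (IF i Pi) (ltac:(by rewrite subrr normr0 mul0r)).
have p1 : `|X1 (F0 i) * F1 i| <= D * C by rewrite normrM ler_pM.
have p2 : `|X1 (F0 i) * F2 i| <= D * C by rewrite normrM ler_pM.
have p3 : `|X2 (F0 i) * F1 i ^+ 2| <= D * C ^+ 2.
  by rewrite normrM ler_pM// normrX lerXn2r// ?nnegrE//; lra.
split; [clear -a0 DC3 D1; lra|clear -p1 DC CD3 C3; lra| |].
  by apply: le_trans (ler_normD _ _) _; lra.
move=> t tC.
have tC1 : `|t| * C <= 1 by apply: scaled_le tC; lra.
have t1 : `|t| <= 1 by rewrite -[`|t|]mulr1; apply: scaled_le tC; lra.
have := h3 t tC1.
set d := F i t - F0 i.
set r := d - F1 i * t - F2 i / 2 * t ^+ 2 => rb.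
have dE : d = F1 i * t + F2 i / 2 * t ^+ 2 + r by rewrite /r; ring.
have t0 := normr_ge0 t.
have t2 : `|t| ^+ 2 <= `|t| by rewrite -{2}[`|t|]expr1 ler_wiXn2l.
have t3 : `|t| ^+ 3 <= `|t| ^+ 2 by rewrite ler_wiXn2l.
have n2 : `|F2 i / 2 * t ^+ 2| <= C * `|t| ^+ 2.
  by rewrite normrM normrX ler_wpM2r ?exprn_ge0// normrM (@ger0_norm _ 2^-1) ?invr_ge0//; clear -h2 C0; lra.
have n1 : `|F1 i * t| <= C * `|t| by rewrite normrM ler_wpM2r.
set w := F2 i / 2 * t ^+ 2 + r.
have wb : `|w| <= 2 * C * `|t| ^+ 2.
  apply: le_trans (ler_normD _ _) _.
  have : C * `|t| ^+ 3 <= C * `|t| ^+ 2 by rewrite ler_wpM2l//; lra.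
  have -> : 2 * C * `|t| ^+ 2 = C * `|t| ^+ 2 + C * `|t| ^+ 2 by ring.
  clear -n2 rb; lra.
have db : `|d| <= 3 * C * `|t|.
  rewrite dE -addrA -/w; apply: le_trans (ler_normD _ _) _.
  have : 2 * C * `|t| ^+ 2 <= 2 * C * `|t| by rewrite ler_wpM2l// mulr_ge0.
  clear -n1 wb; lra.
have dD : `|d| * D <= 1.
  apply: le_trans (_ : 3 * C * `|t| * D <= 1).
    by rewrite ler_wpM2r//; lra.
  have -> : 3 * C * `|t| * D = `|t| * (3 * (D * C)) by ring.
  by apply: scaled_le tC; clear -DC CD3 C3; lra.
have [_ _ _] := T (F0 i) (F i t) (IF i Pi) dD.
rewrite -/d => Tb.
(* The outer remainder is isolated, and [d^2 - (F1 t)^2] is factored as [w (d + F1 t)] with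
   [w = d - F1 t] quadratic in [t]. *)
have -> : X (F i t) - X (F0 i) - X1 (F0 i) * F1 i * t -
    (X1 (F0 i) * F2 i + X2 (F0 i) * F1 i ^+ 2) / 2 * t ^+ 2 =
  (X (F i t) - X (F0 i) - X1 (F0 i) * d - X2 (F0 i) / 2 * d ^+ 2) +
  X1 (F0 i) * r + X2 (F0 i) / 2 * (w * (d + F1 i * t)).
  have -> : w = d - F1 i * t by rewrite /w /r; ring.
  by rewrite /r; field.
have g1 : `|X1 (F0 i) * r| <= D * C * `|t| ^+ 3.
  by rewrite normrM -mulrA ler_pM.
have g2 : `|X2 (F0 i) / 2 * (w * (d + F1 i * t))| <= 8 * (D * C ^+ 2) * `|t| ^+ 3.
  have q1 : `|d + F1 i * t| <= 4 * C * `|t|.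
    by apply: le_trans (ler_normD _ _) _; clear -db n1; lra.
  have q2 : `|w * (d + F1 i * t)| <= 8 * C ^+ 2 * `|t| ^+ 3.
    rewrite normrM; have -> : 8 * C ^+ 2 * `|t| ^+ 3 = (2 * C * `|t| ^+ 2) * (4 * C * `|t|) by ring.
    by rewrite ler_pM.
  have -> : 8 * (D * C ^+ 2) * `|t| ^+ 3 = D * (8 * C ^+ 2 * `|t| ^+ 3) by ring.
  rewrite normrM; apply: ler_pM => //.
  by rewrite normrM (@ger0_norm _ 2^-1) ?invr_ge0//; clear -a2 D0; lra.
have g3 : D * `|d| ^+ 3 <= 27 * (D * C ^+ 3) * `|t| ^+ 3.
  have -> : 27 * (D * C ^+ 3) * `|t| ^+ 3 = D * (3 * C * `|t|) ^+ 3 by ring.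
  by rewrite ler_wpM2l ?lerXn2r// nnegrE; apply: mulr_ge0 => //; exact: mulr_ge0.
apply: le_trans (ler_normD _ _) _.
apply: le_trans (lerD (ler_normD _ _) (lexx _)) _.
have k1 : D * C * `|t| ^+ 3 <= D * C ^+ 3 * `|t| ^+ 3 by exact: cube_le.
have k2 : D * C ^+ 2 * `|t| ^+ 3 <= D * C ^+ 3 * `|t| ^+ 3 by exact: cube_le.
have k3 : 0 <= D * C ^+ 3 * `|t| ^+ 3 by apply: mulr_ge0; [apply: mulr_ge0 => //|]; exact: exprn_ge0.
move: g1 g2 g3 Tb k1 k2 k3; clear; lra.
Qed.

Lemma gjet_lip {R : realType} I (P : I -> Prop) (F : I -> R -> R) F0 F1 F2 :
  gjet P F F0 F1 F2 ->
  exists2 C, 1 <= C & forall i t, P i -> `|t| * C <= 1 -> `|F i t - F0 i| <= C * `|t|.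
Proof.
move=> [C C1 H]; exists (3 * C) => [|i t Pi tC]; first lra.
have tC' : `|t| * C <= 1 by apply: scaled_le tC; lra.
have t1 : `|t| <= 1 by rewrite -[`|t|]mulr1; apply: scaled_le tC; lra.
have [_ h1 h2 /(_ t tC') h3] := H i Pi.
have t0 := normr_ge0 t.
have t2 : `|t| ^+ 2 <= `|t| by rewrite -{2}[`|t|]expr1 ler_wiXn2l.
have t3 : `|t| ^+ 3 <= `|t| by rewrite -{2}[`|t|]expr1 ler_wiXn2l.
have n2 : `|F2 i / 2 * t ^+ 2| <= C * `|t|.
  rewrite normrM normrX; apply: ler_pM => //.
  by rewrite normrM (@ger0_norm _ 2^-1) ?invr_ge0//; lra.
have n1 : `|F1 i * t| <= C * `|t| by rewrite normrM ler_wpM2r.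
have n3 : C * `|t| ^+ 3 <= C * `|t| by rewrite ler_wpM2l//; lra.
set r := F i t - F0 i - F1 i * t - F2 i / 2 * t ^+ 2 in h3.
have -> : F i t - F0 i = r + F1 i * t + F2 i / 2 * t ^+ 2 by rewrite /r; ring.
apply: le_trans (ler_normD _ _) _.
apply: le_trans (lerD (ler_normD _ _) (lexx _)) _.
lra.
Qed.

(* Second differences along the two axes: [i] carries the direction as a bool. *)
Lemma gjet_lap {R : realType} I (P : I -> Prop) (F : bool * I -> R -> R) F0 F1 F2 :
  gjet (fun i => P i.2) F (fun i => F0 i.2) F1 F2 ->
  exists2 C, 1 <= C & forall i h, P i -> 0 < h -> h * C <= 1 ->
   `|F (true, i) h + F (true, i) (- h) + F (false, i) h + F (false, i) (- h) - 4 * F0 i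
     - h ^+ 2 * (F2 (true, i) + F2 (false, i))| <= C * h ^+ 3.
Proof.
move=> [C C1 H]; exists (4 * C) => [|i h Pi h0 hC]; first lra.
have hC' : `|h| * C <= 1.
  by apply: scaled_le (_ : `|h| * (4 * C) <= 1); [lra|rewrite gtr0_norm].
have [_ _ _ k1] := H (true, i) Pi; have [_ _ _ k2] := H (false, i) Pi.
have := k1 h hC'; have := k1 (- h); rewrite normrN => /(_ hC').
have := k2 h hC'; have := k2 (- h); rewrite normrN => /(_ hC').
rewrite (gtr0_norm h0) sqrrN !ler_norml => /andP[a1 a2] /andP[b1 b2] /andP[c1 c2] /andP[d1 d2].
apply/andP; split; lra.
Qed.

Definition pt (R : realType) : Type := (R * R)%type.

Definition sh {R : realType} (e : bool) (z : pt R) (t : R) : pt R :=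
  if e then (z.1 + t, z.2) else (z.1, z.2 + t).

(** Only jets along the two coordinate axes are recorded: the five-point Laplacian never sees mixed
    derivatives. *)
Definition ujet {R : realType} (P : pt R -> Prop) (F : pt R -> R)
    (F1 F2 : bool -> pt R -> R) :=
  gjet (fun i : bool * pt R => P i.2) (fun i t => F (sh i.1 i.2 t))
    (fun i => F i.2) (fun i => F1 i.1 i.2) (fun i => F2 i.1 i.2).

Definition lap {R : realType} (F : pt R -> R) (z : pt R) (h : R) : R :=
  F (sh true z h) + F (sh true z (- h)) + F (sh false z h) + F (sh false z (- h))
  - 4 * F z.

Lemma ujet_lap {R : realType} (P : pt R -> Prop) F F1 F2 :
  @ujet R P F F1 F2 ->
  exists2 C, 1 <= C & forall z h, P z -> 0 < h -> h * C <= 1 ->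
   `|lap F z h - h ^+ 2 * (F2 true z + F2 false z)| <= C * h ^+ 3.
Proof. by move=> /(@gjet_lap R (pt R) P)[C C1 H]; exists C. Qed.

(** * Sums over the square lattice *)

(** The difference of the two sides telescopes through the discrete Wronskian [w]; the four
    vanishing values of [u] kill [w] at both ends. *)
Lemma sum_parts1 {R : realType} (n : nat) (u v : nat -> R) :
  u 0%N = 0 -> u 1%N = 0 -> u n = 0 -> u n.+1 = 0 ->
  \sum_(1 <= i < n.+1) v i * (u i.+1 + u i.-1 - 2 * u i) =
  \sum_(1 <= i < n.+1) u i * (v i.+1 + v i.-1 - 2 * v i).
Proof.
move=> u0 u1 un un1; apply/eqP; rewrite -subr_eq0 -sumrB; apply/eqP.
pose w i := v i * u i.+1 - v i.+1 * u i.
have -> : \sum_(1 <= i < n.+1) (v i * (u i.+1 + u i.-1 - 2 * u i) -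
     u i * (v i.+1 + v i.-1 - 2 * v i)) = \sum_(1 <= i < n.+1) (w i - w i.-1).
  apply: eq_big_nat => i /andP[i1 _]; rewrite /w prednK//; ring.
have -> : \sum_(1 <= i < n.+1) (w i - w i.-1) = w n - w 0%N.
  by rewrite big_add1/= telescope_sumr.
by rewrite /w un un1 u0 u1; ring.
Qed.

(** With [h * N = 1] and indices from 1 to [4 * N] the lattice fills the square of side 4 centred at
    0. The disc lies well inside, so functions supported in it vanish on the outer rows needed for
    summation by parts. *)
Definition grid {R : realType} (h : R) (i j : nat) : pt R := (i%:R * h - 2, j%:R * h - 2).

Definition gsum {R : realType} (n : nat) (h : R) (F : pt R -> R) : R :=
  \sum_(1 <= i < n.+1) \sum_(1 <= j < n.+1) h ^+ 2 * F (grid h i j).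

Lemma grid_sh {R : realType} (h : R) (i j : nat) : (0 < i)%N -> (0 < j)%N ->
  [/\ sh true (grid h i j) h = grid h i.+1 j,
      sh true (grid h i j) (- h) = grid h i.-1 j,
      sh false (grid h i j) h = grid h i j.+1 &
      sh false (grid h i j) (- h) = grid h i j.-1].
Proof.
case: i => // i; case: j => // j _ _; rewrite /sh /grid/=; split;
  congr pair; rewrite -?natr1; ring.
Qed.

Lemma gsumD {R : realType} n h (F G : pt R -> R) :
  gsum n h (fun z => F z + G z) = gsum n h F + gsum n h G.
Proof.
rewrite /gsum -big_split/=; apply: eq_bigr => i _; rewrite -big_split/=.
by apply: eq_bigr => j _; rewrite mulrDr.
Qed.

Lemma gsumZ {R : realType} n h c (F : pt R -> R) :
  gsum n h (fun z => c * F z) = c * gsum n h F.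
Proof.
rewrite /gsum mulr_sumr; apply: eq_bigr => i _; rewrite mulr_sumr.
by apply: eq_bigr => j _; ring.
Qed.

Lemma gsum_big {R : realType} n h (I : Type) (s : seq I) (F : I -> pt R -> R) :
  gsum n h (fun z => \sum_(i <- s) F i z) = \sum_(i <- s) gsum n h (F i).
Proof.
elim: s => [|i s IH].
  rewrite big_nil /gsum big1// => i _; rewrite big1// => j _.
  by rewrite big_nil mulr0.
rewrite big_cons -IH -gsumD /gsum; apply: eq_bigr => k _; apply: eq_bigr => j _.
by rewrite big_cons.
Qed.

Lemma ler_gsum {R : realType} n h (F G : pt R -> R) :
  (forall i j, F (grid h i j) <= G (grid h i j)) -> gsum n h F <= gsum n h G.
Proof.
move=> FG; apply: ler_sum => i _; apply: ler_sum => j _.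
by rewrite ler_wpM2l// sqr_ge0.
Qed.

Lemma gsum_ge0 {R : realType} n h (F : pt R -> R) :
  (forall z, 0 <= F z) -> 0 <= gsum n h F.
Proof.
move=> F0; apply: sumr_ge0 => i _; apply: sumr_ge0 => j _.
by rewrite mulr_ge0// sqr_ge0.
Qed.

Lemma gsum_cst {R : realType} N (h c : R) : h * N%:R = 1 ->
  gsum (4 * N) h (fun=> c) = 16 * c.
Proof.
move=> hN; rewrite /gsum.
rewrite (eq_bigr (fun=> (4 * N)%:R * (h ^+ 2 * c))); last first.
  by move=> i _; rewrite sumr_const_nat subSS subn0 mulr_natl.
rewrite sumr_const_nat subSS subn0 -[_ *+ (4 * N)]mulr_natl natrM.
set M := N%:R in hN *.
have -> : 4 * M * (4 * M * (h ^+ 2 * c)) = 16 * c * (h * M) ^+ 2 by ring.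
by rewrite hN expr1n mulr1.
Qed.

Lemma gsum_lap {R : realType} N (h : R) (u v : pt R -> R) : h * N%:R = 1 ->
  (0 < N)%N ->
  (forall z, 1 <= `|z.1| \/ 1 <= `|z.2| -> u z = 0) ->
  gsum (4 * N) h (fun z => v z * lap u z h) = gsum (4 * N) h (fun z => u z * lap v z h).
Proof.
move=> hN N0 uz; set n := (4 * N)%N.
have h0 : 0 < h.
  have : (0 : R) < N%:R by rewrite ltr0n.
  by move=> Np; rewrite -(pmulr_lgt0 _ Np) hN.
have h1 : h <= 1 by rewrite -hN ler_peMr ?ler1n// ltW.
have nh : n%:R * h = 4 by rewrite natrM -mulrA [N%:R * h]mulrC hN mulr1.
have outside (i : nat) : i \in [:: 0; 1; n; n.+1]%N -> 1 <= `|i%:R * h - 2|.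
  rewrite !inE => /or4P[] /eqP ->.
  - by rewrite mul0r sub0r normrN ger0_norm; lra.
  - by rewrite mul1r ler0_norm; lra.
  - by rewrite nh ger0_norm; lra.
  - by rewrite -natr1 mulrDl nh mul1r ger0_norm; lra.
have split_lap (f g : pt R -> R) i j : (0 < i)%N -> (0 < j)%N ->
   f (grid h i j) * lap g (grid h i j) h =
   f (grid h i j) * (g (grid h i.+1 j) + g (grid h i.-1 j) - 2 * g (grid h i j)) +
   f (grid h i j) * (g (grid h i j.+1) + g (grid h i j.-1) - 2 * g (grid h i j)).
  by move=> i0 j0; rewrite /lap; have [-> -> -> ->] := grid_sh h i0 j0; ring.
have split_sum (f g : pt R -> R) : gsum n h (fun z => f z * lap g z h) =
  h ^+ 2 * (\sum_(1 <= j < n.+1) \sum_(1 <= i < n.+1)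
    f (grid h i j) * (g (grid h i.+1 j) + g (grid h i.-1 j) - 2 * g (grid h i j)) +
   \sum_(1 <= i < n.+1) \sum_(1 <= j < n.+1)
    f (grid h i j) * (g (grid h i j.+1) + g (grid h i j.-1) - 2 * g (grid h i j))).
  rewrite exchange_big/= -big_split/= mulr_sumr /gsum.
  apply: eq_big_nat => i /andP[i0 _]; rewrite -big_split/= mulr_sumr.
  by apply: eq_big_nat => j /andP[j0 _]; rewrite split_lap.
rewrite !split_sum; congr (_ * (_ + _)); apply: eq_bigr => k _.
  apply: (@sum_parts1 _ n (fun i => u (grid h i k)) (fun i => v (grid h i k))).
  1-4: by apply: uz; left; apply: outside; rewrite !inE eqxx ?orbT.
apply: (@sum_parts1 _ n (fun i => u (grid h k i)) (fun i => v (grid h k i))).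
1-4: by apply: uz; right; apply: outside; rewrite !inE eqxx ?orbT.
Qed.

(** Concavity of the power [e], with the tangent taken at the right end [s + h], so that the
    estimate survives at [s = 0]. *)
Lemma powR_step {R : realType} (e s h : R) : 0 < e -> e <= 1 -> 0 <= s -> 0 < h ->
  e * (h * (s + h) `^ (e - 1)) <= (s + h) `^ e - s `^ e.
Proof.
move=> e0 e1; rewrite le_eqVlt => /orP[/eqP <- h0|s0 h0].
  rewrite !add0r powR0 ?gt_eqF// subr0.
  by rewrite mulr_powRB1 ?(ltW h0)// ler_piMl// powR_ge0.
set t := s + h; have t0 : 0 < t by rewrite addr_gt0.
(* Bernoulli's inequality for exponents in (0, 1], obtained from [1 + x <= expR x] at [(1 - e) a]
   and at [- (e a)]. *)
have key : (s / t) `^ e <= 1 + e * (s / t - 1).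
  have x0 : 0 < s / t by rewrite divr_gt0.
  set a := ln (s / t).
  have E : s / t = expR a by rewrite lnK.
  have -> : (s / t) `^ e = expR (e * a) by rewrite E expRM_natl' || rewrite /powR gt_eqF.
  have -> : s / t = expR (e * a) * expR ((1 - e) * a).
    by rewrite E -expRD; congr expR; ring.
  have p0 := expR_gt0 (e * a).
  have k1 := expR_ge1Dx ((1 - e) * a).
  have k2 := expR_ge1Dx (- (e * a)).
  have k3 : expR (e * a) * expR (- (e * a)) = 1 by rewrite -expRD subrr expR0.
  have : 1 <= e * expR ((1 - e) * a) + (1 - e) * expR (- (e * a)).
    have : e * (1 + (1 - e) * a) <= e * expR ((1 - e) * a) by rewrite ler_wpM2l// ltW.
    have : (1 - e) * (1 + - (e * a)) <= (1 - e) * expR (- (e * a)).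
      by rewrite ler_wpM2l// subr_ge0.
    lra.
  rewrite -(ler_pM2l p0) mulr1 mulrDr => H; apply: le_trans H _.
  have -> : expR (e * a) * ((1 - e) * expR (- (e * a))) =
     (1 - e) * (expR (e * a) * expR (- (e * a))) by ring.
  rewrite k3; lra.
have -> : s `^ e = t `^ e * (s / t) `^ e.
  rewrite -powRM ?ltW ?divr_gt0//; congr (_ `^ _); rewrite mulrC divfK// gt_eqF//.
have tE : t `^ e = t * t `^ (e - 1) by rewrite mulr_powRB1// ltW.
have tp : 0 < t `^ (e - 1) by rewrite powR_gt0.
have : t `^ e * (s / t) `^ e <= t `^ e * (1 + e * (s / t - 1)).
  by rewrite ler_wpM2l// powR_ge0.
have -> : t `^ e * (1 + e * (s / t - 1)) = t `^ e - e * (h * t `^ (e - 1)).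
  rewrite tE /t; field; rewrite gt_eqF//.
lra.
Qed.

(** The singularity [|s|^(- th)] shifted by the mesh: finite at a lattice point that hits it, and of
    the form treated by [powR_step]. *)
Definition bump {R : realType} (th h s : R) : R := (`|s| + h) `^ (- th).

Lemma bump_ge0 {R : realType} (th h s : R) : 0 <= bump th h s.
Proof. exact: powR_ge0. Qed.

(** A discrete integral test for an integrable singularity, uniform in its position [c] and in the
    mesh. The 5 bounds the distance from [c] to the ends of the lattice, one mesh included. *)
Lemma sum_bump {R : realType} (th : R) : 0 <= th < 1 ->
  exists2 C, 0 < C & forall N (h c : R), h * N%:R = 1 -> (0 < N)%N -> `|c| <= 2 ->
   \sum_(1 <= i < (4 * N).+1) h * bump th h (i%:R * h - 2 - c) <= C.
Proof.
move=> /andP[th0 th1]; pose e := 1 - th.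
have e0 : 0 < e by rewrite subr_gt0.
have e1 : e <= 1 by rewrite /e; lra.
exists (2 * 5 `^ e / e) => [|N h c hN N0 c2]; first by rewrite divr_gt0// mulr_gt0// powR_gt0.
have h0 : 0 < h.
  have : (0 : R) < N%:R by rewrite ltr0n.
  by move=> Np; rewrite -(pmulr_lgt0 _ Np) hN.
have h1 : h <= 1 by rewrite -hN ler_peMr ?ler1n// ltW.
have nh : (4 * N)%:R * h = 4 by rewrite natrM -mulrA [N%:R * h]mulrC hN mulr1.
pose G (s : R) := (Num.max s 0) `^ e.
have G0 s : 0 <= G s by exact: powR_ge0.
have Gm s t : s <= t -> G s <= G t.
  move=> st; apply: ge0_ler_powR; rewrite ?nnegrE ?le_max ?lexx ?orbT//; first exact: ltW.
  by rewrite /Num.max; case: ltP; case: ltP; lra.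
(* [g] is a primitive to the right of [c] and [k] one to its left. The increments of both are
   nonnegative everywhere, so their sum dominates the bump on either side. *)
pose g i := G (i%:R * h - 2 - c).
pose k i := - G (c - (i%:R * h - 2)).
have main t : 0 <= t -> h * bump th h t <= e^-1 * (G (t + h) - G t).
  move=> t0; rewrite ler_pdivlMl// /G /bump ger0_norm// !(elimT max_idPl) ?addr_ge0 ?(ltW h0)//.
  have -> : - th = e - 1 by rewrite /e; ring.
  exact: powR_step.
have step i : (0 < i)%N -> h * bump th h (i%:R * h - 2 - c) <=
   e^-1 * (g i.+1 - g i) + e^-1 * (k i - k i.-1).
  case: i => // i _; rewrite /g /k /=.
  set s := i.+1%:R * h - 2 - c.
  have -> : i.+2%:R * h - 2 - c = s + h by rewrite /s -[i.+2%:R]natr1; ring.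
  have -> : c - (i.+1%:R * h - 2) = - s by rewrite /s; ring.
  have -> : c - (i%:R * h - 2) = - s + h by rewrite /s -natr1; ring.
  have p1 : 0 <= e^-1 * (G (s + h) - G s).
    by rewrite mulr_ge0 ?invr_ge0 ?(ltW e0)// subr_ge0 Gm//; lra.
  have p2 : 0 <= e^-1 * (- G (- s) - - G (- s + h)).
    by rewrite mulr_ge0 ?invr_ge0 ?(ltW e0)// opprK addrC subr_ge0 Gm//; lra.
  have [s0|s0] := leP 0 s; first by have := main s s0; lra.
  have := main (- s); rewrite /bump normrN => H.
  have := H (ltac:(lra)); lra.
apply: le_trans (_ : \sum_(1 <= i < (4 * N).+1)
    (e^-1 * (g i.+1 - g i) + e^-1 * (k i - k i.-1)) <= _).
  by apply: ler_sum_nat => i /andP[i0 _]; exact: step.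
rewrite big_split/= -!mulr_sumr telescope_sumr//.
rewrite [X in _ + _ * X](_ : _ = k (4 * N)%N - k 0%N); last first.
  by rewrite big_add1/= telescope_sumr.
rewrite -mulrDr mulrC ler_wpM2r ?invr_ge0 ?(ltW e0)//.
have := c2; rewrite ler_norml => /andP[c2a c2b].
have g1 : g (4 * N).+1 <= 5 `^ e.
  rewrite (_ : 5 = Num.max 5 0); last by rewrite (elimT max_idPl).
  by apply: Gm; rewrite -natr1 mulrDl nh; lra.
have k1 : - k 0%N <= 5 `^ e.
  rewrite /k opprK mul0r (_ : 5 = Num.max 5 0); last by rewrite (elimT max_idPl).
  by apply: Gm; lra.
have g0 : 0 <= g 1%N by exact: G0.
have k0 : k (4 * N)%N <= 0 by rewrite /k oppr_le0.
lra.
Qed.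

(** * Power series and division by the zeros *)

Lemma cabs_ge0 {R : realType} (z : R[i]) : 0 <= cabs z.
Proof. by case: z => x y; rewrite /cabs /= sqrtr_ge0. Qed.

Lemma cabsM {R : realType} (z w : R[i]) : cabs (z * w) = cabs z * cabs w.
Proof. exact: Normc.normcM. Qed.

Lemma cabsD {R : realType} (z w : R[i]) : cabs (z + w) <= cabs z + cabs w.
Proof. exact: le_normcD. Qed.

Lemma cabsN {R : realType} (z : R[i]) : cabs (- z) = cabs z.
Proof. exact: normcN. Qed.

Lemma cabs0 {R : realType} : cabs (0 : R[i]) = 0.
Proof. exact: Normc.normc0. Qed.

Lemma cabs1 {R : realType} : cabs (1 : R[i]) = 1.
Proof. exact: Normc.normc1. Qed.

Lemma cabs_eq0 {R : realType} (z : R[i]) : (cabs z == 0) = (z == 0).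
Proof.
by apply/eqP/eqP => [/Normc.eq0_normc//|->]; exact: cabs0.
Qed.

Lemma cabsB {R : realType} (z w : R[i]) : cabs (z - w) = cabs (w - z).
Proof. by rewrite -cabsN opprB. Qed.

Lemma cabsX {R : realType} (z : R[i]) n : cabs (z ^+ n) = cabs z ^+ n.
Proof. by elim: n => [|n IH]; rewrite ?expr0 ?cabs1// !exprS cabsM IH. Qed.

Lemma cabs_sq {R : realType} (z : R[i]) : cabs z ^+ 2 = complex.Re z ^+ 2 + complex.Im z ^+ 2.
Proof. by case: z => x y; rewrite /cabs/= sqr_sqrtr ?addr_ge0 ?sqr_ge0. Qed.

Lemma Re_le_cabs {R : realType} (z : R[i]) : `|complex.Re z| <= cabs z.
Proof.
rewrite -(@ler_pXn2r _ 2)// ?nnegrE ?cabs_ge0// cabs_sq real_normK ?num_real//.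
by rewrite lerDl sqr_ge0.
Qed.

Lemma Im_le_cabs {R : realType} (z : R[i]) : `|complex.Im z| <= cabs z.
Proof.
rewrite -(@ler_pXn2r _ 2)// ?nnegrE ?cabs_ge0// cabs_sq real_normK ?num_real//.
by rewrite lerDr sqr_ge0.
Qed.

Lemma cabs_prod {R : realType} (I : Type) (s : seq I) (F : I -> R[i]) :
  cabs (\prod_(i <- s) F i) = \prod_(i <- s) cabs (F i).
Proof.
by elim: s => [|i s IH]; rewrite ?big_nil ?cabs1// !big_cons cabsM IH.
Qed.

Lemma pseries_val {R : realType} (f : R[i] -> R[i]) a c rho :
  pseries_at f a c rho -> f a = c 0%N.
Proof.
move=> [rho0 /(_ a)]; rewrite subrr cabs0 => /(_ rho0) H.
suff E : cabs (f a - c 0%N) = 0.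
  by apply/eqP; rewrite -subr_eq0 -cabs_eq0 E.
apply: (cvg_unique _ _ H) => //=.
apply: cvg_near_cst; exists 1%N => // N /= N1.
congr (cabs (_ - _)); case: N N1 => // N _.
rewrite big_ord_recl expr0 mulr1 big1 ?addr0// => i _.
by rewrite lift0 expr0n/= mulr0.
Qed.

(** A Cauchy estimate without contour integrals: the term of index [i] at the point [a + t] is the
    difference of two consecutive remainders, and a convergent sequence is bounded. *)
Lemma pseries_bound {R : realType} (f : R[i] -> R[i]) a c rho t :
  pseries_at f a c rho -> 0 < t -> t < rho ->
  exists2 M, 0 < M & forall i, cabs (c i) * t ^+ i <= M.
Proof.
move=> [rho0 H] t0 tr.
have ct : cabs (t%:C)%C = t by rewrite /cabs /= expr0n addr0 sqrtr_sqr gtr0_norm.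
have := H (a + (t%:C)%C); rewrite addrAC subrr add0r ct => /(_ tr).
set e := fun N : nat => _ => He.
have /cvg_seq_bounded [B [_ HB]] : cvgn e by apply/cvg_ex; exists 0.
pose M := `|B| + 1.
have eM N : e N <= M.
  have : `|B| + 1 > B by rewrite (le_lt_trans (ler_norm B))// ltrDl.
  by move=> /HB /(_ N I) /(le_trans (ler_norm _)).
exists (2 * M) => [|i]; first by rewrite mulr_gt0// /M ltr_wpDl.
rewrite -{1}ct -cabsX -cabsM.
have -> : c i * ((t%:C)%C) ^+ i = (f (a + (t%:C)%C) - \sum_(j < i) c j * ((t%:C)%C) ^+ j)
   - (f (a + (t%:C)%C) - \sum_(j < i.+1) c j * ((t%:C)%C) ^+ j).
  by rewrite big_ord_recr/=; ring.
apply: le_trans (cabsD _ _) _; rewrite cabsN.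
have h1 := eM i; have h2 := eM i.+1; rewrite /e in h1 h2.
by rewrite mulr_natl mulr2n lerD.
Qed.

Lemma pseries_div_same {R : realType} (f f1 : R[i] -> R[i]) a c rho :
  pseries_at f a c rho -> c 0%N = 0 -> (forall z, f z = (z - a) * f1 z) ->
  f1 a = c 1%N -> pseries_at f1 a (fun i => c i.+1) rho.
Proof.
move=> [rho0 H] c0 E E1; split => // z za.
have [->|nz] := eqVneq z a.
  apply: cvg_near_cst; exists 1%N => // N /= N1; case: N N1 => // N _.
  rewrite big_ord_recl expr0 mulr1 big1 ?addr0 ?E1 ?subrr ?cabs0// => i _.
  by rewrite lift0 ?subrr expr0n/= mulr0.
have w0 : cabs (z - a) != 0 by rewrite cabs_eq0 subr_eq0.
have := H z za; rewrite -(cvg_shiftS (fun N => cabs _)) => Hs.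
rewrite [X in X @ _ --> _](_ : _ = (fun N => (cabs (z - a))^-1 *
   cabs (f z - \sum_(i < N.+1) c i * (z - a) ^+ i))); last first.
  apply/funext => N; rewrite big_ord_recl c0 mul0r add0r E.
  have -> : \sum_(i < N) c (lift ord0 i) * (z - a) ^+ lift ord0 i =
    (z - a) * \sum_(i < N) c i.+1 * (z - a) ^+ i.
    by rewrite mulr_sumr; apply: eq_bigr => i _; rewrite lift0 exprS; ring.
  by rewrite -mulrBr cabsM mulKf.
rewrite -[X in _ --> X](mulr0 (cabs (z - a))^-1).
by apply: cvgM => //; exact: cvg_cst.
Qed.

(** With [u = z - w] and [b = w - a], comparing coefficients in [(u + b) sum d_i u^i = sum c_i u^i]
    gives the recurrence [b d_(i+1) = c_(i+1) - d_i]. Initial zeros of [c] are inherited by [d]. *)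
Lemma pseries_div_other {R : realType} (f f1 : R[i] -> R[i]) a w c rho :
  pseries_at f w c rho -> w != a -> (forall z, f z = (z - a) * f1 z) ->
  exists d rho', pseries_at f1 w d rho' /\
    forall k, (forall i, (i < k)%N -> c i = 0) -> forall i, (i < k)%N -> d i = 0.
Proof.
move=> cf wa E; have [rho0 H] := cf.
pose b := w - a; have b0 : b != 0 by rewrite subr_eq0.
have nb0 : 0 < cabs b by rewrite lt_neqAle cabs_ge0 andbT eq_sym cabs_eq0.
pose d := fix d i := if i is j.+1 then (c i - d j) / b else c 0%N / b.
have dS i : b * d i.+1 = c i.+1 - d i by rewrite /= mulrC divfK.
have d0 : b * d 0%N = c 0%N by rewrite /= mulrC divfK.
clearbody d.
(* The bound [t <= |b| / 2] closes the induction on [|d_i| t^i <= D]: with [|b| D = 2 M], one step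
   gives at most [M + D |b| / 2 = 2 M]. *)
pose t := Num.min rho (cabs b) / 2.
have m0 : 0 < Num.min rho (cabs b) by rewrite lt_min rho0.
have t0 : 0 < t by rewrite divr_gt0.
have tr : t < rho.
  have : Num.min rho (cabs b) <= rho by rewrite ge_min lexx.
  by rewrite /t; lra.
have tb : t <= cabs b / 2.
  have : Num.min rho (cabs b) <= cabs b by rewrite ge_min lexx orbT.
  by rewrite /t; lra.
have [M M0 cM] := pseries_bound cf t0 tr.
pose D := 2 * M / cabs b.
have D0 : 0 < D by rewrite divr_gt0// mulr_gt0.
have DM : cabs b * D = 2 * M by rewrite /D mulrC divfK// gt_eqF.
have dD i : cabs (d i) * t ^+ i <= D.
  elim: i => [|i IH].
    rewrite -(ler_pM2l nb0) DM mulrA -cabsM d0.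
    by apply: le_trans (cM 0%N) _; lra.
  rewrite -(ler_pM2l nb0) DM mulrA -cabsM dS.
  have : cabs (c i.+1 - d i) <= cabs (c i.+1) + cabs (d i).
    by apply: le_trans (cabsD _ _) _; rewrite cabsN.
  move=> h; apply: le_trans (ler_wpM2r (exprn_ge0 i.+1 (ltW t0)) h) _.
  rewrite mulrDl; have := cM i.+1.
  have : cabs (d i) * t ^+ i.+1 <= D * (cabs b / 2).
    rewrite exprSr mulrA; apply: ler_pM => //; last exact: ltW.
    by rewrite mulr_ge0 ?cabs_ge0 ?exprn_ge0// ltW.
  have -> : D * (cabs b / 2) = M.
    by rewrite mulrA [D * _]mulrC DM mulrAC divff ?mul1r.
  lra.
exists d, (t / 2); split; last first.
  move=> k ck; elim => [k0|i IH ik].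
    by apply: (mulfI b0); rewrite d0 ck// mulr0.
  by apply: (mulfI b0); rewrite dS ck// IH ?subr0 ?mulr0// ltnW.
split=> [|z zw]; first by rewrite divr_gt0.
set u := z - w in zw *.
have uza : u + b = z - a by rewrite /u /b; ring.
have nub : cabs b / 2 <= cabs (z - a).
  have : cabs b <= cabs (z - a) + cabs u.
    rewrite (_ : b = (z - a) + - u); last by rewrite /u /b; ring.
    by apply: le_trans (cabsD _ _) _; rewrite cabsN.
  lra.
(* Multiplying the truncated quotient by [u + b] leaves a single surplus term, which decays
   geometrically for [|u| < t / 2]. *)
have key N : (z - a) * (f1 z - \sum_(i < N.+1) d i * u ^+ i) =
   (f z - \sum_(i < N.+1) c i * u ^+ i) - d N * u ^+ N.+1.
  have : (z - a) * \sum_(i < N.+1) d i * u ^+ i = \sum_(i < N.+1) c i * u ^+ i + d N * u ^+ N.+1.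
    rewrite -uza; elim: N => [|N IH].
      by rewrite !big_ord1 -d0 expr0; ring.
    rewrite big_ord_recr/= mulrDr IH [in RHS]big_ord_recr/=.
    have -> : c N.+1 = b * d N.+1 + d N by rewrite dS; ring.
    by rewrite (exprS u N.+1); ring.
  by rewrite mulrBr -E => ->; ring.
have ut : cabs u < rho by lra.
have := H z ut; rewrite -(cvg_shiftS (fun N => cabs _)) => Hs.
rewrite -(cvg_shiftS (fun N => cabs _)).
have bnd N : cabs (f1 z - \sum_(i < N.+1) d i * u ^+ i) <=
   2 / cabs b * (cabs (f z - \sum_(i < N.+1) c i * u ^+ i) + D * t * (1 / 2) ^+ N.+1).
  have dN : cabs (d N * u ^+ N.+1) <= D * t * (1 / 2) ^+ N.+1.
    rewrite cabsM cabsX.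
    have : cabs u ^+ N.+1 <= (t * (1 / 2)) ^+ N.+1.
      by rewrite lerXn2r// ?nnegrE ?cabs_ge0// ?mulr_ge0 ?(ltW t0)//; lra.
    rewrite exprMn => h.
    apply: le_trans (ler_wpM2l (cabs_ge0 _) h) _.
    rewrite mulrA ler_wpM2r ?exprn_ge0// exprSr mulrA ler_wpM2r ?(ltW t0)//.
  have : cabs (z - a) * cabs (f1 z - \sum_(i < N.+1) d i * u ^+ i) <=
     cabs (f z - \sum_(i < N.+1) c i * u ^+ i) + D * t * (1 / 2) ^+ N.+1.
    rewrite -cabsM key; apply: le_trans (cabsD _ _) _.
    by rewrite cabsN lerD2l.
  set x := cabs (f1 z - _).
  set y := cabs (f z - _) + _ => xy.
  have : cabs b / 2 * x <= y.
    by apply: le_trans xy; rewrite ler_wpM2r ?cabs_ge0.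
  by rewrite -ler_pdivlMl ?divr_gt0// invf_div.
apply: (squeeze_cvgr _ (cvg_cst 0)).
  by near=> N; rewrite cabs_ge0/=; exact: bnd.
rewrite -[X in _ --> X](_ : 2 / cabs b * (0 + D * t * 0) = 0); last by ring.
apply: cvgM; first exact: cvg_cst.
apply: cvgD => //; apply: cvgM; first exact: cvg_cst.
have half0 : (fun N => (1 / 2 : R) ^+ N) @ \oo --> (0 : R).
  by apply: cvg_expr; rewrite ger0_norm; lra.
by rewrite -(cvg_shiftS (fun N => (1 / 2 : R) ^+ N)) in half0.
Unshelve. all: by end_near. Qed.

Lemma factor1 {R : realType} (f : R[i] -> R[i]) a k :
  analytic_on_disc f -> vanishes_to f a k.+1 ->
  exists f1, [/\ forall z, f z = (z - a) * f1 z, analytic_on_disc f1,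
    vanishes_to f1 a k & forall w j, w != a -> vanishes_to f w j -> vanishes_to f1 w j].
Proof.
move=> fA [c [rho [cf ck]]].
have c0 : c 0%N = 0 by exact: ck.
pose f1 z := if z == a then c 1%N else f z / (z - a).
have E z : f z = (z - a) * f1 z.
  rewrite /f1; case: eqVneq => [->|za].
    by rewrite subrr mul0r (pseries_val cf).
  by rewrite mulrC divfK// subr_eq0.
have H1 : pseries_at f1 a (fun i => c i.+1) rho.
  by apply: pseries_div_same cf c0 E _; rewrite /f1 eqxx.
exists f1; split => //.
- move=> w w1; have [->|wa] := eqVneq w a; first by exists (fun i => c i.+1), rho.
  have [d [rh dr]] := fA w w1.
  by have [d' [r' [K _]]] := pseries_div_other dr wa E; exists d', r'.
- by exists (fun i => c i.+1), rho; split => // i ik; apply: ck.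
- move=> w j wa [d [rh [dr dj]]].
  have [d' [r' [K L]]] := pseries_div_other dr wa E; exists d', r'; split => //.
  exact: L.
Qed.

(** A zero is divided out as often as [s] lists it. The quotient [g] may have further zeros: they
    only add positive mass to the Laplacian, which is estimated from below. *)
Lemma factor_zeros {R : realType} (s : seq R[i]) (f : R[i] -> R[i]) :
  analytic_on_disc f -> (forall a, a \in s -> vanishes_to f a (count_mem a s)) ->
  exists2 g, analytic_on_disc g & forall z, f z = (\prod_(a <- s) (z - a)) * g z.
Proof.
elim: s f => [|a s IH] f fA H.
  by exists f => // z; rewrite big_nil mul1r.
have Ha : vanishes_to f a (count_mem a s).+1.
  by have := H a (mem_head _ _); rewrite /= eqxx.
have [f1 [E A1 V1 V2]] := factor1 fA Ha.
have [|g gA gE] := IH f1 A1.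
  move=> w ws; have [->//|wa] := eqVneq w a.
  apply: V2 => //; have := H w; rewrite inE ws orbT => /(_ isT)/=.
  by rewrite eq_sym (negbTE wa).
by exists g => // z; rewrite E gE big_cons mulrA.
Qed.

(** * Second differences of the regularized logarithm *)

(** Compactness turns constants valid near each point into a single one, since [Q] is monotone in
    its constant. *)
Lemma bound_local_segment {R : realType} (Q : R -> R -> Prop) (a b : R) :
  (forall C C' x, C <= C' -> Q C x -> Q C' x) ->
  (forall x, a <= x <= b -> exists2 C, 1 <= C & forall y, `|y - x| * C <= 1 -> Q C y) ->
  exists2 C, 1 <= C & forall x, a <= x <= b -> Q C x.
Proof.
move=> Qm Ql.
have /compact_near_coveringP cov := @segment_compact R a b.
have := cov R (pinfty_nbhs R) (fun C x => Q C x) _.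
have [|C [Cr HC]] := cov R (pinfty_nbhs R) (fun C x => Q C x) _.
  move=> x /=; rewrite in_itv/= => /Ql[C C1 H].
  exists ([set y | `|y - x| * C <= 1], [set D | C < D]).
    split => /=.
      exists C^-1 => /=; first by rewrite invr_gt0; lra.
      move=> y /=; rewrite distrC => yx.
      by rewrite -ler_pdivlMr ?mul1r ?ltW//; lra.
    by exists C; split => //; exact: num_real.
  move=> [y D] /= [yx CD]; apply: Qm (H y yx); exact: ltW.
move=> _; exists (Num.max 1 (C + 1)) => [|x xab]; first by rewrite le_max lexx.
apply: (HC _ _ x); last by rewrite /= in_itv.
by rewrite lt_max ltrDl ltr01 orbT.
Qed.

Lemma bound_local {R : realType} (Q : R -> R -> R -> Prop) :
  (forall C C' x y, C <= C' -> Q C x y -> Q C' x y) ->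
  (forall x y, -1 <= x <= 1 -> -1 <= y <= 1 -> exists2 C, 1 <= C &
     forall x' y', `|x' - x| * C <= 1 -> `|y' - y| * C <= 1 -> Q C x' y') ->
  exists2 C, 1 <= C & forall x y, -1 <= x <= 1 -> -1 <= y <= 1 -> Q C x y.
Proof.
move=> Qm Ql.
have [||C C1 H] := @bound_local_segment R
  (fun C x => forall y, -1 <= y <= 1 -> Q C x y) (-1) 1.
- by move=> C C' x CC H y /H; exact: Qm.
- move=> x x1.
  have [||C C1 H] := @bound_local_segment R
    (fun C y => forall x', `|x' - x| * C <= 1 -> Q C x' y) (-1) 1.
  + move=> C C' y CC H x' x'C; apply: (Qm _ _ _ _ CC); apply: H.
    by apply: scaled_le x'C.
  + move=> y y1; have [C C1 H] := Ql x y x1 y1.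
    by exists C => // y' y'C x' x'C; exact: H.
  exists C => // x' x'C y y1; exact: H.
- by exists C => // x y x1 y1; exact: H.
Qed.

Definition cpx {R : realType} (z : pt R) : R[i] := Complex z.1 z.2.

Definition dirc {R : realType} (e : bool) (t : R) : R[i] :=
  if e then Complex t 0 else Complex 0 t.

Lemma cpx_sh {R : realType} e (z : pt R) t : cpx (sh e z t) = cpx z + dirc e t.
Proof. by case: e; rewrite /cpx /sh /dirc; simpc. Qed.

Lemma cabs_dirc {R : realType} e (t : R) : cabs (dirc e t) = `|t|.
Proof.
by case: e; rewrite /cabs /dirc /= expr0n/= ?addr0 ?add0r sqrtr_sqr.
Qed.

(** [A] and [B] are [i w^(i-1)] and [i (i-1) / 2 w^(i-2)], built by repeated multiplication by
    [w + eta]. The factor [2 ^ i] absorbs these polynomial factors: every multiplication splits the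
    bound into two equal halves. *)
Lemma monomial_jet {R : realType} (w : R[i]) (rho : R) (i : nat) : 0 < rho ->
  cabs w <= rho ->
  exists A B : R[i], [/\ cabs A * rho <= (2 * rho) ^+ i, cabs B * rho ^+ 2 <= (2 * rho) ^+ i &
   forall eta, cabs w + cabs eta <= rho ->
    cabs ((w + eta) ^+ i - w ^+ i - A * eta - B * eta ^+ 2) * rho ^+ 3
      <= (2 * rho) ^+ i * cabs eta ^+ 3].
Proof.
move=> rho0 wr; elim: i => [|i [A [B [hA hB hR]]]].
  exists 0, 0; rewrite cabs0 !mul0r expr0 ler01; split => // eta _.
  rewrite !expr0 subrr !mul0r !subr0 cabs0 mul0r mul1r.
  by rewrite exprn_ge0// cabs_ge0.
have r2 : 0 <= (2 * rho) ^+ i by rewrite exprn_ge0//; lra.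
have e1 : (2 * rho) ^+ i.+1 = rho * (2 * rho) ^+ i + rho * (2 * rho) ^+ i by rewrite exprS; ring.
exists (w * A + w ^+ i), (w * B + A); split.
- apply: le_trans (ler_wpM2r (ltW rho0) (cabsD _ _)) _.
  rewrite mulrDl e1 !cabsM cabsX; apply: lerD.
    by rewrite -mulrA ler_pM ?cabs_ge0// mulr_ge0 ?cabs_ge0 ?(ltW rho0).
  rewrite mulrC ler_wpM2l ?(ltW rho0)//; apply: lerXn2r; rewrite ?nnegrE ?cabs_ge0//; lra.
- apply: le_trans (ler_wpM2r (exprn_ge0 2 (ltW rho0)) (cabsD _ _)) _.
  rewrite mulrDl e1 !cabsM; apply: lerD.
    by rewrite -mulrA ler_pM ?cabs_ge0// mulr_ge0 ?cabs_ge0 ?exprn_ge0 ?(ltW rho0).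
  by rewrite expr2 mulrA mulrC ler_wpM2l ?(ltW rho0).
- move=> eta wer; have e0 := cabs_ge0 eta; have w0 := cabs_ge0 w.
  have -> : (w + eta) ^+ i.+1 - w ^+ i.+1 - (w * A + w ^+ i) * eta - (w * B + A) * eta ^+ 2
   = (w + eta) * ((w + eta) ^+ i - w ^+ i - A * eta - B * eta ^+ 2) + B * eta ^+ 3.
    by rewrite !exprS; ring.
  apply: le_trans (ler_wpM2r (exprn_ge0 3 (ltW rho0)) (cabsD _ _)) _.
  rewrite (cabsM (w + eta)) (cabsM B) cabsX e1 [X in X <= _]mulrDl [X in _ <= X]mulrDl.
  apply: lerD.
    rewrite -!mulrA ler_pM ?cabs_ge0// ?mulr_ge0 ?cabs_ge0 ?exprn_ge0 ?(ltW rho0)//.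
      by apply: le_trans (cabsD _ _) _.
    exact: hR.
  have -> : cabs B * cabs eta ^+ 3 * rho ^+ 3 = (rho * (cabs B * rho ^+ 2)) * cabs eta ^+ 3 by ring.
  by rewrite ler_wpM2r ?exprn_ge0// ler_wpM2l ?(ltW rho0).
Qed.

(** The bounds do not depend on [N], so estimates for partial sums will pass to the limit. The gap
    between radii [4 rho] and [2 rho] produces a geometric series. *)
Lemma poly_jet {R : realType} (c : nat -> R[i]) (M rho : R) (w : R[i]) (N : nat) :
  0 < rho -> cabs w <= rho -> (forall i, cabs (c i) * (4 * rho) ^+ i <= M) ->
  exists A B : R[i], [/\ cabs (\sum_(i < N) c i * w ^+ i) <= 2 * M,
   cabs A * rho <= 2 * M, cabs B * rho ^+ 2 <= 2 * M &
   forall eta, cabs w + cabs eta <= rho ->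
    cabs (\sum_(i < N) c i * (w + eta) ^+ i - \sum_(i < N) c i * w ^+ i - A * eta - B * eta ^+ 2)
      * rho ^+ 3 <= 2 * M * cabs eta ^+ 3].
Proof.
move=> rho0 wr cM.
have M0 : 0 <= M by apply: le_trans (cM 0%N); rewrite mulr_ge0 ?cabs_ge0 ?exprn_ge0//; lra.
(* Partial sums of [M / 2^i]; carrying them instead of [2 * M] makes the induction on [N] close. *)
pose S n : R := 2 * M - 2 * M * (1 / 2) ^+ n.
have S2 n : S n <= 2 * M by rewrite /S gerBl mulr_ge0 ?mulr_ge0 ?exprn_ge0.
have term n : cabs (c n) * (2 * rho) ^+ n <= S n.+1 - S n.
  have -> : S n.+1 - S n = M * (1 / 2) ^+ n by rewrite /S exprS; field.
  have -> : (2 * rho) ^+ n = (4 * rho) ^+ n * (1 / 2) ^+ n.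
    by rewrite -exprMn; congr (_ ^+ _); field.
  by rewrite mulrA ler_wpM2r// exprn_ge0.
suff [A [B [h0 hA hB hR]]] : exists A B : R[i], [/\ cabs (\sum_(i < N) c i * w ^+ i) <= S N,
   cabs A * rho <= S N, cabs B * rho ^+ 2 <= S N &
   forall eta, cabs w + cabs eta <= rho ->
    cabs (\sum_(i < N) c i * (w + eta) ^+ i - \sum_(i < N) c i * w ^+ i - A * eta - B * eta ^+ 2)
      * rho ^+ 3 <= S N * cabs eta ^+ 3].
  exists A, B; split; [exact: le_trans (S2 N)|exact: le_trans (S2 N)|exact: le_trans (S2 N)|].
  move=> eta /hR /le_trans; apply; rewrite ler_wpM2r// exprn_ge0// cabs_ge0//.
elim: N => [|N [A [B [h0 hA hB hR]]]].
  have S0 : S 0%N = 0 by rewrite /S expr0; ring.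
  exists 0, 0; rewrite S0 !big_ord0 cabs0 !mul0r lexx; split => // eta _.
  by rewrite !big_ord0 !mul0r !subr0 cabs0 mul0r.
have [A' [B' [kA kB kR]]] := monomial_jet N rho0 wr.
have cN := cabs_ge0 (c N).
have SN : S N.+1 = S N + (S N.+1 - S N) by ring.
exists (A + c N * A'), (B + c N * B'); split.
- rewrite big_ord_recr/=; apply: le_trans (cabsD _ _) _; rewrite SN; apply: lerD => //.
  apply: le_trans (term N); rewrite cabsM cabsX ler_wpM2l//.
  by apply: lerXn2r; rewrite ?nnegrE ?cabs_ge0//; lra.
- apply: le_trans (ler_wpM2r (ltW rho0) (cabsD _ _)) _.
  rewrite mulrDl SN; apply: lerD => //; apply: le_trans (term N).
  by rewrite cabsM -mulrA ler_wpM2l.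
- apply: le_trans (ler_wpM2r (exprn_ge0 2 (ltW rho0)) (cabsD _ _)) _.
  rewrite mulrDl SN; apply: lerD => //; apply: le_trans (term N).
  by rewrite cabsM -mulrA ler_wpM2l.
- move=> eta wer; have e3 : 0 <= cabs eta ^+ 3 by rewrite exprn_ge0 ?cabs_ge0.
  rewrite !big_ord_recr/=.
  set s1 := \sum_(i < N) _; set s2 := \sum_(i < N) _.
  have -> : s1 + c N * (w + eta) ^+ N - (s2 + c N * w ^+ N) - (A + c N * A') * eta -
    (B + c N * B') * eta ^+ 2 = (s1 - s2 - A * eta - B * eta ^+ 2) +
    c N * ((w + eta) ^+ N - w ^+ N - A' * eta - B' * eta ^+ 2) by ring.
  apply: le_trans (ler_wpM2r (exprn_ge0 3 (ltW rho0)) (cabsD _ _)) _.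
  rewrite mulrDl SN mulrDl; apply: lerD; first exact: hR.
  apply: le_trans (ler_wpM2r e3 (term N)).
  by rewrite cabsM -!mulrA ler_wpM2l// kR.
Qed.

Lemma utay_sqr {R : realType} (B : R) :
  utay (fun a => `|a| <= B) (fun x : R => x ^+ 2) (fun x => 2 * x) (fun=> 2).
Proof.
exists (2 + `|B| + `|B| ^+ 2 + 2 * `|B|) => [|a b aB ab].
  by have := normr_ge0 B; have := exprn_ge0 2 (normr_ge0 B); lra.
have := normr_ge0 B; have := exprn_ge0 2 (normr_ge0 B) => B2 B0.
have aB' : `|a| <= `|B| by apply: le_trans aB (ler_norm _).
have a2 : `|a| ^+ 2 <= `|B| ^+ 2 by apply: lerXn2r; rewrite ?nnegrE.
split; [rewrite normrX; lra|rewrite normrM ger0_norm//; lra|rewrite ger0_norm//; lra|].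
have -> : b ^+ 2 - a ^+ 2 - 2 * a * (b - a) - 2 / 2 * (b - a) ^+ 2 = 0 by field.
by rewrite normr0 mulr_ge0 ?exprn_ge0//; lra.
Qed.

Lemma utay_ln {R : realType} (l B : R) : 0 < l ->
  utay (fun a => l <= a <= B) (@ln R) (fun x => x^-1) (fun x => - (x ^+ 2)^-1).
Proof.
move=> l0.
(* Halving [l] leaves room to move off the base points, and [m <= 1] makes the powers of [T = 1 / m]
   increasing. *)
pose m := Num.min 1 (l / 2).
have m0 : 0 < m by rewrite lt_min ltr01/= divr_gt0.
have m1 : m <= 1 by rewrite ge_min lexx.
have ml : m <= l / 2 by rewrite ge_min lexx orbT.
pose B' := 1 + `|B| + 1.
pose M := 2 * (B' + m^-1) / m ^+ 3 + 2 / l.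
have i1 : 1 <= m^-1 by rewrite invf_ge1.
have i0 : 0 < m^-1 by rewrite invr_gt0.
have B'1 : 1 <= B' by rewrite /B'; have := normr_ge0 B; lra.
pose T := m^-1.
have ME : M = 2 * (B' + T) * T ^+ 3 + 2 / l by rewrite /M exprVn.
have T1 : 1 <= T by [].
have T0 : 0 <= T by exact: le_trans T1.
have T2 : T <= T ^+ 2 by rewrite ler_eXnr.
have T3 : T ^+ 2 <= T ^+ 3 by rewrite ler_weXn2l.
have l2 : 0 < 2 / l by rewrite divr_gt0.
have MB : 2 * (B' + T) * T ^+ 3 <= M by rewrite ME; lra.
have MT3 : 4 * T ^+ 3 <= 2 * (B' + T) * T ^+ 3 by rewrite ler_wpM2r//; lra.
have MBB : B' + T <= 2 * (B' + T) * T ^+ 3.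
  have : (B' + T) * 1 <= (B' + T) * T ^+ 3 by rewrite ler_wpM2l//; lra.
  have -> : 2 * (B' + T) * T ^+ 3 = (B' + T) * T ^+ 3 + (B' + T) * T ^+ 3 by ring.
  lra.
apply: (@utay_deriv R _ (fun x => m <= x <= B') _ _ _ M).
- lra.
- move=> a b /andP[la aB] ab.
  have ab1 : `|b - a| <= 1.
    by rewrite -[`|b - a|]mulr1; apply: scaled_le ab; lra.
  have ab2 : `|b - a| * (2 / l) <= 1 by apply: scaled_le ab; lra.
  have ab3 : `|b - a| <= l / 2.
    by rewrite -[l / 2]mul1r -ler_pdivrMr ?divr_gt0// invf_div.
  move: ab1 ab3; rewrite !ler_norml => /andP[u1 u2] /andP[u3 u4].
  by apply/andP; split; rewrite /B'; [lra|have := ler_norm B; lra].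
- by move=> x /andP[mx _]; apply: is_derive1_ln; lra.
- move=> x /andP[mx _]; have x0 : 0 < x by lra.
  have x0' : id x != 0 by rewrite gt_eqF.
  have H := @is_deriveV _ _ x 1 1 x0' (is_derive_id x 1).
  by apply: is_derive_eq; rewrite /GRing.scale/= mulr1.
- move=> x /andP[mx xB]; have x0 : 0 < x by lra.
  have xi : x^-1 <= T by rewrite lef_pV2.
  have xi0 : 0 < x^-1 by rewrite invr_gt0.
  have xi2 : (x ^+ 2)^-1 <= T ^+ 2 by rewrite -exprVn; apply: lerXn2r; rewrite ?nnegrE//; lra.
  have n2 : 0 < (x ^+ 2)^-1 by rewrite invr_gt0 exprn_gt0.
  split; last 2 first.
  + rewrite gtr0_norm//; lra.
  + rewrite normrN gtr0_norm//; lra.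
  rewrite ler_norml; apply/andP; split.
    have : - ln x <= T - 1.
      rewrite -lnV// -[in ln _](subrKC 1 x^-1); apply: le_trans (le_ln1Dx _) _; lra.
    lra.
  have : ln x <= B' - 1 by rewrite -[in ln _](subrKC 1 x); apply: le_trans (le_ln1Dx _) _; lra.
  lra.
- move=> x y /andP[mx xB] /andP[my yB]; have x0 : 0 < x by lra. have y0 : 0 < y by lra.
  have -> : - (y ^+ 2)^-1 - - (x ^+ 2)^-1 = ((x^-1) ^+ 2 * y^-1 + x^-1 * (y^-1) ^+ 2) * (y - x).
    by field; rewrite !gt_eqF.
  have xi : x^-1 <= T by rewrite lef_pV2.
  have yi : y^-1 <= T by rewrite lef_pV2.
  have xi0 : 0 < x^-1 by rewrite invr_gt0.
  have yi0 : 0 < y^-1 by rewrite invr_gt0.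
  rewrite normrM ler_wpM2r// ger0_norm; last first.
    by rewrite addr_ge0 ?mulr_ge0 ?exprn_ge0 ?ltW.
  have h1 : (x^-1) ^+ 2 * y^-1 <= T ^+ 2 * T.
    by rewrite ler_pM ?exprn_ge0 ?(ltW xi0) ?(ltW yi0)//; apply: lerXn2r; rewrite ?nnegrE//; lra.
  have h2 : x^-1 * (y^-1) ^+ 2 <= T * T ^+ 2.
    by rewrite ler_pM ?exprn_ge0 ?(ltW xi0) ?(ltW yi0)//; apply: lerXn2r; rewrite ?nnegrE//; lra.
  rewrite -exprSr -exprS in h1 h2.
  have : 0 <= T ^+ 3 by lra.
  lra.
Qed.

Definition lnreg {R : realType} (g : R[i] -> R[i]) (d : R) (z : pt R) : R :=
  ln (cabs (g (cpx z)) ^+ 2 + d) / 2.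

(* Second differences of [ln(|q|^2 + d)/2] for a holomorphic 2-jet [q]: the
   second-order coefficient is [2 d |A|^2 / (|p|^2 + d)^2 >= 0]. *)
Lemma lap_ln_jet {R : realType} (C d : R) : 0 < C -> 0 < d ->
  exists2 C', 1 <= C' & forall (p A B : R[i]) (q : R[i] -> R[i]),
   cabs p <= C -> cabs A <= C -> cabs B <= C ->
   (forall eta, cabs eta * C <= 1 -> cabs (q eta - p - A * eta - B * eta ^+ 2) <= C * cabs eta ^+ 3) ->
   forall h, 0 < h -> h * C' <= 1 ->
   - (C' * h ^+ 3) <= ln (cabs (q (dirc true h)) ^+ 2 + d) / 2 +
     ln (cabs (q (dirc true (- h))) ^+ 2 + d) / 2 +
     ln (cabs (q (dirc false h)) ^+ 2 + d) / 2 +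
     ln (cabs (q (dirc false (- h))) ^+ 2 + d) / 2 - 4 * (ln (cabs p ^+ 2 + d) / 2).
Proof.
move=> C0 d0.
(* All jets obeying the bound [C] form one family, so that [gjet_lap] returns one constant valid for
   every partial sum of a power series. *)
pose I := ((R[i] -> R[i]) * (R[i] * (R[i] * R[i])))%type.
pose qq (i : I) := i.1; pose p (i : I) := i.2.1; pose A (i : I) := i.2.2.1.
pose B (i : I) := i.2.2.2.
pose P (i : I) := [/\ cabs (p i) <= C, cabs (A i) <= C, cabs (B i) <= C &
  forall eta, cabs eta * C <= 1 ->
    cabs (qq i eta - p i - A i * eta - B i * eta ^+ 2) <= C * cabs eta ^+ 3].
pose PB (j : bool * I) := P j.2.
pose D := 1 + 2 * C.
have comp (L : R[i] -> R) : (forall z, `|L z| <= cabs z) ->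
    (forall z w, L (z - w) = L z - L w) ->
    (forall e z t, L (z * dirc e t) = L (z * dirc e 1) * t) ->
    (forall e z t, L (z * dirc e t ^+ 2) = L (z * dirc e 1 ^+ 2) * t ^+ 2) ->
  gjet PB (fun j t => L (qq j.2 (dirc j.1 t))) (fun j => L (p j.2))
    (fun j => L (A j.2 * dirc j.1 1)) (fun j => 2 * L (B j.2 * dirc j.1 1 ^+ 2)).
  move=> Ln LB L1 L2; exists D => [|[e i] [hp hA hB hq]]; first by rewrite /D; lra.
  have d1 : cabs (dirc e (1 : R)) = 1 by rewrite cabs_dirc normr1.
  split => /=.
  - by apply: le_trans (Ln _) _; rewrite /D; lra.
  - by apply: le_trans (Ln _) _; rewrite cabsM d1 mulr1 /D; lra.
  - rewrite normrM ger0_norm//.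
    have : `|L (B i * dirc e 1 ^+ 2)| <= C.
      by apply: le_trans (Ln _) _; rewrite cabsM cabsX d1 expr1n mulr1.
    by rewrite /D; lra.
  move=> t tD.
  have -> : L (qq i (dirc e t)) - L (p i) - L (A i * dirc e 1) * t -
     2 * L (B i * dirc e 1 ^+ 2) / 2 * t ^+ 2 =
     L (qq i (dirc e t) - p i - A i * dirc e t - B i * dirc e t ^+ 2).
    by rewrite !LB (L1 e (A i) t) (L2 e (B i) t); field.
  apply: le_trans (Ln _) _.
  have := hq (dirc e t); rewrite cabs_dirc => H.
  apply: le_trans (H _) _; first by apply: scaled_le tD; rewrite /D; lra.
  by apply: cube_le; rewrite /D; lra.
have JR : gjet PB (fun j t => complex.Re (qq j.2 (dirc j.1 t))) (fun j => complex.Re (p j.2))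
    (fun j => complex.Re (A j.2 * dirc j.1 1)) (fun j => 2 * complex.Re (B j.2 * dirc j.1 1 ^+ 2)).
  apply: comp.
  - exact: Re_le_cabs.
  - by move=> [? ?] [? ?].
  - by move=> [] [x y] t; rewrite /dirc /=; ring.
  - by move=> [] [x y] t; rewrite /dirc !expr2 /=; ring.
have JI : gjet PB (fun j t => complex.Im (qq j.2 (dirc j.1 t))) (fun j => complex.Im (p j.2))
    (fun j => complex.Im (A j.2 * dirc j.1 1)) (fun j => 2 * complex.Im (B j.2 * dirc j.1 1 ^+ 2)).
  apply: comp.
  - exact: Im_le_cabs.
  - by move=> [? ?] [? ?].
  - by move=> [] [x y] t; rewrite /dirc /=; ring.
  - by move=> [] [x y] t; rewrite /dirc !expr2 /=; ring.
have SR := gjet_comp (utay_sqr C) (fun j (H : PB j) =>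
  (let: And4 h _ _ _ := H in le_trans (Re_le_cabs _) h)) JR.
have SI := gjet_comp (utay_sqr C) (fun j (H : PB j) =>
  (let: And4 h _ _ _ := H in le_trans (Im_le_cabs _) h)) JI.
have J := gjetD (gjetD SR SI) (gjet_cst PB d).
have range j : PB j -> d <= complex.Re (p j.2) ^+ 2 + complex.Im (p j.2) ^+ 2 + d <= C ^+ 2 + d.
  move=> [hp _ _ _]; rewrite -cabs_sq lerDr sqr_ge0/= lerD2r.
  by apply: lerXn2r; rewrite ?nnegrE ?cabs_ge0// ltW.
have [C' C'1 H] := gjet_lap (F0 := fun i => ln (complex.Re (p i) ^+ 2 + complex.Im (p i) ^+ 2 + d) / 2)
   (gjet_ext (fun i t => mulrC _ _) (fun i _ => mulrC _ _) (fun i _ => erefl) (fun i _ => erefl)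
    (gjetZ 2^-1 (gjet_comp (utay_ln (C ^+ 2 + d) d0) range J))).
exists C' => // p0 A0 B0 q hp hA hB hq h h0 hC.
have := H (q, (p0, (A0, B0))) h (And4 hp hA hB hq) h0 hC.
rewrite /= /qq /p /A /B /= ler_norml !addrA -!cabs_sq => /andP[H1 _]; move: H1.
set T := h ^+ 2 * _.
have S0 : 0 < cabs p0 ^+ 2 + d by rewrite ltr_wpDl// sqr_ge0.
(* The contributions of [B] cancel because the unit steps 1 and [i] have opposite squares: this is
   harmonicity of the real and imaginary parts. *)
have TE : T = h ^+ 2 * (2 * d * cabs A0 ^+ 2 / (cabs p0 ^+ 2 + d) ^+ 2).
  rewrite /T; congr (_ * _); move: (lt0r_neq0 S0).
  rewrite !cabs_sq; case: p0 A0 B0 {hp hA hB hq T S0} => [p1 p2] [a1 a2] [b1 b2] /= S0.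
  rewrite !expr2/=; field.
  by move: S0; rewrite !expr2.
have : 0 <= T.
  rewrite TE mulr_ge0 ?sqr_ge0// divr_ge0 ?sqr_ge0// mulr_ge0 ?sqr_ge0//.
  by rewrite mulr_ge0// ltW.
lra.
Qed.

(** The estimate is proved for partial sums, with a constant independent of the truncation, and then
    passes to the limit because [d > 0] makes the logarithm continuous. No derivative of [g] is ever
    formed. *)
Lemma lap_lnreg_local {R : realType} (g : R[i] -> R[i]) (d : R) (z0 : R[i]) c rho0 : 0 < d ->
  pseries_at g z0 c rho0 ->
  exists2 C, 1 <= C & forall z, cabs (cpx z - z0) * C <= 1 ->
    cabs (g (cpx z)) <= C /\
    forall h, 0 < h -> h * C <= 1 -> - (C * h ^+ 3) <= lap (lnreg g d) z h.
Proof.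
move=> d0 cg; have [r0 H] := cg.
(* Then [4 * rho < rho0], as the coefficient bound requires, and base point and increment, each at
   most [rho / 2], stay together within [rho]. *)
pose rho := rho0 / 8; have rp : 0 < rho by rewrite divr_gt0.
have [||M M0 cM] := @pseries_bound _ g z0 c rho0 (4 * rho) cg; [rewrite /rho; lra..|].
pose C1 := 2 * M + 2 * M / rho + 2 * M / rho ^+ 2 + 2 * M / rho ^+ 3 + 2 / rho.
have q1 : 0 < 2 * M / rho by rewrite divr_gt0// mulr_gt0.
have q2 : 0 < 2 * M / rho ^+ 2 by rewrite divr_gt0 ?exprn_gt0// mulr_gt0.
have q3 : 0 < 2 * M / rho ^+ 3 by rewrite divr_gt0 ?exprn_gt0// mulr_gt0.
have q4 : 0 < 2 / rho by rewrite divr_gt0.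
have C10 : 0 < C1 by rewrite /C1; lra.
have [C2 C21 HC] := lap_ln_jet C10 d0.
exists (C1 + C2) => [|z zC]; first lra.
set w := cpx z - z0 in zC.
have wr : cabs w <= rho / 2.
  rewrite -[rho / 2]mul1r -ler_pdivrMr ?divr_gt0// invf_div.
  rewrite -(ger0_norm (cabs_ge0 w)); apply: (@scaled_le _ _ (C1 + C2)); first by rewrite /C1; lra.
  by rewrite ger0_norm ?cabs_ge0.
pose S N (y : R[i]) := \sum_(i < N) c i * y ^+ i.
have conv y : cabs y < rho0 ->
   (fun N => ln (cabs (S N y) ^+ 2 + d) / 2) @ \oo --> ln (cabs (g (z0 + y)) ^+ 2 + d) / 2.
  move=> yr; have := H (z0 + y); rewrite addrAC subrr add0r => /(_ yr) Hy.
  have Sy : (fun N => cabs (S N y)) @ \oo --> cabs (g (z0 + y)).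
    have K : (fun N => cabs (S N y) - cabs (g (z0 + y))) @ \oo --> (0 : R).
      apply/norm_cvg0P; apply: (squeeze_cvgr _ (cvg_cst 0) Hy).
      near=> N; rewrite normr_ge0/= ler_norml; apply/andP; split.
        have := cabsD (g (z0 + y) - S N y) (S N y); rewrite subrK; lra.
      have := cabsD (S N y - g (z0 + y)) (g (z0 + y)); rewrite subrK cabsB; lra.
    rewrite (_ : (fun N => cabs (S N y)) =
      (fun N => (cabs (S N y) - cabs (g (z0 + y))) + cabs (g (z0 + y)))); last first.
      by apply/funext => N; rewrite subrK.
    by rewrite -[X in _ --> X]add0r; apply: cvgD => //; exact: cvg_cst.
  apply: cvgM; last exact: cvg_cst.
  have p0 : 0 < cabs (g (z0 + y)) ^+ 2 + d by rewrite ltr_wpDl// sqr_ge0.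
  apply: (@cvg_comp _ _ _ (fun N => cabs (S N y) ^+ 2 + d) (@ln R) _ _ _ _ (continuous_ln p0)).
  apply: cvgD; last exact: cvg_cst.
  by rewrite !expr2; under eq_fun do rewrite expr2; exact: cvgM.
have z0w : z0 + w = cpx z by rewrite /w; ring.
have pj N := @poly_jet _ c M rho w N rp (ltac:(lra)) cM.
have SC N : cabs (S N w) <= C1.
  by have [A [B [h0 _ _ _]]] := pj N; apply: le_trans h0 _; rewrite /C1; lra.
have wr0 : cabs w < rho0 by rewrite (le_lt_trans wr)// /rho; lra.
split.
  have Hy := H (cpx z) wr0.
  apply/ler_addgt0Pr => e e0.
  have : \forall N \near \oo, cabs (g (cpx z) - S N w) < e.
    move/cvgr0_norm_lt: Hy => /(_ e e0); apply: filterS => N.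
    by rewrite ger0_norm ?cabs_ge0.
  move=> [N _ /(_ N (leqnn N))] /= HN.
  have := cabsD (g (cpx z) - S N w) (S N w); rewrite subrK => K.
  have := SC N; lra.
move=> h h0 hC.
have hr : h <= rho / 2.
  rewrite -[rho / 2]mul1r -ler_pdivrMr ?divr_gt0// invf_div -(gtr0_norm h0).
  by apply: (@scaled_le _ _ (C1 + C2)); [rewrite /C1; lra|rewrite gtr0_norm].
have fin N : - (C2 * h ^+ 3) <= ln (cabs (S N (w + dirc true h)) ^+ 2 + d) / 2 +
     ln (cabs (S N (w + dirc true (- h))) ^+ 2 + d) / 2 +
     ln (cabs (S N (w + dirc false h)) ^+ 2 + d) / 2 +
     ln (cabs (S N (w + dirc false (- h))) ^+ 2 + d) / 2 - 4 * (ln (cabs (S N w) ^+ 2 + d) / 2).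
  have [A [B [h0' hA hB hq]]] := pj N.
  apply: (HC (S N w) A B (fun eta => S N (w + eta))) => //.
  - apply: le_trans (_ : 2 * M / rho <= _); first by rewrite ler_pdivlMr.
    by rewrite /C1; lra.
  - apply: le_trans (_ : 2 * M / rho ^+ 2 <= _); first by rewrite ler_pdivlMr ?exprn_gt0.
    by rewrite /C1; lra.
  - move=> eta eC.
    have er : cabs eta <= rho / 2.
      rewrite -[rho / 2]mul1r -ler_pdivrMr ?divr_gt0// invf_div.
      rewrite -(ger0_norm (cabs_ge0 eta)); apply: (@scaled_le _ _ C1); first by rewrite /C1; lra.
      by rewrite ger0_norm ?cabs_ge0.
    apply: le_trans (_ : 2 * M / rho ^+ 3 * cabs eta ^+ 3 <= _).
      rewrite mulrAC ler_pdivlMr ?exprn_gt0//; apply: hq; lra.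
    by rewrite ler_wpM2r ?exprn_ge0 ?cabs_ge0// /C1; lra.
  - by rewrite -(gtr0_norm h0); apply: (@scaled_le _ _ (C1 + C2)); [lra|rewrite gtr0_norm].
have dr e t : `|t| = h -> cabs (w + dirc e t) < rho0.
  move=> th; apply: le_lt_trans (cabsD _ _) _; rewrite cabs_dirc th /rho in hr wr *; lra.
have nh : `|h| = h by rewrite gtr0_norm.
have nhN : `|- h| = h by rewrite normrN.
apply: (@le_trans _ _ (- (C2 * h ^+ 3))).
  by rewrite lerN2 ler_wpM2r ?exprn_ge0 ?(ltW h0)//; lra.
have E e t : lnreg g d (sh e z t) = ln (cabs (g (z0 + (w + dirc e t))) ^+ 2 + d) / 2.
  by rewrite /lnreg cpx_sh addrA z0w.
rewrite /lap !E /lnreg -z0w.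
apply: (@cvgr_to_ge _ (nbhs \oo) _ _ (fun N => ln (cabs (S N (w + dirc true h)) ^+ 2 + d) / 2 +
     ln (cabs (S N (w + dirc true (- h))) ^+ 2 + d) / 2 +
     ln (cabs (S N (w + dirc false h)) ^+ 2 + d) / 2 +
     ln (cabs (S N (w + dirc false (- h))) ^+ 2 + d) / 2 - 4 * (ln (cabs (S N w) ^+ 2 + d) / 2))).
  apply: cvgB; last by apply: cvgM; [exact: cvg_cst|exact: conv].
  apply: cvgD; last by apply: conv; exact: dr.
  apply: cvgD; last by apply: conv; exact: dr.
  by apply: cvgD; apply: conv; exact: dr.
by near=> N; exact: fin.
Unshelve. all: by end_near. Qed.

(** Comparable to [1 - |z|] in the disc, but polynomial, hence smooth at the origin. *)
Definition Y {R : realType} (z : pt R) : R := 1 - z.1 ^+ 2 - z.2 ^+ 2.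

Lemma Y_cabs {R : realType} (z : pt R) : Y z = 1 - cabs (cpx z) ^+ 2.
Proof. by rewrite cabs_sq /Y /cpx/=; ring. Qed.

Lemma Y_gt0 {R : realType} (z : pt R) : (0 < Y z) = (cabs (cpx z) < 1).
Proof.
rewrite Y_cabs subr_gt0 -[X in _ = (_ < X)](expr1n R 2) -{1}[1](expr1n R 2).
by rewrite !expr1n -{1}[1](expr1n R 2) ltr_pXn2r// nnegrE ?cabs_ge0.
Qed.

Lemma lap_lnreg_disc {R : realType} (g : R[i] -> R[i]) (d y : R) : 0 < d -> 0 < y ->
  analytic_on_disc g ->
  exists2 C, 1 <= C & forall z, y <= Y z -> cabs (g (cpx z)) <= C /\
    forall h, 0 < h -> h * C <= 1 -> - (C * h ^+ 3) <= lap (lnreg g d) z h.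
Proof.
move=> d0 y0 gA.
have [||C C1 H] := @bound_local R (fun C a b => y <= Y (a, b) -> cabs (g (cpx (a, b))) <= C /\
    forall h, 0 < h -> h * C <= 1 -> - (C * h ^+ 3) <= lap (lnreg g d) (a, b) h).
- move=> C C' a b CC H /H[H1 H2]; split => [|h h0 hC]; first exact: le_trans CC.
  apply: le_trans (H2 h h0 _); last first.
    by rewrite -(gtr0_norm h0); apply: (scaled_le CC); rewrite gtr0_norm.
  by rewrite lerN2 ler_wpM2r// exprn_ge0// ltW.
- move=> a b _ _.
  have [yab|yab] := leP y (Y (a, b)).
    have [c [rho cg]] : exists c rho, pseries_at g (cpx (a, b)) c rho.
      by apply: gA; rewrite -Y_gt0 (lt_le_trans y0).
    have [C C1 H] := lap_lnreg_local d0 cg.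
    exists (2 * C) => [|a' b' aC bC yab']; first lra.
    have [|H1 H2] := H (a', b').
      have -> : cpx (a', b') - cpx (a, b) = dirc true (a' - a) + dirc false (b' - b).
        by rewrite /cpx /dirc; simpc.
      apply: le_trans (ler_wpM2r (_ : 0 <= C) (cabsD _ _)) _; first lra.
      rewrite !cabs_dirc; lra.
    split => [|h h0 hC]; first lra.
    apply: le_trans (H2 h h0 _); last first.
      rewrite -(gtr0_norm h0); apply: (@scaled_le _ _ (2 * C)); first lra.
      by rewrite gtr0_norm.
    by rewrite lerN2 ler_wpM2r// ?exprn_ge0 ?(ltW h0)//; lra.
  (* Near a point with [Y < y] the claim is vacuous; [K] is a local Lipschitz constant of [Y] that
     makes the neighbourhood explicit. *)
  pose K := 4 * `|a| + 4 * `|b| + 2.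
  pose C := 1 + K / (y - Y (a, b)).
  have a0 := normr_ge0 a; have b0 := normr_ge0 b.
  have K0 : 0 < K by rewrite /K; lra.
  have n0 : 0 < K / (y - Y (a, b)) by rewrite divr_gt0//; lra.
  exists C => [|a' b' aC bC yab']; first by rewrite /C; lra.
  exfalso; move: yab'; apply/negP; rewrite -ltNge.
  have half (x : R) : `|x| * C <= 1 -> `|x| <= 1 /\ `|x| * K < y - Y (a, b).
    have [->|x0] := eqVneq x 0; first by move=> _; rewrite normr0 mul0r subr_gt0 ler01.
    have {}x0 : 0 < `|x| by rewrite normr_gt0.
    move=> xC; split; first by rewrite -[`|x|]mulr1; apply: scaled_le xC; rewrite /C; lra.
    rewrite -[y - _]mul1r -ltr_pdivrMr ?subr_gt0// -mulrA; apply: lt_le_trans xC.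
    by rewrite ltr_pM2l// /C ltrDr.
  have [u1 u2] := half _ aC; have [v1 v2] := half _ bC.
  have key (x x' : R) : `|x' - x| <= 1 -> x ^+ 2 - x' ^+ 2 <= `|x' - x| * (2 * `|x| + 1).
    move=> x1; apply: le_trans (ler_norm _) _.
    have -> : x ^+ 2 - x' ^+ 2 = (x' - x) * - (2 * x + (x' - x)) by ring.
    rewrite normrM normrN ler_wpM2l//; apply: le_trans (ler_normD _ _) _.
    by rewrite normrM (@ger0_norm _ 2)//; lra.
  have ka := key a a' u1; have kb := key b b' v1.
  have la : `|a' - a| * (2 * `|a| + 1) <= `|a' - a| * K / 2.
    by rewrite -mulrA ler_wpM2l// /K; lra.
  have lb : `|b' - b| * (2 * `|b| + 1) <= `|b' - b| * K / 2.
    by rewrite -mulrA ler_wpM2l// /K; lra.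
  by move: u2 v2; rewrite /Y/=; lra.
- exists C => // -[a b] yz.
  have ab1 : a ^+ 2 + b ^+ 2 <= 1 by move: yz; rewrite /Y/=; lra.
  have a2 := sqr_ge0 a; have b2 := sqr_ge0 b.
  have u (x : R) : x ^+ 2 <= 1 -> -1 <= x <= 1.
    by move=> x2; apply/andP; split; nra.
  by apply: H => //; apply: u; lra.
Qed.

(** * The weight *)

Lemma utay_sub {R : realType} (I J : R -> Prop) (X X1 X2 : R -> R) :
  (forall x, I x -> J x) -> utay J X X1 X2 -> utay I X X1 X2.
Proof. by move=> IJ [D D1 H]; exists D => // a b /IJ; exact: H. Qed.

Lemma utayD {R : realType} (I : R -> Prop) (X X1 X2 Z Z1 Z2 : R -> R) :
  utay I X X1 X2 -> utay I Z Z1 Z2 ->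
  utay I (fun x => X x + Z x) (fun x => X1 x + Z1 x) (fun x => X2 x + Z2 x).
Proof.
move=> [C C1 H] [D D1 K]; exists (C + D) => [|a b Ia ab]; first lra.
have [|h0 h1 h2 h3] := H a b Ia; first by apply: scaled_le ab; lra.
have [|k0 k1 k2 k3] := K a b Ia; first by apply: scaled_le ab; lra.
split; [| | |].
- by apply: le_trans (ler_normD _ _) _; lra.
- by apply: le_trans (ler_normD _ _) _; lra.
- by apply: le_trans (ler_normD _ _) _; lra.
have -> : X b + Z b - (X a + Z a) - (X1 a + Z1 a) * (b - a) - (X2 a + Z2 a) / 2 * (b - a) ^+ 2 =
  (X b - X a - X1 a * (b - a) - X2 a / 2 * (b - a) ^+ 2) +
  (Z b - Z a - Z1 a * (b - a) - Z2 a / 2 * (b - a) ^+ 2) by ring.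
by apply: le_trans (ler_normD _ _) _; rewrite mulrDl lerD.
Qed.

Lemma utayZ {R : realType} (I : R -> Prop) (X X1 X2 : R -> R) (c : R) :
  utay I X X1 X2 -> utay I (fun x => c * X x) (fun x => c * X1 x) (fun x => c * X2 x).
Proof.
move=> [C C1 H]; exists ((1 + `|c|) * C) => [|a b Ia ab].
  by rewrite mulrDl mul1r ler_wpDr// mulr_ge0//; lra.
have cC : C <= (1 + `|c|) * C by rewrite mulrDl mul1r lerDl mulr_ge0//; lra.
have hc x : `|x| <= C -> `|c * x| <= (1 + `|c|) * C.
  by move=> xC; rewrite normrM; apply: ler_pM => //; lra.
have [|h0 h1 h2 h3] := H a b Ia; first by apply: scaled_le ab.
split; [exact: hc|exact: hc|exact: hc|].
have -> : c * X b - c * X a - c * X1 a * (b - a) - c * X2 a / 2 * (b - a) ^+ 2 =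
   c * (X b - X a - X1 a * (b - a) - X2 a / 2 * (b - a) ^+ 2) by ring.
by rewrite normrM -(mulrA (1 + `|c|)); apply: ler_pM => //; lra.
Qed.

Lemma utay_poly {R : realType} (B c0 c1 c2 : R) :
  utay (fun a => `|a| <= B) (fun x => c0 + c1 * x + c2 * x ^+ 2)
    (fun x => c1 + 2 * c2 * x) (fun=> 2 * c2).
Proof.
have n0 := normr_ge0 c0; have n1 := normr_ge0 c1; have n2 := normr_ge0 c2.
have nB := normr_ge0 B.
have p1 := mulr_ge0 n1 nB; have p2 := mulr_ge0 n2 nB.
have p3 := mulr_ge0 n2 (exprn_ge0 2 nB).
exists (1 + `|c0| + `|c1| + 2 * `|c2| + `|c1| * `|B| + 2 * (`|c2| * `|B|) + `|c2| * `|B| ^+ 2) => [|a b aB ab].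
  lra.
have aB' : `|a| <= `|B| by apply: le_trans aB (ler_norm _).
have q1 : `|c1| * `|a| <= `|c1| * `|B| by rewrite ler_wpM2l.
have q2 : `|c2| * `|a| <= `|c2| * `|B| by rewrite ler_wpM2l.
have q3 : `|c2| * `|a| ^+ 2 <= `|c2| * `|B| ^+ 2.
  by rewrite ler_wpM2l//; apply: lerXn2r; rewrite ?nnegrE.
split.
- apply: le_trans (ler_normD _ _) _; apply: le_trans (lerD (ler_normD _ _) (lexx _)) _.
  by rewrite (normrM c1) (normrM c2) normrX; lra.
- apply: le_trans (ler_normD _ _) _.
  by rewrite !normrM (@ger0_norm _ 2)//; lra.
- by rewrite normrM (@ger0_norm _ 2)//; lra.
have -> : c0 + c1 * b + c2 * b ^+ 2 - (c0 + c1 * a + c2 * a ^+ 2) - (c1 + 2 * c2 * a) * (b - a) -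
   2 * c2 / 2 * (b - a) ^+ 2 = 0 by field.
by rewrite normr0 mulr_ge0 ?exprn_ge0//; lra.
Qed.

Lemma expR_lip {R : realType} (x y B : R) : x <= B -> y <= B ->
  `|expR y - expR x| <= expR B * `|y - x|.
Proof.
have main u v : u <= v -> v <= B -> `|expR v - expR u| <= expR B * `|v - u|.
  move=> uv vB; rewrite !ger0_norm ?subr_ge0 ?ler_expR//.
  have k := expR_ge1Dx (u - v).
  have E : expR u = expR v * expR (u - v) by rewrite -expRD; congr expR; ring.
  rewrite E -[X in X - _]mulr1 -mulrBr.
  have h : expR v <= expR B by rewrite ler_expR.
  apply: ler_pM => //; [rewrite subr_ge0 -expR0 ler_expR; lra|lra].
move=> xB yB; have [xy|yx] := leP x y; first exact: main.
by rewrite distrC [`|y - x|]distrC; apply: main => //; exact: ltW.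
Qed.

Lemma is_derive_expc {R : realType} (c x : R) :
  is_derive x 1 (fun x : R => expR (c * x)) (c * expR (c * x)).
Proof.
have d1 : is_derive x 1 (fun x : R => c * x) c.
  by apply: is_derive_eq; rewrite /GRing.scale/=; ring.
apply: is_derive_eq (is_derive1_comp (is_derive_expR (c * x)) d1) _.
by rewrite mulrC.
Qed.

Lemma utay_expc {R : realType} (B c : R) :
  utay (fun a => `|a| <= B) (fun x => expR (c * x)) (fun x => c * expR (c * x))
    (fun x => c ^+ 2 * expR (c * x)).
Proof.
pose K := `|c| * (`|B| + 1).
have nc := normr_ge0 c; have nB := normr_ge0 B.
have c2 : 0 <= `|c| ^+ 2 by rewrite exprn_ge0.
have c3 : 0 <= `|c| ^+ 3 by rewrite exprn_ge0.
have eK := expR_gt0 K.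
pose M := 1 + (1 + `|c| + `|c| ^+ 2 + `|c| ^+ 3) * expR K.
have t0 : 0 <= `|c| * expR K by rewrite mulr_ge0 ?(ltW eK).
have t2 : 0 <= `|c| ^+ 2 * expR K by rewrite mulr_ge0 ?(ltW eK).
have t3 : 0 <= `|c| ^+ 3 * expR K by rewrite mulr_ge0 ?(ltW eK).
have ME : M = 1 + expR K + `|c| * expR K + `|c| ^+ 2 * expR K + `|c| ^+ 3 * expR K.
  by rewrite /M; ring.
have cxK x : `|x| <= `|B| + 1 -> c * x <= K.
  by move=> xB; apply: le_trans (ler_norm _) _; rewrite normrM /K ler_wpM2l.
have dexp := @is_derive_expc R c.
apply: (@utay_deriv R _ (fun x => `|x| <= `|B| + 1) _ _ _ M).
- by rewrite ME; lra.
- move=> a b aB abM.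
  have : `|b - a| <= 1.
    by rewrite -[`|b - a|]mulr1; apply: scaled_le abM; rewrite ME; lra.
  have := ler_normD (b - a) a; rewrite subrK; have := ler_norm B; lra.
- move=> x _; have := dexp x => ?.
  by apply: is_derive_eq; rewrite /GRing.scale/= expr2 mulrA.
- move=> x /cxK xK; have e0 := expR_gt0 (c * x).
  have eM : expR (c * x) <= expR K by rewrite ler_expR.
  split.
  + by rewrite gtr0_norm// ME; lra.
  + rewrite normrM (gtr0_norm e0).
    have : `|c| * expR (c * x) <= `|c| * expR K by rewrite ler_wpM2l.
    by rewrite ME; lra.
  + rewrite normrM normrX (gtr0_norm e0).
    have : `|c| ^+ 2 * expR (c * x) <= `|c| ^+ 2 * expR K by rewrite ler_wpM2l.
    by rewrite ME; lra.
- move=> x y /cxK xK /cxK yK.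
  rewrite -mulrBr normrM normrX.
  apply: le_trans (ler_wpM2l c2 (expR_lip xK yK)) _.
  have -> : c * y - c * x = c * (y - x) by ring.
  rewrite normrM.
  have -> : `|c| ^+ 2 * (expR K * (`|c| * `|y - x|)) = (`|c| ^+ 3 * expR K) * `|y - x| by ring.
  by rewrite ler_wpM2r// ME; lra.
Qed.

(** The first derivative of a log-sum-exp is the [tau]-weighted mean of the two derivatives; the
    second is the mean of the second derivatives plus the variance [tau (1 - tau) (A1 - B1)^2] of
    the first ones. *)
Lemma gjet_lse {R : realType} I (P : I -> Prop) (A B : I -> R -> R) A0 A1 A2 B0 B1 B2
    (tau : I -> R) :
  (forall i, tau i = expR (A0 i) / (expR (A0 i) + expR (B0 i))) ->
  gjet P A A0 A1 A2 -> gjet P B B0 B1 B2 ->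
  gjet P (fun i t => ln (expR (A i t) + expR (B i t)))
   (fun i => ln (expR (A0 i) + expR (B0 i)))
   (fun i => tau i * A1 i + (1 - tau i) * B1 i)
   (fun i => tau i * A2 i + (1 - tau i) * B2 i + tau i * (1 - tau i) * (A1 i - B1 i) ^+ 2).
Proof.
move=> tauE JA JB; have [CA CA1 HA] := JA; have [CB CB1 HB] := JB.
have bA i : P i -> `|A0 i| <= CA by move=> /(HA i)[].
have bB i : P i -> `|B0 i| <= CB by move=> /(HB i)[].
have EA := gjet_comp (utay_expc CA 1) bA JA.
have EB := gjet_comp (utay_expc CB 1) bB JB.
have J := gjetD EA EB.
have range i : P i -> expR (- CA) <= expR (1 * A0 i) + expR (1 * B0 i) <= expR CA + expR CB.
  move=> Pi; rewrite !mul1r; have := bA i Pi; have := bB i Pi.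
  rewrite !ler_norml => /andP[u1 u2] /andP[u3 u4].
  have := expR_gt0 (B0 i).
  have : expR (- CA) <= expR (A0 i) by rewrite ler_expR.
  have : expR (A0 i) <= expR CA by rewrite ler_expR.
  have : expR (B0 i) <= expR CB by rewrite ler_expR.
  by move=> *; apply/andP; split; lra.
apply: gjet_ext (gjet_comp (utay_ln _ (expR_gt0 (- CA))) range J).
- by move=> i t; rewrite !mul1r.
- by move=> i _; rewrite !mul1r.
- move=> i _; rewrite tauE !mul1r.
  have := expR_gt0 (A0 i); have := expR_gt0 (B0 i) => b0 a0.
  by field; rewrite gt_eqF// addr_gt0.
- move=> i _; rewrite tauE !mul1r.
  have := expR_gt0 (A0 i); have := expR_gt0 (B0 i) => b0 a0.
  by field; rewrite gt_eqF// addr_gt0.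
Qed.

(** * Logarithmic derivatives of the weight and its subharmonicity near the circle *)

Definition co {R : realType} (e : bool) (z : pt R) : R := if e then z.1 else z.2.
Definition coc {R : realType} (e : bool) (w : R[i]) : R := if e then complex.Re w else complex.Im w.
Definition R2 {R : realType} (w : R[i]) (z : pt R) : R :=
  (z.1 - complex.Re w) ^+ 2 + (z.2 - complex.Im w) ^+ 2.

Lemma R2_cabs {R : realType} (w : R[i]) z : R2 w z = cabs (cpx z - w) ^+ 2.
Proof. by rewrite cabs_sq; case: w. Qed.

Lemma Y_le_dist {R : realType} (w : R[i]) z : cabs w = 1 -> 0 < Y z ->
  Y z <= 2 * cabs (cpx z - w).
Proof.
move=> w1; rewrite Y_gt0 => z1.
have : 1 <= cabs (cpx z - w) + cabs (cpx z).
  by have := cabsD (w - cpx z) (cpx z); rewrite subrK w1 cabsB.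
have := cabs_ge0 (cpx z); rewrite Y_cabs; set t := cabs _ in z1 *.
move=> t0 h; have : (1 - t) * (1 + t) <= (1 - t) * 2 by rewrite ler_wpM2l; lra.
lra.
Qed.

Lemma Y_le_R2 {R : realType} (w : R[i]) z : cabs w = 1 -> 0 < Y z -> Y z ^+ 2 <= 4 * R2 w z.
Proof.
move=> w1 Y0; rewrite R2_cabs.
have -> : 4 * cabs (cpx z - w) ^+ 2 = (2 * cabs (cpx z - w)) ^+ 2 by ring.
apply: lerXn2r; rewrite ?nnegrE ?(ltW Y0) ?mulr_ge0 ?cabs_ge0//.
exact: Y_le_dist.
Qed.

Lemma Y_le1 {R : realType} (z : pt R) : Y z <= 1.
Proof. by rewrite /Y; have := sqr_ge0 z.1; have := sqr_ge0 z.2; lra. Qed.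

Lemma co_le1 {R : realType} e (z : pt R) : 0 < Y z -> `|co e z| <= 1.
Proof.
rewrite /Y => h; have := sqr_ge0 z.1; have := sqr_ge0 z.2 => b a.
by case: e; rewrite /co -(@ler_pXn2r _ 2)// ?nnegrE// expr1n real_normK ?num_real//; lra.
Qed.

Lemma coc_le {R : realType} e (w : R[i]) : `|coc e w| <= cabs w.
Proof. by case: e; [exact: Re_le_cabs|exact: Im_le_cabs]. Qed.

Lemma ujet_Y {R : realType} (y : R) : 0 < y ->
  ujet (fun z => y <= Y z) (@Y R) (fun e z => - 2 * co e z) (fun _ _ => - 2).
Proof.
move=> y0; exists 2 => [|[e z] /= yz]; first lra.
have Y0 : 0 < Y z by apply: lt_le_trans yz.
split.
- by rewrite gtr0_norm//; have := Y_le1 z; lra.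
- by rewrite normrM normrN (@ger0_norm _ 2)//; have := co_le1 e Y0; lra.
- by rewrite normrN ger0_norm.
- move=> t _.
  have -> : Y (sh e z t) - Y z - - 2 * co e z * t - - 2 / 2 * t ^+ 2 = 0.
    by case: e; rewrite /Y /sh /co/=; field.
  by rewrite normr0 mulr_ge0 ?exprn_ge0.
Qed.

Lemma ujet_dist2 {R : realType} (P : pt R -> Prop) (w : R[i]) (B : R) :
  (forall z, P z -> cabs (cpx z) <= B) ->
  ujet P (R2 w) (fun e z => 2 * (co e z - coc e w)) (fun _ _ => 2).
Proof.
move=> PB; have w0 := cabs_ge0 w.
pose C := `|B| + cabs w.
have C0 : 0 <= C by rewrite addr_ge0.
exists (2 + 2 * C + C ^+ 2) => [|[e z] /= Pz]; first by have := sqr_ge0 C; lra.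
have zB : cabs (cpx z) <= `|B| by apply: le_trans (PB z Pz) (ler_norm _).
have zw : cabs (cpx z - w) <= C.
  by apply: le_trans (cabsD _ _) _; rewrite cabsN /C; lra.
have C2 := sqr_ge0 C.
split.
- rewrite R2_cabs normrX (ger0_norm (cabs_ge0 _)).
  have : cabs (cpx z - w) ^+ 2 <= C ^+ 2 by apply: lerXn2r; rewrite ?nnegrE ?cabs_ge0.
  lra.
- rewrite normrM (@ger0_norm _ 2)//.
  have -> : co e z - coc e w = coc e (cpx z - w) by case: e; rewrite /co /coc/=; case: (w).
  by have := coc_le e (cpx z - w); lra.
- by rewrite ger0_norm//; lra.
- move=> t _.
  have -> : R2 w (sh e z t) - R2 w z - 2 * (co e z - coc e w) * t - 2 / 2 * t ^+ 2 = 0.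
    by case: e; rewrite /R2 /sh /co /coc/=; field.
  by rewrite normr0 mulr_ge0 ?exprn_ge0//; lra.
Qed.

Lemma cos2 {R : realType} (z : pt R) : co true z ^+ 2 + co false z ^+ 2 = 1 - Y z.
Proof. by rewrite /co /Y; ring. Qed.

Lemma R2_gt0 {R : realType} (w : R[i]) z : cabs w = 1 -> 0 < Y z -> 0 < R2 w z.
Proof.
move=> w1 Y0; have := Y_le_R2 w1 Y0; have := exprn_gt0 2 Y0; lra.
Qed.

Lemma ujet_lnY {R : realType} (y : R) : 0 < y ->
  ujet (fun z => y <= Y z) (fun z => ln (@Y R z)) (fun e z => - 2 * co e z / Y z)
    (fun e z => - 2 / Y z - (- 2 * co e z / Y z) ^+ 2).
Proof.
move=> y0.
have range (i : bool * pt R) : y <= Y i.2 -> y <= Y i.2 <= 1 by move=> ->; rewrite Y_le1.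
apply: gjet_ext (gjet_comp (utay_ln 1 y0) range (ujet_Y y0)) => // -[e z] /= yz.
  by rewrite mulrC.
have Y0 : Y z != 0 by rewrite gt_eqF// (lt_le_trans y0).
by field.
Qed.

Lemma ujet_lndist {R : realType} (w : R[i]) (y : R) : 0 < y -> cabs w = 1 ->
  ujet (fun z => y <= Y z) (fun z => ln (R2 w z))
   (fun e z => 2 * (co e z - coc e w) / R2 w z)
   (fun e z => 2 / R2 w z - (2 * (co e z - coc e w) / R2 w z) ^+ 2).
Proof.
move=> y0 w1.
have z1 (z : pt R) : y <= Y z -> cabs (cpx z) <= 1.
  by move=> yz; apply: ltW; rewrite -Y_gt0 (lt_le_trans y0).
have range (i : bool * pt R) : y <= Y i.2 -> y ^+ 2 / 4 <= R2 w i.2 <= 4.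
  move=> yz; have Y0 := lt_le_trans y0 yz.
  have h1 := Y_le_R2 w1 Y0.
  have h2 : y ^+ 2 <= Y i.2 ^+ 2 by apply: lerXn2r; rewrite ?nnegrE ?(ltW y0) ?(ltW Y0).
  have h3 : cabs (cpx i.2 - w) <= 2.
    by apply: le_trans (cabsD _ _) _; rewrite cabsN w1; have := z1 _ yz; lra.
  have h4 : R2 w i.2 <= 2 ^+ 2.
    by rewrite R2_cabs; apply: lerXn2r; rewrite ?nnegrE ?cabs_ge0.
  by apply/andP; split; lra.
have y2 : 0 < y ^+ 2 / 4 by rewrite divr_gt0 ?exprn_gt0.
apply: gjet_ext (gjet_comp (utay_ln 4 y2) range (ujet_dist2 w z1)) => // -[e z] /= yz.
  by rewrite mulrC.
have r0 : R2 w z != 0.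
  by have /andP[+ _] := range (e, z) yz => /(lt_le_trans y2) /gt_eqF ->.
by field.
Qed.

Lemma gjet_le {R : realType} I (P : I -> Prop) (F : I -> R -> R) F0 F1 F2 :
  gjet P F F0 F1 F2 -> exists2 C, 0 <= C & forall i, P i -> `|F0 i| <= C.
Proof. by move=> [C C1 H]; exists C => [|i /(H i)[]//]; lra. Qed.

(** The share of [Y^gam] in [Q]: the weight with which [ln Y] enters the logarithmic derivative of
    [Q]. *)
Definition tauw {R : realType} (gam kap : R) (zt : R[i]) (z : pt R) : R :=
  expR (gam * ln (Y z)) / (expR (gam * ln (Y z)) + expR (ln kap + gam / 2 * ln (R2 zt z))).

(* Logarithm of the weight [Y^a \prod_k |z - xi_k|^(beta_k) Q^(-b/gam)] with
   [Q = Y^gam + kap |z - zt|^gam]; since [Y <= 2|z - zt|], the last factor is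
   comparable to [|z - zt|^(-b)]. *)
Definition lamw {R : realType} (m : nat) (xi : 'I_m -> R[i]) (beta : 'I_m -> R)
   (zt : R[i]) (a b gam kap : R) (z : pt R) : R :=
  a * ln (Y z) + \sum_k beta k / 2 * ln (R2 (xi k) z)
  - b / gam * ln (expR (gam * ln (Y z)) + expR (ln kap + gam / 2 * ln (R2 zt z))).

Definition gY {R : realType} e (z : pt R) : R := - 2 * co e z / Y z.
Definition gR {R : realType} (w : R[i]) e (z : pt R) : R := 2 * (co e z - coc e w) / R2 w z.

Definition lamw1 {R : realType} (m : nat) (xi : 'I_m -> R[i]) (beta : 'I_m -> R)
   (zt : R[i]) (a b gam kap : R) (e : bool) (z : pt R) : R :=
  (a - b * tauw gam kap zt z) * gY e z + \sum_k beta k / 2 * gR (xi k) e z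
  - b * (1 - tauw gam kap zt z) / 2 * gR zt e z.

Definition lamw2 {R : realType} (m : nat) (xi : 'I_m -> R[i]) (beta : 'I_m -> R)
   (zt : R[i]) (a b gam kap : R) (e : bool) (z : pt R) : R :=
  (a - b * tauw gam kap zt z) * (- 2 / Y z - gY e z ^+ 2)
  + \sum_k beta k / 2 * (2 / R2 (xi k) z - gR (xi k) e z ^+ 2)
  - b * (1 - tauw gam kap zt z) / 2 * (2 / R2 zt z - gR zt e z ^+ 2)
  - b * gam * (tauw gam kap zt z * (1 - tauw gam kap zt z)) * (gY e z - gR zt e z / 2) ^+ 2.

Lemma ujet_lamw {R : realType} (m : nat) (xi : 'I_m -> R[i]) (beta : 'I_m -> R)
   (zt : R[i]) (a b gam kap y : R) :
  (forall k, cabs (xi k) = 1) -> cabs zt = 1 -> 0 < gam -> 0 < y ->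
  ujet (fun z => y <= Y z) (lamw xi beta zt a b gam kap)
    (lamw1 xi beta zt a b gam kap) (lamw2 xi beta zt a b gam kap).
Proof.
move=> xi1 zt1 gam0 y0.
have JY := ujet_lnY y0.
have JR w w1 := @ujet_lndist R w y y0 w1.
have JA := gjetZ gam JY.
have JB := gjetD (gjet_cst _ (ln kap)) (gjetZ (gam / 2) (JR zt zt1)).
have JQ := gjet_lse (tau := fun i => tauw gam kap zt i.2) (fun i => erefl) JA JB.
have JS := gjet_sum (index_enum 'I_m) (fun k => gjetZ (beta k / 2) (JR (xi k) (xi1 k))).
apply: gjet_ext (gjetD (gjetD (gjetZ a JY) JS) (gjetZ (- (b / gam)) JQ)).
- by move=> i t; rewrite /lamw mulNr.
- by move=> i _; rewrite /lamw mulNr.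
- move=> [e z] /= yz; rewrite /lamw1 /gY /gR; have Y0 := lt_le_trans y0 yz.
  have rz := R2_gt0 zt1 Y0.
  by field; rewrite !gt_eqF.
- move=> [e z] /= yz; rewrite /lamw2 /gY /gR; have Y0 := lt_le_trans y0 yz.
  have rz := R2_gt0 zt1 Y0.
  by field; rewrite !gt_eqF.
Qed.

Lemma gY_sq {R : realType} (z : pt R) : 0 < Y z ->
  gY true z ^+ 2 + gY false z ^+ 2 = 4 * (1 - Y z) / Y z ^+ 2.
Proof. by move=> Y0; rewrite -cos2 /gY; field; rewrite gt_eqF. Qed.

Lemma gY_co {R : realType} (z : pt R) : 0 < Y z ->
  gY true z * co true z + gY false z * co false z = - (2 * (1 - Y z) / Y z).
Proof. by move=> Y0; rewrite -cos2 /gY; field; rewrite gt_eqF. Qed.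

Lemma gR_sq {R : realType} (w : R[i]) (z : pt R) : cabs w = 1 -> 0 < Y z ->
  gR w true z ^+ 2 + gR w false z ^+ 2 = 4 / R2 w z.
Proof.
move=> w1 Y0; have r0 := R2_gt0 w1 Y0.
have E : R2 w z = (co true z - coc true w) ^+ 2 + (co false z - coc false w) ^+ 2 by [].
rewrite /gR.
have -> : 4 / R2 w z = 4 * R2 w z / R2 w z ^+ 2 by field; rewrite gt_eqF.
by rewrite [X in 4 * X / _]E; field; rewrite gt_eqF.
Qed.

Lemma gR_co {R : realType} (w : R[i]) (z : pt R) : cabs w = 1 -> 0 < Y z ->
  gR w true z * co true z + gR w false z * co false z = 1 - Y z / R2 w z.
Proof.
move=> w1 Y0; have r0 := R2_gt0 w1 Y0.
have E : R2 w z - Y z = 2 * ((co true z - coc true w) * co true z + (co false z - coc false w) * co false z).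
  have := cabs_sq w; rewrite w1 expr1n /R2 /Y /co /coc => h.
  have -> : R2 w z - Y z = R2 w z - Y z + (1 - (complex.Re w ^+ 2 + complex.Im w ^+ 2)) by rewrite -h; ring.
  by rewrite /R2 /Y; ring.
have -> : 1 - Y z / R2 w z = (R2 w z - Y z) / R2 w z by field; rewrite gt_eqF.
by rewrite E /gR; field; rewrite gt_eqF.
Qed.

Lemma tauw01 {R : realType} gam kap (zt : R[i]) z : 0 <= tauw gam kap zt z <= 1.
Proof.
rewrite /tauw; set x := expR _; set y := expR _.
have x0 : 0 < x by exact: expR_gt0.
have y0 : 0 < y by exact: expR_gt0.
rewrite divr_ge0 ?addr_ge0 ?(ltW x0) ?(ltW y0)//=.
by rewrite ler_pdivrMr ?addr_gt0// mul1r lerDl ltW.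
Qed.

(** The unsmoothed part of the last factor, of weight [1 - tau], pulls the radial derivative the
    wrong way by an amount proportional to [Y^2 / |z - zt|^2]. Where that ratio is not small,
    [Y^gam] dominates [Q]; the product is of order [kap]. *)
Lemma tauw_far {R : realType} gam kap (zt : R[i]) z : 0 < gam <= 1 -> 0 < kap ->
  cabs zt = 1 -> 0 < Y z ->
  (1 - tauw gam kap zt z) * (Y z ^+ 2) <= 4 * kap * R2 zt z.
Proof.
move=> /andP[g0 g1] k0 zt1 Y0; have r0 := R2_gt0 zt1 Y0.
have h := Y_le_R2 zt1 Y0.
pose s := ln (R2 zt z) / 2 - ln (Y z).
have t1 : 1 - tauw gam kap zt z <= kap * expR (gam * s).
  rewrite /tauw; set x := expR _; set y := expR _.
  have x0 : 0 < x by exact: expR_gt0.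
  have y0 : 0 < y by exact: expR_gt0.
  have -> : 1 - x / (x + y) = y / (x + y) by field; rewrite gt_eqF ?addr_gt0.
  rewrite ler_pdivrMr ?addr_gt0//.
  have -> : y = kap * expR (gam * s) * x.
    have kE : expR (ln kap) = kap by rewrite lnK ?posrE.
    by rewrite -{1}kE -!expRD; congr expR; rewrite /s; field.
  by rewrite ler_wpM2l// ?lerDl ?mulr_ge0 ?expR_ge0 ?(ltW k0) ?(ltW x0).
have t2 : expR (gam * s) * Y z ^+ 2 <= 4 * R2 zt z.
  have E : R2 zt z = expR (2 * s) * Y z ^+ 2.
    rewrite -[R2 zt z]lnK ?posrE// -[Y z in RHS]lnK ?posrE// expr2 -!expRD.
    by congr expR; rewrite /s; field.
  have [s0|s0] := leP 0 s.
    rewrite E mulrA ler_wpM2r ?sqr_ge0//.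
    have : expR (gam * s) <= expR (2 * s) by rewrite ler_expR ler_wpM2r//; lra.
    have := expR_gt0 (2 * s); lra.
  apply: le_trans h; rewrite ler_piMl ?sqr_ge0// -expR0 ler_expR.
  by rewrite nmulr_lle0// ltW.
apply: le_trans (ler_wpM2r (sqr_ge0 _) t1) _.
have -> : 4 * kap * R2 zt z = kap * (4 * R2 zt z) by ring.
by rewrite -mulrA ler_wpM2l// ltW.
Qed.

(** Logarithms of distances are harmonic off their poles, so the [xi k] and [zt] terms cancel;
    [ln Y] and the variance of the log-sum-exp remain, the latter damped by [gam]. *)
Lemma lamw2_sum {R : realType} (m : nat) (xi : 'I_m -> R[i]) (beta : 'I_m -> R)
   (zt : R[i]) (a b gam kap : R) (z : pt R) :
  (forall k, cabs (xi k) = 1) -> cabs zt = 1 -> 0 < Y z ->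
  lamw2 xi beta zt a b gam kap true z + lamw2 xi beta zt a b gam kap false z =
  - (4 * (a - b * tauw gam kap zt z) / Y z ^+ 2) -
  b * gam * (tauw gam kap zt z * (1 - tauw gam kap zt z)) *
    ((gY true z - gR zt true z / 2) ^+ 2 + (gY false z - gR zt false z / 2) ^+ 2).
Proof.
move=> xi1 zt1 Y0; rewrite /lamw2; set T := tauw _ _ _ _.
have sxi : \sum_k beta k / 2 * (2 / R2 (xi k) z - gR (xi k) true z ^+ 2) +
           \sum_k beta k / 2 * (2 / R2 (xi k) z - gR (xi k) false z ^+ 2) = 0.
  rewrite -big_split big1//= => k _; have := gR_sq (xi1 k) Y0 => h.
  have -> : beta k / 2 * (2 / R2 (xi k) z - gR (xi k) true z ^+ 2) +
    beta k / 2 * (2 / R2 (xi k) z - gR (xi k) false z ^+ 2) =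
    beta k / 2 * (4 / R2 (xi k) z - (gR (xi k) true z ^+ 2 + gR (xi k) false z ^+ 2)) by ring.
  by rewrite h subrr mulr0.
have szt : (2 / R2 zt z - gR zt true z ^+ 2) + (2 / R2 zt z - gR zt false z ^+ 2) = 0.
  have := gR_sq zt1 Y0 => h.
  have -> : (2 / R2 zt z - gR zt true z ^+ 2) + (2 / R2 zt z - gR zt false z ^+ 2) =
    4 / R2 zt z - (gR zt true z ^+ 2 + gR zt false z ^+ 2) by ring.
  by rewrite h subrr.
have sY : (- 2 / Y z - gY true z ^+ 2) + (- 2 / Y z - gY false z ^+ 2) = - (4 / Y z ^+ 2).
  have -> : (- 2 / Y z - gY true z ^+ 2) + (- 2 / Y z - gY false z ^+ 2) =
    - 4 / Y z - (gY true z ^+ 2 + gY false z ^+ 2) by ring.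
  by rewrite gY_sq//; field; rewrite gt_eqF.
move: sxi szt sY; set s1 := \sum_k _; set s2 := \sum_k _.
set u1 := 2 / _ - gR _ true _ ^+ 2; set u2 := 2 / _ - gR _ false _ ^+ 2.
set v1 := - 2 / _ - _; set v2 := - 2 / Y z - _ => e1 e2 e3.
have -> : s1 = - s2 by lra.
have -> : u1 = - u2 by lra.
have -> : v1 = - (4 / Y z ^+ 2) - v2 by lra.
ring.
Qed.

(** The quantity is the Laplacian of [exp lam] divided by [exp lam]. With
    [d = a - b tau >= 1 + eps], the Laplacian of [lam] costs at most [(4 d + eps) / Y^2], while the
    squared radial derivative brings at least [(2 d - eps / 2)^2 / Y^2], which is larger. *)
Lemma lamw_subharm {R : realType} (m : nat) (xi : 'I_m -> R[i]) (beta : 'I_m -> R)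
   (zt : R[i]) (a b gam kap eps Y0 : R) (z : pt R) :
  (forall k, cabs (xi k) = 1) -> cabs zt = 1 ->
  (forall k, 0 <= beta k) -> 0 <= b -> 0 < eps -> 1 + eps <= a - b ->
  0 < gam <= 1 -> 0 < kap -> 4 * b * gam <= eps -> 8 * b * kap <= eps ->
  4 * (Y0 * (2 * a + \sum_k beta k / 2)) <= eps ->
  0 < Y z -> Y z <= Y0 ->
  0 <= lamw2 xi beta zt a b gam kap true z + lamw2 xi beta zt a b gam kap false z +
    (lamw1 xi beta zt a b gam kap true z ^+ 2 + lamw1 xi beta zt a b gam kap false z ^+ 2).
Proof.
move=> xi1 zt1 beta0 b0 eps0 abe gam01 kap0 c1 c2 c3 Yp YY0.
have /andP[gam0 gam1] := gam01.
rewrite lamw2_sum//.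
have /andP[T0 T1] := tauw01 gam kap zt z.
have Tf := tauw_far gam01 kap0 zt1 Yp.
have r0 := R2_gt0 zt1 Yp.
pose S := \sum_k beta k / 2; rewrite -/S in c3.
have S0 : 0 <= S by apply: sumr_ge0 => k _; rewrite divr_ge0.
set T := tauw _ _ _ _ in T0 T1 Tf *; set y := Y z in Yp YY0 Tf r0 *.
pose d := a - b * T.
have d1 : 1 + eps <= d by rewrite /d; nra.
have da : d <= a by rewrite /d; nra.
have y1 : y <= 1 by exact: Y_le1.
pose X e := lamw1 xi beta zt a b gam kap e z.
rewrite -/(X true) -/(X false).
(* The derivative of [lam] in the direction of [z]. *)
have Q : X true * co true z + X false * co false z =
   - (2 * d * (1 - y) / y) + \sum_k beta k / 2 * (1 - y / R2 (xi k) z)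
   - b * (1 - T) / 2 * (1 - y / R2 zt z).
  have -> : \sum_k beta k / 2 * (1 - y / R2 (xi k) z) =
    (\sum_k beta k / 2 * gR (xi k) true z) * co true z +
    (\sum_k beta k / 2 * gR (xi k) false z) * co false z.
    rewrite !mulr_suml -big_split; apply: eq_bigr => k _ /=.
    by rewrite -(gR_co (xi1 k) Yp); ring.
  rewrite -(gR_co zt1 Yp) /X /lamw1 -/T -/d.
  have -> : - (2 * d * (1 - y) / y) = d * (gY true z * co true z + gY false z * co false z).
    by rewrite gY_co// -/y; ring.
  ring.
have Qs : \sum_k beta k / 2 * (1 - y / R2 (xi k) z) <= S.
  apply: ler_sum => k _; rewrite ler_piMr ?divr_ge0// gerBl divr_ge0 ?(ltW Yp)//.
  exact: (ltW (R2_gt0 (xi1 k) Yp)).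
pose q := - (X true * co true z + X false * co false z).
(* The loss [eps / 2] has two halves: the terms of order [Y], small by the choice of [Y0], and the
   pull of [zt], at most [2 b kap] by [tauw_far]. *)
have qy : 2 * d - eps / 2 <= q * y.
  have e1 : q * y = 2 * d * (1 - y) - (\sum_k beta k / 2 * (1 - y / R2 (xi k) z)) * y
     + b * (1 - T) / 2 * y - b * ((1 - T) * y ^+ 2 / R2 zt z) / 2.
    by rewrite /q Q; field; rewrite !gt_eqF.
  have e2 : (1 - T) * y ^+ 2 / R2 zt z <= 4 * kap by rewrite ler_pdivrMr.
  have e3 : b * ((1 - T) * y ^+ 2 / R2 zt z) <= b * (4 * kap) by rewrite ler_wpM2l.
  have e4 : (\sum_k beta k / 2 * (1 - y / R2 (xi k) z)) * y <= S * y by rewrite ler_wpM2r// ltW.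
  have e5 : 0 <= b * (1 - T) / 2 * y.
    by rewrite mulr_ge0 ?(ltW Yp)// divr_ge0// mulr_ge0// subr_ge0.
  have e6 : 2 * d * y + S * y <= Y0 * (2 * a + S).
    have -> : 2 * d * y + S * y = y * (2 * d + S) by ring.
    by apply: ler_pM; rewrite ?(ltW Yp)//; lra.
  rewrite e1; lra.
(* Lagrange's identity, that is Cauchy-Schwarz with [|z| <= 1]. *)
have q2 : q ^+ 2 <= X true ^+ 2 + X false ^+ 2.
  have cs : co true z ^+ 2 + co false z ^+ 2 <= 1 by rewrite cos2 gerBl ltW.
  have -> : q ^+ 2 = (X true ^+ 2 + X false ^+ 2) * (co true z ^+ 2 + co false z ^+ 2)
    - (X true * co false z - X false * co true z) ^+ 2 by rewrite /q; ring.
  apply: (le_trans (y := (X true ^+ 2 + X false ^+ 2) * (co true z ^+ 2 + co false z ^+ 2))).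
    by rewrite gerBl sqr_ge0.
  by rewrite ler_piMr// addr_ge0// sqr_ge0.
have gb : (gY true z - gR zt true z / 2) ^+ 2 + (gY false z - gR zt false z / 2) ^+ 2 <= 16 / y ^+ 2.
  have h1 := gY_sq Yp; have h2 := gR_sq zt1 Yp.
  have h3 : 4 / R2 zt z <= 16 / y ^+ 2.
    rewrite ler_pdivrMr// mulrAC ler_pdivlMr ?exprn_gt0//.
    have := Y_le_R2 zt1 Yp; rewrite -/y; lra.
  have h4 : 4 * (1 - y) / y ^+ 2 <= 4 / y ^+ 2.
    by rewrite ler_pM2r ?invr_gt0 ?exprn_gt0//; lra.
  rewrite -/y in h1.
  have : (gY true z + gR zt true z / 2) ^+ 2 + (gY false z + gR zt false z / 2) ^+ 2 >= 0.
    by rewrite addr_ge0 ?sqr_ge0.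
  lra.
have TT : T * (1 - T) <= 1 / 4 by have := sqr_ge0 (T - 1 / 2); lra.
have TT0 : 0 <= T * (1 - T) by rewrite mulr_ge0// subr_ge0.
have g1 : b * gam * (T * (1 - T)) * ((gY true z - gR zt true z / 2) ^+ 2 + (gY false z - gR zt false z / 2) ^+ 2)
   <= eps / y ^+ 2.
  have bg : 0 <= b * gam by rewrite mulr_ge0// ltW.
  apply: (le_trans (y := b * gam * (1 / 4) * (16 / y ^+ 2))).
    apply: ler_pM => //; [exact: mulr_ge0|by rewrite addr_ge0 ?sqr_ge0|].
    exact: ler_wpM2l.
  have -> : b * gam * (1 / 4) * (16 / y ^+ 2) = (4 * b * gam) / y ^+ 2 by field; rewrite gt_eqF.
  by rewrite ler_pM2r ?invr_gt0 ?exprn_gt0.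
rewrite -/d.
suff : 0 <= q ^+ 2 - 4 * d / y ^+ 2 - eps / y ^+ 2 by lra.
have -> : q ^+ 2 - 4 * d / y ^+ 2 - eps / y ^+ 2 = ((q * y) ^+ 2 - 4 * d - eps) / y ^+ 2.
  by field; rewrite gt_eqF.
rewrite divr_ge0 ?sqr_ge0//.
have : (2 * d - eps / 2) ^+ 2 <= (q * y) ^+ 2.
  by apply: lerXn2r; rewrite ?nnegrE//; lra.
nra.
Qed.

Lemma lamw_bounds {R : realType} (m : nat) (xi : 'I_m -> R[i]) (beta : 'I_m -> R)
   (zt : R[i]) (a b gam kap : R) :
  (forall k, cabs (xi k) = 1) -> cabs zt = 1 ->
  (forall k, 0 <= beta k) -> 0 <= b -> 0 <= a - b -> 0 < gam <= 1 ->
  exists2 C, 1 <= C & forall z, 0 < Y z ->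
   `|lamw2 xi beta zt a b gam kap true z + lamw2 xi beta zt a b gam kap false z| <= C / Y z ^+ 2 /\
   lamw1 xi beta zt a b gam kap true z ^+ 2 + lamw1 xi beta zt a b gam kap false z ^+ 2 <= C / Y z ^+ 2.
Proof.
move=> xi1 zt1 beta0 b0 ab gam01; have /andP[gam0 gam1] := gam01.
pose S := \sum_k beta k / 2.
have S0 : 0 <= S by apply: sumr_ge0 => k _; rewrite divr_ge0.
pose D := 2 * a + 4 * S + 2 * b.
have D0 : 0 <= D by rewrite /D; lra.
exists (1 + 4 * a + 4 * b + 2 * D ^+ 2) => [|z Y0]; first by have := sqr_ge0 D; lra.
have D2 := sqr_ge0 D.
have /andP[T0 T1] := tauw01 gam kap zt z.
set T := tauw _ _ _ _ in T0 T1.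
have bT : b * T <= b by rewrite ler_piMr.
have d0 : 0 <= a - b * T by lra.
have da : a - b * T <= a by rewrite gerBl mulr_ge0.
have y2 : 0 < Y z ^+ 2 by rewrite exprn_gt0.
have r0 := R2_gt0 zt1 Y0.
have gYb e : `|gY e z| <= 2 / Y z.
  rewrite normrM normfV (gtr0_norm Y0) ler_pM2r ?invr_gt0//.
  by rewrite normrM normrN (@ger0_norm _ 2)//; have := co_le1 e Y0; lra.
have gRb w e : cabs w = 1 -> `|gR w e z| <= 4 / Y z.
  move=> w1; rewrite -(@ler_pXn2r _ 2)// ?nnegrE ?divr_ge0 ?(ltW Y0)//.
  rewrite real_normK ?num_real//.
  apply: (le_trans (y := gR w true z ^+ 2 + gR w false z ^+ 2)).
    by case: e; rewrite ?lerDl ?lerDr sqr_ge0.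
  rewrite gR_sq// ler_pdivrMr ?R2_gt0// expr_div_n mulrAC ler_pdivlMr//.
  by have := Y_le_R2 w1 Y0; lra.
split.
  rewrite lamw2_sum// -/T.
  have gb : (gY true z - gR zt true z / 2) ^+ 2 + (gY false z - gR zt false z / 2) ^+ 2 <= 16 / Y z ^+ 2.
    have h1 := gY_sq Y0; have h2 := gR_sq zt1 Y0.
    have h3 : 4 / R2 zt z <= 16 / Y z ^+ 2.
      rewrite ler_pdivrMr// mulrAC ler_pdivlMr//.
      by have := Y_le_R2 zt1 Y0; lra.
    have h4 : 4 * (1 - Y z) / Y z ^+ 2 <= 4 / Y z ^+ 2.
      by rewrite ler_pM2r ?invr_gt0//; lra.
    have : (gY true z + gR zt true z / 2) ^+ 2 + (gY false z + gR zt false z / 2) ^+ 2 >= 0.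
      by rewrite addr_ge0 ?sqr_ge0.
    lra.
  have TT : T * (1 - T) <= 1 / 4 by have := sqr_ge0 (T - 1 / 2); lra.
  have TT0 : 0 <= T * (1 - T) by rewrite mulr_ge0// subr_ge0.
  have bg : 0 <= b * gam <= b by rewrite mulr_ge0 ?(ltW gam0)//= ler_piMr.
  move: gb; set G := _ ^+ 2 + _ => gb.
  have G0 : 0 <= G by rewrite addr_ge0 ?sqr_ge0.
  have p1 : 0 <= 4 * (a - b * T) / Y z ^+ 2 by rewrite divr_ge0 ?(ltW y2)// mulr_ge0.
  have p2 : 0 <= b * gam * (T * (1 - T)) * G by rewrite !mulr_ge0//; lra.
  have p3 : b * gam * (T * (1 - T)) * G <= b * (1 / 4) * (16 / Y z ^+ 2).
    apply: ler_pM => //; first by rewrite mulr_ge0//; lra.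
    by apply: ler_pM => //; lra.
  rewrite ler0_norm; last lra.
  have -> : (1 + 4 * a + 4 * b + 2 * D ^+ 2) / Y z ^+ 2 = 4 * a / Y z ^+ 2 + b * (1 / 4) * (16 / Y z ^+ 2)
     + (1 + 2 * D ^+ 2) / Y z ^+ 2 by field; rewrite gt_eqF.
  have p4 : 4 * (a - b * T) / Y z ^+ 2 <= 4 * a / Y z ^+ 2.
    by rewrite ler_pM2r ?invr_gt0//; lra.
  have p5 : 0 <= (1 + 2 * D ^+ 2) / Y z ^+ 2 by rewrite divr_ge0 ?(ltW y2)//; lra.
  lra.
have X1 e : `|lamw1 xi beta zt a b gam kap e z| <= D / Y z.
  rewrite /lamw1 -/T.
  have -> : D / Y z = a * (2 / Y z) + S * (4 / Y z) + b / 2 * (4 / Y z) by rewrite /D; field; rewrite gt_eqF.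
  apply: le_trans (ler_normB _ _) _; apply: lerD; last first.
    rewrite normrM; apply: ler_pM => //; last exact: gRb.
    rewrite ger0_norm ?divr_ge0 ?mulr_ge0 ?subr_ge0//.
    by rewrite ler_pM2r ?invr_gt0// ler_piMr// gerBl.
  apply: le_trans (ler_normD _ _) _; apply: lerD.
    rewrite normrM (ger0_norm d0); apply: ler_pM => //; exact: gYb.
  rewrite /S mulr_suml; apply: le_trans (ler_norm_sum _ _ _) _; apply: ler_sum => k _.
  rewrite normrM ger0_norm ?divr_ge0//; apply: ler_wpM2l; first by rewrite divr_ge0.
  exact: gRb.
have X2 e : lamw1 xi beta zt a b gam kap e z ^+ 2 <= D ^+ 2 / Y z ^+ 2.
  rewrite -expr_div_n -(real_normK (num_real _)).
  by apply: lerXn2r; rewrite ?nnegrE ?divr_ge0 ?(ltW Y0).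
have -> : (1 + 4 * a + 4 * b + 2 * D ^+ 2) / Y z ^+ 2 = D ^+ 2 / Y z ^+ 2 + D ^+ 2 / Y z ^+ 2
     + (1 + 4 * a + 4 * b) / Y z ^+ 2 by ring.
have := X2 true; have := X2 false.
have : 0 <= (1 + 4 * a + 4 * b) / Y z ^+ 2 by rewrite divr_ge0 ?(ltW y2)//; lra.
lra.
Qed.

Lemma lamw_weight {R : realType} (m : nat) (xi : 'I_m -> R[i]) (beta : 'I_m -> R)
   (zt : R[i]) (a b gam kap : R) : cabs zt = 1 -> 0 <= b -> 0 < gam <= 1 -> 0 < kap ->
  exists2 C, 0 < C & forall z, 0 < Y z ->
   `|lamw xi beta zt a b gam kap z -
     (a * ln (Y z) + \sum_k beta k / 2 * ln (R2 (xi k) z) - b / 2 * ln (R2 zt z))| <= C.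
Proof.
move=> zt1 b0 /andP[gam0 gam1] kap0.
pose C := b / gam * (`|ln kap| + `|ln (1 + 1 + kap)|) + 1.
have bg : 0 <= b / gam by rewrite divr_ge0// ltW.
have n0 : 0 <= b / gam * (`|ln kap| + `|ln (1 + 1 + kap)|) by rewrite mulr_ge0// addr_ge0.
exists C => [|z Y0]; first by rewrite /C; lra.
have r0 := R2_gt0 zt1 Y0.
rewrite /lamw; set A := a * _ + _.
set x := expR _; set y := expR _.
have x0 : 0 < x by exact: expR_gt0.
have y0 : 0 < y by exact: expR_gt0.
pose l := gam / 2 * ln (R2 zt z).
have -> : A - b / gam * ln (x + y) - (A - b / 2 * ln (R2 zt z)) = - (b / gam * (ln (x + y) - l)).
  by rewrite /l; field; rewrite gt_eqF.
rewrite normrN normrM (ger0_norm bg).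
apply: (le_trans (y := b / gam * (`|ln kap| + `|ln (1 + 1 + kap)|))); last by rewrite /C; lra.
apply: ler_wpM2l => //.
have lE : expR (ln kap) = kap by rewrite lnK ?posrE.
have ye : y = kap * expR l by rewrite /y expRD lE.
have l0 := expR_gt0 l.
have low : ln kap <= ln (x + y) - l.
  have : ln y <= ln (x + y) by rewrite ler_ln ?posrE ?addr_gt0// lerDr ltW.
  by rewrite /y expRK -/l; lra.
have xe : x <= (1 + 1) * expR l.
  have h : ln (Y z ^+ 2) <= ln (4 * R2 zt z).
    rewrite ler_ln ?posrE ?exprn_gt0 ?mulr_gt0//; exact: Y_le_R2.
  have e4 : ln (4 * R2 zt z) = 2 * ln 2 + ln (R2 zt z).
    rewrite lnM ?posrE//; congr (_ + _).
    have -> : (4 : R) = 2 * 2 by ring.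
    by rewrite lnM ?posrE//; ring.
  have e2 : ln (Y z ^+ 2) = 2 * ln (Y z) by rewrite expr2 lnM ?posrE//; ring.
  have k1 : gam * ln (Y z) <= gam * ln 2 + l.
    have : gam / 2 * (2 * ln (Y z)) <= gam / 2 * (2 * ln 2 + ln (R2 zt z)).
      by rewrite ler_wpM2l ?divr_ge0 ?(ltW gam0)// -e2 -e4.
    by rewrite /l; lra.
  apply: (le_trans (y := expR (gam * ln 2 + l))); first by rewrite ler_expR.
  rewrite expRD ler_wpM2r ?(ltW l0)//.
  have -> : (1 + 1 : R) = expR (ln 2) by rewrite lnK ?posrE//; ring.
  rewrite ler_expR ler_piMl// ln_ge0//; lra.
have up : ln (x + y) - l <= ln (1 + 1 + kap).
  have : ln (x + y) <= ln ((1 + 1 + kap) * expR l).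
    by rewrite ler_ln ?posrE ?addr_gt0 ?mulr_gt0 ?addr_gt0// ye mulrDl lerD2r.
  rewrite lnM ?posrE ?addr_gt0// expRK; lra.
have := ler_norm (ln (1 + 1 + kap)); have := ler_norm (- ln kap); rewrite normrN.
have := normr_ge0 (ln kap); have := normr_ge0 (ln (1 + 1 + kap)).
by move=> *; rewrite ler_norml; apply/andP; split; lra.
Qed.

(** * Integrability of the majorant on the lattice *)

Lemma powRN_le {R : realType} (th u v : R) : 0 <= th -> 0 < u -> u <= v -> v `^ (- th) <= u `^ (- th).
Proof.
move=> th0 u0 uv; have v0 : 0 < v by apply: lt_le_trans uv.
rewrite !powRN lef_pV2 ?posrE ?powR_gt0//.
by apply: ge0_ler_powR => //; rewrite nnegrE ltW.
Qed.

Lemma powRN_half {R : realType} (th u : R) : 0 <= th <= 1 -> 0 < u -> (u / 2) `^ (- th) <= 2 * u `^ (- th).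
Proof.
move=> /andP[th0 th1] u0; rewrite powRM ?invr_ge0 ?(ltW u0)// mulrC.
rewrite ler_wpM2r ?powR_ge0//.
have E : 2^-1 `^ th * 2 `^ th = 1 :> R by rewrite -powRM ?invr_ge0// mulVf// powR1.
have a0 : (2^-1 : R) `^ th != 0 by rewrite gt_eqF// powR_gt0// invr_gt0.
have -> : 2^-1 `^ (- th) = 2 `^ th :> R by rewrite powRN; apply: (mulfI a0); rewrite mulfV// E.
by rewrite -[leRHS]powRr1// ler_powR//; lra.
Qed.

Lemma bump_le {R : realType} (th h s u : R) : 0 <= th <= 1 -> 0 < h -> `|s| <= u -> h <= u ->
  u `^ (- th) <= 2 * bump th h s.
Proof.
move=> th01 h0 su hu; have sh0 : 0 < `|s| + h by rewrite ltr_wpDl.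
apply: le_trans (powRN_half th01 sh0); apply: powRN_le.
- by have /andP[] := th01.
- by rewrite divr_gt0.
- lra.
Qed.

Lemma gsum_prod {R : realType} n h (F G : R -> R) :
  gsum n h (fun z => F z.1 * G z.2) =
  (\sum_(1 <= i < n.+1) h * F (i%:R * h - 2)) * (\sum_(1 <= j < n.+1) h * G (j%:R * h - 2)).
Proof.
rewrite /gsum mulr_suml; apply: eq_bigr => i _; rewrite mulr_sumr.
by apply: eq_bigr => j _; rewrite /grid /=; ring.
Qed.

(* The row bound: on the part of the disc where [|y| <= |x|], each horizontal
   line crosses the circle transversally, at [+-X] with [X = sqrt (1 - y^2)]. *)
Lemma sum_rows {R : realType} (m : nat) (c : 'I_m -> R) (th : R) : 0 <= th < 1 ->
  (forall k, `|c k| <= 2) ->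
  exists2 C, 0 < C & forall N (h : R) (X : R -> R), h * N%:R = 1 -> (0 < N)%N ->
    (forall t, `|X t| <= 2) ->
   \sum_(1 <= i < (4 * N).+1) \sum_(1 <= j < (4 * N).+1) h ^+ 2 *
     ((bump th h (i%:R * h - 2 - X (j%:R * h - 2)) + bump th h (i%:R * h - 2 - - X (j%:R * h - 2))) *
      (1 + \sum_k bump th h (j%:R * h - 2 - c k))) <= C.
Proof.
move=> th01 c2; have [C C0 HC] := sum_bump th01.
exists (2 * C * (4 + m%:R * C)) => [|N h X hN N0 X2].
  by rewrite mulr_gt0 ?mulr_gt0// ltr_wpDr// mulr_ge0// ltW.
have h0 : 0 < h.
  have Np : (0 : R) < N%:R by rewrite ltr0n.
  by rewrite -(pmulr_lgt0 _ Np) hN.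
rewrite exchange_big/=.
pose W j : R := 1 + \sum_k bump th h (j%:R * h - 2 - c k).
have W0 j : 0 <= W j by rewrite addr_ge0// sumr_ge0// => k _; exact: bump_ge0.
apply: (le_trans (y := \sum_(1 <= j < (4 * N).+1) 2 * C * (h * W j))).
  apply: ler_sum => j _.
  set s := j%:R * h - 2.
  apply: (le_trans (y := (\sum_(1 <= i < (4 * N).+1) h * bump th h (i%:R * h - 2 - X s) +
     \sum_(1 <= i < (4 * N).+1) h * bump th h (i%:R * h - 2 - - X s)) * (h * W j))).
    rewrite -big_split mulr_suml; apply: ler_sum => i _ /=.
    by rewrite le_eqVlt; apply/orP; left; apply/eqP; rewrite /W -/s; ring.
  rewrite ler_wpM2r ?mulr_ge0 ?(ltW h0)//.
  have k1 := HC N h (X s) hN N0 (X2 s).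
  have k2 := HC N h (- X s) hN N0; rewrite normrN in k2.
  have := k2 (X2 s); lra.
rewrite -mulr_sumr ler_wpM2l ?mulr_ge0 ?(ltW C0)//.
rewrite (eq_bigr (fun j => h + \sum_k h * bump th h (j%:R * h - 2 - c k))); last first.
  by move=> j _; rewrite /W mulrDr mulr1 mulr_sumr.
rewrite big_split/=; apply: lerD.
  rewrite sumr_const_nat subSS subn0 -[_ *+ (4 * N)]mulr_natl natrM.
  set M := N%:R in hN *.
  have -> : 4 * M * h = 4 * (h * M) by ring.
  by rewrite hN mulr1.
rewrite exchange_big/=.
apply: (le_trans (y := \sum_(k < m) C)); first by apply: ler_sum => k _; exact: HC.
by rewrite sumr_const card_ord mulr_natl.
Qed.

Lemma gsum_swap {R : realType} n (h : R) (F : pt R -> R) :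
  gsum n h F = gsum n h (fun z => F (z.2, z.1)).
Proof. by rewrite /gsum exchange_big. Qed.

Lemma count_window {R : realType} N (h c l : R) : h * N%:R = 1 -> (0 < N)%N ->
  `|c| <= 1 -> h <= l -> l <= 1 / 2 ->
  l <= \sum_(1 <= i < (4 * N).+1) h * (`|i%:R * h - 2 - c| <= l)%R%:R.
Proof.
move=> hN N0 c1 hl l2.
have h0 : 0 < h.
  have Np : (0 : R) < N%:R by rewrite ltr0n.
  by rewrite -(pmulr_lgt0 _ Np) hN.
have nh : (4 * N)%:R * h = 4 by rewrite natrM -mulrA [N%:R * h]mulrC hN mulr1.
(* [G] clamps to [[- l, 0]]. Stopping at 0 rather than at [l] ensures that for [s > l] the previous
   node [s - h] is still in the flat part, as [h <= l]. *)
pose G (s : R) := if s <= - l then - l else if s <= 0 then s else 0.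
have l0 : 0 < l by exact: lt_le_trans hl.
have stepG (s : R) : G s - G (s - h) <= h * (`|s| <= l)%R%:R.
  clear -h0 l0 hl; rewrite ler_norml /G.
  case: (boolP (- l <= s <= l)) => [_|nb]; rewrite ?mulr1 ?mulr0.
    by case: (leP s (- l)) => ?; case: (leP s 0) => ?; case: (leP (s - h) (- l)) => ?; case: (leP (s - h) 0) => ?; lra.
  have {nb} [sl|sl] : s < - l \/ l < s by move: nb; rewrite negb_and -!ltNge => /orP.
    have -> : s <= - l by exact: ltW.
    have -> : s - h <= - l by lra.
    lra.
  have -> : (s <= - l) = false by apply/negbTE; rewrite -ltNge; lra.
  have -> : (s <= 0) = false by apply/negbTE; rewrite -ltNge; lra.
  by case: (leP (s - h) (- l)) => ?; case: (leP (s - h) 0) => ?; lra.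
pose k (i : nat) := G (i%:R * h - 2 - c).
have step i : (0 < i)%N -> k i - k i.-1 <= h * (`|i%:R * h - 2 - c| <= l)%R%:R.
  case: i => // i _; rewrite /k /=; set s := i.+1%:R * h - 2 - c.
  by have -> : i%:R * h - 2 - c = s - h by [rewrite /s -[i.+1%:R]natr1; ring].
apply: (le_trans (y := \sum_(1 <= i < (4 * N).+1) (k i - k i.-1))); last first.
  by apply: ler_sum_nat => i /andP[i0 _]; exact: step.
have -> : \sum_(1 <= i < (4 * N).+1) (k i - k i.-1) = k (4 * N)%N - k 0%N.
  by rewrite big_add1/= telescope_sumr.
move: c1; rewrite ler_norml => /andP[ca cb].
rewrite /k nh mul0r /G.
clear -ca cb l2 l0.
have -> : (4 - 2 - c <= - l) = false by apply/negbTE; rewrite -ltNge; lra.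
have -> : (4 - 2 - c <= 0) = false by apply/negbTE; rewrite -ltNge; lra.
have -> : 0 - 2 - c <= - l by lra.
by rewrite opprK add0r.
Qed.

(** [Y = (X - |x|) (X + |x|)], and [|y| <= |x|] inside the disc forces [X >= 1/2], so the second
    factor lies between 1/2 and 2. Distances to the [xi k] are bounded below by their second
    coordinates, which separates the variables. The margin [2 h <= Y] pays for the shift by [h] in
    [bump]. *)
Lemma weight_row {R : realType} (m : nat) (xi : 'I_m -> R[i]) (th h : R) (z : pt R) :
  0 <= th <= 1 -> 0 < h -> (forall k, cabs (xi k) = 1) ->
  2 * h <= Y z -> `|z.2| <= `|z.1| ->
  Y z `^ (- th) * (1 + \sum_k cabs (cpx z - xi k) `^ (- th)) <=
  8 * ((bump th h (z.1 - Num.sqrt (1 - z.2 ^+ 2)) + bump th h (z.1 - - Num.sqrt (1 - z.2 ^+ 2))) *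
   (1 + \sum_k bump th h (z.2 - complex.Im (xi k)))).
Proof.
move=> th01 h0 xi1 hY zz; case: z zz hY => x t /= zz hY.
have Y0 : 0 < Y (x, t) by lra.
pose X := Num.sqrt (1 - t ^+ 2); rewrite -/X.
have tx : t ^+ 2 <= x ^+ 2 by rewrite -[t ^+ 2]real_normK ?num_real// -[x ^+ 2]real_normK ?num_real//; apply: lerXn2r; rewrite ?nnegrE.
have YE : Y (x, t) = 1 - x ^+ 2 - t ^+ 2 by [].
have x2 := sqr_ge0 x; have t2 := sqr_ge0 t.
have X2 : X ^+ 2 = 1 - t ^+ 2 by rewrite sqr_sqrtr//; lra.
have X0 : 0 <= X by exact: sqrtr_ge0.
have xX : `|x| <= X.
  by rewrite -(@ler_pXn2r _ 2)// ?nnegrE// real_normK ?num_real//; lra.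
have nx2 : `|x| ^+ 2 = x ^+ 2 by rewrite real_normK ?num_real.
have X1 : X <= 1 by rewrite -(@ler_pXn2r _ 2)// ?nnegrE//; lra.
have Xh : 1 / 2 <= X by rewrite -(@ler_pXn2r _ 2)// ?nnegrE//; lra.
have YX : Y (x, t) = (X - `|x|) * (X + `|x|).
  have -> : (X - `|x|) * (X + `|x|) = X ^+ 2 - `|x| ^+ 2 by ring.
  by rewrite X2 nx2 YE; ring.
have nx0 := normr_ge0 x.
have Yge : (X - `|x|) / 2 <= Y (x, t).
  by rewrite YX; apply: ler_wpM2l; lra.
have Yle : Y (x, t) <= 2 * (X - `|x|).
  by rewrite YX mulrC; apply: ler_wpM2r; lra.
have hX : h <= X - `|x| by lra.
have b1 : Y (x, t) `^ (- th) <= 4 * bump th h (X - `|x|).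
  apply: (le_trans (y := ((X - `|x|) / 2) `^ (- th))).
    by apply: powRN_le; rewrite ?divr_gt0//; [have /andP[] := th01|lra].
  apply: le_trans (powRN_half th01 _) _; first lra.
  have : (X - `|x|) `^ (- th) <= 2 * bump th h (X - `|x|).
    by apply: bump_le => //; rewrite ger0_norm//; lra.
  lra.
have b2 : bump th h (X - `|x|) <= bump th h (x - X) + bump th h (x - - X).
  have [x0|x0] := leP 0 x.
    rewrite ger0_norm//; have -> : bump th h (X - x) = bump th h (x - X) by rewrite /bump distrC.
    by rewrite lerDl bump_ge0.
  rewrite ltr0_norm// opprK; have -> : X + x = x - - X by ring.
  by rewrite lerDr bump_ge0.
have b3 k : cabs (cpx (x, t) - xi k) `^ (- th) <= 2 * bump th h (t - complex.Im (xi k)).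
  apply: bump_le => //.
    by have := Im_le_cabs (cpx (x, t) - xi k); rewrite /cpx/=; case: (xi k).
  by have := Y_le_dist (xi1 k) Y0; lra.
have b4 : 1 + \sum_k cabs (cpx (x, t) - xi k) `^ (- th) <= 2 * (1 + \sum_k bump th h (t - complex.Im (xi k))).
  have : \sum_k cabs (cpx (x, t) - xi k) `^ (- th) <= 2 * \sum_k bump th h (t - complex.Im (xi k)).
    by rewrite mulr_sumr; apply: ler_sum => k _.
  lra.
have -> : 8 * ((bump th h (x - X) + bump th h (x - - X)) * (1 + \sum_k bump th h (t - complex.Im (xi k))))
  = (4 * (bump th h (x - X) + bump th h (x - - X))) * (2 * (1 + \sum_k bump th h (t - complex.Im (xi k)))) by ring.
apply: ler_pM => //; [exact: powR_ge0|by rewrite addr_ge0// sumr_ge0// => k _; exact: powR_ge0|].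
lra.
Qed.

(** At [xi k] the singularity of the circle and that of the point multiply, to total order up to
    [2 th]; it is still summable because one is measured across the circle and the other along it,
    each with exponent [th < 1]. *)
Lemma gsum_weight {R : realType} (m : nat) (xi : 'I_m -> R[i]) (th : R) : 0 <= th < 1 ->
  (forall k, cabs (xi k) = 1) ->
  exists2 C, 0 < C & forall N (h y : R), h * N%:R = 1 -> (0 < N)%N -> 2 * h <= y ->
   gsum (4 * N) h (fun z => if y <= Y z then
      Y z `^ (- th) * (1 + \sum_k cabs (cpx z - xi k) `^ (- th)) else 0) <= C.
Proof.
move=> th01 xi1; have th1 : 0 <= th <= 1 by move: th01 => /andP[-> /ltW ->].
have cI k : `|complex.Im (xi k)| <= 2 by have := Im_le_cabs (xi k); rewrite xi1; lra.
have cR k : `|complex.Re (xi k)| <= 2 by have := Re_le_cabs (xi k); rewrite xi1; lra.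
have [C1 C10 H1] := sum_rows th01 cI.
have [C2 C20 H2] := sum_rows th01 cR.
exists (8 * C1 + 8 * C2) => [|N h y hN N0 hy]; first lra.
have h0 : 0 < h.
  have Np : (0 : R) < N%:R by rewrite ltr0n.
  by rewrite -(pmulr_lgt0 _ Np) hN.
pose X (t : R) := Num.sqrt (1 - t ^+ 2).
have X2 t : `|X t| <= 2.
  rewrite /X ger0_norm ?sqrtr_ge0//.
  have -> : (2 : R) = Num.sqrt (2 ^+ 2) by rewrite sqrtr_sqr ger0_norm.
  by apply: ler_wsqrtr; have := sqr_ge0 t; lra.
pose A (c : 'I_m -> R) (z : pt R) := (bump th h (z.1 - X z.2) + bump th h (z.1 - - X z.2)) *
   (1 + \sum_k bump th h (z.2 - c k)).
have A0 c z : 0 <= A c z.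
  rewrite mulr_ge0 ?addr_ge0 ?bump_ge0//.
  by apply: sumr_ge0 => k _; exact: bump_ge0.
have K1 := H1 N h X hN N0 X2.
have K2 := H2 N h X hN N0 X2.
apply: (le_trans (y := gsum (4 * N) h (fun z => 8 * A (fun k => complex.Im (xi k)) z +
   8 * A (fun k => complex.Re (xi k)) (z.2, z.1)))); last first.
  rewrite gsumD !gsumZ [X in _ + 8 * X <= _]gsum_swap.
  by apply: lerD; rewrite ler_wpM2l.
apply: ler_gsum => i j; move: (grid h i j) => z.
have G1 := A0 (fun k => complex.Im (xi k)) z.
have G2 := A0 (fun k => complex.Re (xi k)) (z.2, z.1).
case: ifP => [yz|_]; last lra.
have [zz|zz] := leP `|z.2| `|z.1|.
  have := @weight_row R m xi th h z th1 h0 xi1 _ zz; rewrite -/X -/(A (fun k => complex.Im (xi k)) z).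
  move=> K; apply: le_trans (K _) _; lra.
(* Swapping the coordinates of z and of each xi k exchanges rows and columns. *)
pose w (u : R[i]) : R[i] := Complex (complex.Im u) (complex.Re u).
have w1 k : cabs (w (xi k)) = 1.
  apply/eqP; rewrite -(@eqrXn2 _ 2)// ?cabs_ge0// expr1n cabs_sq /= addrC -cabs_sq xi1 expr1n//.
have YE : Y (z.2, z.1) = Y z by rewrite /Y/=; ring.
have dE k : cabs (cpx (z.2, z.1) - w (xi k)) = cabs (cpx z - xi k).
  apply/eqP; rewrite -(@eqrXn2 _ 2)// ?cabs_ge0//; apply/eqP.
  by rewrite -!R2_cabs /R2 /w/=; ring.
have := @weight_row R m (fun k => w (xi k)) th h (z.2, z.1) th1 h0 w1.
rewrite YE /= => /(_ _ (ltW zz)) => K.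
rewrite (eq_bigr (fun k => cabs (cpx (z.2, z.1) - w (xi k)) `^ (- th))); last by move=> k _; rewrite dE.
apply: le_trans (K _) _; first lra.
by rewrite -/(X z.1) -/(A (fun k => complex.Re (xi k)) (z.2, z.1)); lra.
Qed.

(** * The test function and the radial correction *)

(** It vanishes to third order at 0, so composing with the positive part stays within the jet
    calculus, and it is comparable to [expR x] for large [x]. *)
Definition exp_tail {R : realType} (x : R) : R := expR x - 1 - x - x ^+ 2 / 2.

Lemma utay_exp_tail {R : realType} (B : R) : 0 <= B ->
  utay (fun a => a <= B) (fun x => exp_tail (Num.max x 0))
   (fun x => expR (Num.max x 0) - 1 - Num.max x 0) (fun x => expR (Num.max x 0) - 1).
Proof.
move=> B0.
have H := utayD (utay_expc B 1) (utay_poly B (- 1) (- 1) (- (1 / 2))).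
have {}H : utay (fun a => 0 <= a <= B) (@exp_tail R) (fun x => expR x - 1 - x) (fun x => expR x - 1).
  apply: (utay_sub (J := fun a => `|a| <= B)); first by move=> x /andP[x0 xB]; rewrite ger0_norm.
  have -> : @exp_tail R = fun x => expR (1 * x) + (- 1 + - 1 * x + - (1 / 2) * x ^+ 2).
    by apply/funext => x; rewrite /exp_tail (mul1r x); field.
  have -> : (fun x : R => expR x - 1 - x) = fun x => 1 * expR (1 * x) + (- 1 + 2 * - (1 / 2) * x).
    by apply/funext => x; rewrite (mul1r x); field.
  have -> : (fun x : R => expR x - 1) = fun x => 1 ^+ 2 * expR (1 * x) + 2 * - (1 / 2).
    by apply/funext => x; rewrite (mul1r x); field.
  exact: H.
apply: (@utay_pos R B (expR B) (@exp_tail R) (fun x => expR x - 1 - x) (fun x => expR x - 1)) => //.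
- by rewrite /exp_tail expR0; ring.
- by rewrite expR0; ring.
- by rewrite expR0; ring.
move=> b /andP[b0 bB].
have e1 := expR_ge1Dx b; have e2 := expR_ge1Dx (- b).
have e0 := expR_gt0 b; have eB : expR b <= expR B by rewrite ler_expR.
have e3 : expR b * (1 - b) <= 1.
  have := expRxMexpNx_1 b; have : expR b * (1 - b) <= expR b * expR (- b) by rewrite ler_wpM2l.
  lra.
have k1 : expR b - 1 <= expR b * b by lra.
have k2 : expR b * b <= expR B * b by rewrite ler_wpM2r.
split; rewrite ger0_norm; [|lra|lra|lra].
have : (expR b - 1) * b <= expR B * b * b by rewrite ler_wpM2r//; lra.
have : expR b - 1 - b <= (expR b - 1) * b by lra.
by rewrite expr2; lra.
Qed.

(** The primitive of [(1 - e^(- x))^2] vanishing at 0. It is flat to third order at 0, and for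
    [x = ln (s1 / s)] the exponentials become powers of [s / s1], which makes the Laplacian of [rad]
    explicit. *)
Definition ulog {R : realType} (x : R) : R := x - 3 / 2 + 2 * expR (- x) - expR (- (2 * x)) / 2.

Lemma utay_ulog {R : realType} (B : R) : 0 <= B ->
  utay (fun a => a <= B) (fun x => ulog (Num.max x 0))
   (fun x => (1 - expR (- Num.max x 0)) ^+ 2)
   (fun x => 2 * expR (- Num.max x 0) * (1 - expR (- Num.max x 0))).
Proof.
move=> B0.
have H := utayD (utayD (utayZ 2 (utay_expc B (- 1))) (utayZ (- (1 / 2)) (utay_expc B (- 2))))
  (utay_poly B (- (3 / 2)) 1 0).
have E2 (x : R) : expR (- 2 * x) = expR (- x) ^+ 2 by rewrite expr2 -expRD; congr expR; ring.
have {}H : utay (fun a => 0 <= a <= B) (@ulog R) (fun x => (1 - expR (- x)) ^+ 2)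
    (fun x => 2 * expR (- x) * (1 - expR (- x))).
  apply: (utay_sub (J := fun a => `|a| <= B)); first by move=> x /andP[x0 xB]; rewrite ger0_norm.
  have E1 (x : R) : expR (- 1 * x) = expR (- x) by rewrite mulN1r.
  have -> : @ulog R = fun x => 2 * expR (-1 * x) + - (1 / 2) * expR (- 2 * x) + (- (3 / 2) + 1 * x + 0 * x ^+ 2).
    by apply/funext => x; rewrite /ulog E2 E1 -(E2 x) mulNr; field.
  have -> : (fun x : R => (1 - expR (- x)) ^+ 2) = fun x => 2 * (-1 * expR (-1 * x)) + - (1 / 2) * (- 2 * expR (- 2 * x)) + (1 + 2 * 0 * x).
    by apply/funext => x; rewrite E2 E1; field.
  have -> : (fun x : R => 2 * expR (- x) * (1 - expR (- x))) = fun x => 2 * ((-1) ^+ 2 * expR (-1 * x)) + - (1 / 2) * ((- 2) ^+ 2 * expR (- 2 * x)) + 2 * 0.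
    by apply/funext => x; rewrite E2 E1; field.
  exact: H.
apply: (@utay_pos R B 2 (@ulog R) (fun x => (1 - expR (- x)) ^+ 2)
   (fun x => 2 * expR (- x) * (1 - expR (- x)))) => //.
- by rewrite /ulog mulr0 oppr0 expR0; field.
- by rewrite oppr0 expR0; ring.
- by rewrite oppr0 expR0; ring.
move=> b /andP[b0 bB].
have e2 := expR_ge1Dx (- b).
have e0 := expR_gt0 (- b).
have e1 : expR (- b) <= 1 by rewrite -expR0 ler_expR; lra.
split; rewrite ger0_norm ?sqr_ge0//.
- have : (1 - expR (- b)) ^+ 2 <= b ^+ 2 by apply: lerXn2r; rewrite ?nnegrE//; lra.
  have := sqr_ge0 b; lra.
- have : expR (- b) * (1 - expR (- b)) <= 1 * b by apply: ler_pM => //; lra.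
  lra.
- by rewrite mulr_ge0 ?mulr_ge0 ?(ltW e0)//; lra.
Qed.

Lemma ge0_of_derive {R : realType} (f f1 : R -> R) (x : R) :
  (forall t : R, is_derive t 1 f (f1 t)) -> (forall t, 0 <= t -> 0 <= f1 t) -> f 0 = 0 ->
  0 <= x -> 0 <= f x.
Proof.
move=> fd f10 f0 x0.
have [|c] := @MVT_segment R f f1 0 x x0 (fun t _ => fd t).
  by apply: derivable_within_continuous => t _; case: (fd t).
rewrite in_itv/= f0 !subr0 => /andP[c0 _] ->.
by rewrite mulr_ge0// f10.
Qed.

Lemma exp_tail_ge0 {R : realType} (x : R) : 0 <= x -> 0 <= exp_tail x.
Proof.
apply: (@ge0_of_derive R _ (fun x => expR x - 1 - x)) => [t|t t0|].
- by rewrite /exp_tail; apply: is_derive_eq; rewrite /GRing.scale/=; field.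
- by have := expR_ge1Dx t; lra.
- by rewrite /exp_tail expR0; ring.
Qed.

Lemma ulog_ge0 {R : realType} (x : R) : 0 <= x -> 0 <= ulog x.
Proof.
have -> : @ulog R = fun x => x - 3 / 2 + 2 * expR (-1 * x) - expR (- 2 * x) / 2.
  by apply/funext => t; rewrite /ulog mulN1r mulNr.
apply: (@ge0_of_derive R (fun x => x - 3 / 2 + 2 * expR (-1 * x) - expR (- 2 * x) / 2)
  (fun x => (1 - expR (-1 * x)) ^+ 2) x) => [t|t t0|].
- have d1 := is_derive_expc (-1) t; have d2 := is_derive_expc (- 2) t.
  apply: is_derive_eq.
  have -> : expR (- 2 * t) = expR (-1 * t) ^+ 2 by rewrite expr2 -expRD; congr expR; ring.
  by rewrite /GRing.scale/=; field.
- exact: sqr_ge0.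
- by rewrite !mulr0 expR0; field.
Qed.

Lemma exp_tail_big {R : realType} (x : R) : 16 <= x -> expR x <= 2 * exp_tail x.
Proof.
(* The quartic [s^4 <= exp x] has to beat [2 + 2 x + x^2], which is at most [16 s^2]; [s >= 5] is
   enough, whence the 16. *)
move=> x16; pose s := 1 + x / 4.
have s5 : 5 <= s by rewrite /s; lra.
have e : s ^+ 4 <= expR x.
  have -> : expR x = expR (x / 4) ^+ 4.
    by rewrite -expRM_natl; congr expR; field.
  by apply: lerXn2r; rewrite ?nnegrE ?expR_ge0 ?expR_ge1Dx//; lra.
have xs : x = 4 * (s - 1) by rewrite /s; field.
have s2 : 16 * s ^+ 2 <= s ^+ 4.
  have -> : s ^+ 4 = s ^+ 2 * s ^+ 2 by ring.
  by rewrite ler_wpM2r ?sqr_ge0//; nra.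
rewrite /exp_tail xs; rewrite xs in e; nra.
Qed.

(** A smooth version of [(exp lam - dl)_+]: zero where the weight is below the level [dl], and at
    least half the weight once [lam] exceeds [ln dl] by 16. The test on [Y] excludes points outside
    the disc, where [lam] has no meaning. *)
Definition ptest {R : realType} (lam : pt R -> R) (dl : R) (z : pt R) : R :=
  if 0 < Y z then dl * exp_tail (Num.max (lam z - ln dl) 0) else 0.

Lemma ptest_ge0 {R : realType} (lam : pt R -> R) (dl : R) z : 0 < dl -> 0 <= ptest lam dl z.
Proof.
move=> dl0; rewrite /ptest; case: ifP => // _.
by rewrite mulr_ge0 ?(ltW dl0)// exp_tail_ge0// le_max lexx orbT.
Qed.

Lemma ptest_eq0 {R : realType} (lam : pt R -> R) (dl : R) z :
  (0 < Y z -> lam z <= ln dl) -> ptest lam dl z = 0.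
Proof.
rewrite /ptest; case: ifP => // _ /(_ isT) h.
rewrite (elimT max_idPr); last by rewrite subr_le0.
by rewrite /exp_tail expR0 expr0n/=; ring.
Qed.

Lemma ptest_big {R : realType} (lam : pt R -> R) (dl : R) z : 0 < dl -> 0 < Y z ->
  ln dl + 16 <= lam z -> expR (lam z) <= 2 * ptest lam dl z.
Proof.
move=> dl0 Y0 h; rewrite /ptest Y0 (elimT max_idPl); last lra.
have -> : expR (lam z) = dl * expR (lam z - ln dl).
  by rewrite expRD expRN lnK ?posrE// mulrCA mulfV ?mulr1// gt_eqF.
have -> : 2 * (dl * exp_tail (lam z - ln dl)) = dl * (2 * exp_tail (lam z - ln dl)) by ring.
by rewrite ler_wpM2l ?(ltW dl0)// exp_tail_big//; lra.
Qed.

Definition ptest1 {R : realType} (lam : pt R -> R) (lam1 : bool -> pt R -> R) (dl : R) e z : R :=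
  dl * (expR (Num.max (lam z - ln dl) 0) - 1 - Num.max (lam z - ln dl) 0) * lam1 e z.

Definition ptest2 {R : realType} (lam : pt R -> R) (lam1 lam2 : bool -> pt R -> R) (dl : R) e z : R :=
  dl * ((expR (Num.max (lam z - ln dl) 0) - 1 - Num.max (lam z - ln dl) 0) * lam2 e z +
   (expR (Num.max (lam z - ln dl) 0) - 1) * lam1 e z ^+ 2).

Lemma ujet_ptest {R : realType} (lam : pt R -> R) lam1 lam2 (dl y : R) : 0 < y ->
  ujet (fun z => y <= Y z) lam lam1 lam2 ->
  ujet (fun z => y <= Y z) (ptest lam dl) (ptest1 lam lam1 dl) (ptest2 lam lam1 lam2 dl).
Proof.
move=> y0 J; have J' := gjetD J (gjet_cst _ (- ln dl)).
have [C C0 HC] := gjet_le J'.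
have JT := gjetZ dl (gjet_comp (utay_exp_tail C0)
  (fun i Pi => le_trans (ler_norm _) (HC i Pi)) J').
have [D D1 HD] := gjet_lip (ujet_Y y0).
have {}JT := gjet_ext (G0 := fun i => ptest lam dl i.2) (fun _ _ => erefl) _ (fun _ _ => erefl) (fun _ _ => erefl) JT.
have {}JT := JT (ltac:(move=> i yi; rewrite /ptest ifT//; exact: lt_le_trans yi)).
(* The constant limits the shift so that [Y] changes by at most [y / 2]: the shifted point stays in
   the disc. *)
have JE := @gjet_eqloc R (bool * pt R) (fun i => y <= Y i.2) _ (fun i t => ptest lam dl (sh i.1 i.2 t)) _ _ _ (D + 2 * D / y) _ _ JT.
apply: gjet_ext (JE _ _) => //.
- by move=> [e z] _; rewrite /ptest1/= addr0 mulrA.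
- by move=> [e z] _; rewrite /ptest2/= !addr0.
- by rewrite addr_ge0 ?divr_ge0 ?mulr_ge0 ?(ltW y0)//; lra.
- move=> i t yi tC.
  have q0 : 0 <= 2 * D / y by rewrite divr_ge0 ?mulr_ge0 ?(ltW y0)//; lra.
  have t1 : `|t| * D <= 1 by apply: scaled_le tC; lra.
  have t2 : `|t| * (2 * D / y) <= 1 by apply: scaled_le tC; lra.
  have := HD i t yi t1; rewrite ler_norml => /andP[k1 _].
  rewrite /ptest ifT//.
  have : D * `|t| <= y / 2.
    by move: t2; rewrite mulrA ler_pdivrMr// mul1r; lra.
  lra.
Qed.

(* The test function is subharmonic wherever [exp lam] is, because the second
   derivative of [exp_tail] dominates the first one. *)
Lemma ptest_lap_ge0 {R : realType} (lam : pt R -> R) lam1 lam2 (dl : R) z : 0 < dl ->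
  0 <= lam2 true z + lam2 false z + (lam1 true z ^+ 2 + lam1 false z ^+ 2) ->
  0 <= ptest2 lam lam1 lam2 dl true z + ptest2 lam lam1 lam2 dl false z.
Proof.
move=> dl0 h; rewrite /ptest2; set x := Num.max _ _.
have x0 : 0 <= x by rewrite le_max lexx orbT.
have e := expR_ge1Dx x.
rewrite -mulrDr mulr_ge0 ?(ltW dl0)//.
set A := lam2 true z; set B := lam2 false z.
set P := lam1 true z ^+ 2; set Q := lam1 false z ^+ 2.
have -> : (expR x - 1 - x) * A + (expR x - 1) * P + ((expR x - 1 - x) * B + (expR x - 1) * Q)
  = (expR x - 1 - x) * (A + B + (P + Q)) + x * (P + Q) by ring.
have PQ : 0 <= P + Q by rewrite addr_ge0 ?sqr_ge0.
by apply: addr_ge0; apply: mulr_ge0 => //; lra.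
Qed.

Lemma ptest_lap_le {R : realType} (lam : pt R -> R) lam1 lam2 (dl M : R) z : 0 < dl -> 0 <= M ->
  `|lam2 true z + lam2 false z| <= M -> lam1 true z ^+ 2 + lam1 false z ^+ 2 <= M ->
  `|ptest2 lam lam1 lam2 dl true z + ptest2 lam lam1 lam2 dl false z| <= 2 * M * expR (lam z).
Proof.
move=> dl0 M0 h1 h2; rewrite /ptest2; set x := Num.max _ _.
have x0 : 0 <= x by rewrite le_max lexx orbT.
have e := expR_ge1Dx x.
have dx : dl * (expR x - 1) <= expR (lam z).
  rewrite /x; have [l0|l0] := leP (lam z - ln dl) 0.
    by rewrite expR0 subrr mulr0 expR_ge0.
  have -> : expR (lam z) = dl * expR (lam z - ln dl).
    by rewrite expRD expRN lnK ?posrE// mulrCA mulfV ?mulr1// gt_eqF.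
  by rewrite ler_wpM2l ?(ltW dl0)//; lra.
have P0 : 0 <= lam1 true z ^+ 2 + lam1 false z ^+ 2 by rewrite addr_ge0 ?sqr_ge0.
move: h1 h2 P0; set A := lam2 true z; set B := lam2 false z.
set P := lam1 true z ^+ 2; set Q := lam1 false z ^+ 2 => h1 h2 P0.
have -> : dl * ((expR x - 1 - x) * A + (expR x - 1) * P) + dl * ((expR x - 1 - x) * B + (expR x - 1) * Q)
  = dl * (expR x - 1 - x) * (A + B) + dl * (expR x - 1) * (P + Q) by ring.
have k1 : `|dl * (expR x - 1 - x) * (A + B)| <= expR (lam z) * M.
  rewrite normrM; apply: ler_pM => //.
  rewrite ger0_norm; last by rewrite mulr_ge0 ?(ltW dl0)//; lra.
  by apply: le_trans dx; rewrite ler_wpM2l ?(ltW dl0)//; lra.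
have k2 : `|dl * (expR x - 1) * (P + Q)| <= expR (lam z) * M.
  rewrite normrM (ger0_norm P0) ger0_norm; last by rewrite mulr_ge0 ?(ltW dl0)//; lra.
  by apply: ler_pM => //; rewrite mulr_ge0 ?(ltW dl0)//; lra.
by apply: le_trans (ler_normD _ _) _; lra.
Qed.

(* Radial correction [U ((ln (s1 / s))_+)] with [s = |z|^2 + eta^2]: a smooth
   subharmonic bump up to a negative mass concentrated near 0. *)
Definition rad {R : realType} (s1 eta : R) (z : pt R) : R :=
  ulog (Num.max (ln s1 - ln (R2 0 z + eta ^+ 2)) 0).

Definition rad1 {R : realType} (s1 eta : R) (e : bool) (z : pt R) : R :=
  (1 - expR (- Num.max (ln s1 - ln (R2 0 z + eta ^+ 2)) 0)) ^+ 2 *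
  - (2 * co e z / (R2 0 z + eta ^+ 2)).

Definition rad2 {R : realType} (s1 eta : R) (e : bool) (z : pt R) : R :=
  let x := Num.max (ln s1 - ln (R2 0 z + eta ^+ 2)) 0 in
  let l1 := - (2 * co e z / (R2 0 z + eta ^+ 2)) in
  let l2 := - (2 / (R2 0 z + eta ^+ 2) - (2 * co e z / (R2 0 z + eta ^+ 2)) ^+ 2) in
  (1 - expR (- x)) ^+ 2 * l2 + 2 * expR (- x) * (1 - expR (- x)) * l1 ^+ 2.

Lemma R20 {R : realType} (z : pt R) : R2 0 z = 1 - Y z.
Proof. by rewrite /R2 /Y/=; ring. Qed.

Lemma ujet_rad {R : realType} (s1 eta y : R) : 0 < y -> 0 < eta ->
  ujet (fun z => y <= Y z) (rad s1 eta) (rad1 s1 eta) (rad2 s1 eta).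
Proof.
move=> y0 eta0; have eta2 : 0 < eta ^+ 2 by rewrite exprn_gt0.
have z1 (z : pt R) : y <= Y z -> cabs (cpx z) <= 1.
  by move=> yz; apply: ltW; rewrite -Y_gt0 (lt_le_trans y0).
have J := gjetD (ujet_dist2 0 z1) (gjet_cst _ (eta ^+ 2)).
have range (i : bool * pt R) : y <= Y i.2 -> eta ^+ 2 <= R2 0 i.2 + eta ^+ 2 <= 1 + eta ^+ 2.
  move=> yi; rewrite R20; have := Y_le1 i.2; have : 0 < Y i.2 by exact: lt_le_trans yi.
  by move=> *; apply/andP; split; lra.
have J1 := gjetD (gjet_cst _ (ln s1)) (gjetZ (- 1) (gjet_comp (utay_ln _ eta2) range J)).
have [C C0 HC] := gjet_le J1.
have J2 := gjet_comp (utay_ulog C0) (fun i Pi => le_trans (ler_norm _) (HC i Pi)) J1.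
apply: gjet_ext J2.
- by move=> i t; rewrite /rad mulN1r.
- by move=> i _; rewrite /rad mulN1r.
- move=> [e z] /= yz; rewrite /rad1 !mulN1r.
  have -> : coc e (0 : R[i]) = 0 by case: e.
  congr (_ * _); rewrite ?subr0 ?addr0 ?add0r; ring.
- move=> [e z] /= yz; rewrite /rad2 !mulN1r.
  have -> : coc e (0 : R[i]) = 0 by case: e.
  have s0 : R2 0 z + eta ^+ 2 != 0.
    by have /andP[+ _] := range (e, z) yz => /(lt_le_trans eta2) /gt_eqF ->.
  congr (_ * _ + _ * _); rewrite ?subr0 ?addr0 ?add0r; field; exact: s0.
Qed.

Lemma rad_ge0 {R : realType} (s1 eta : R) z : 0 <= rad s1 eta z.
Proof. by apply: ulog_ge0; rewrite le_max lexx orbT. Qed.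

Lemma rad_eq0 {R : realType} (s1 eta : R) z : 0 < s1 -> 0 < eta -> Y z <= 1 - s1 ->
  rad s1 eta z = 0 /\ forall e, rad2 s1 eta e z = 0.
Proof.
move=> s0 eta0 Ys; have e2 : 0 < eta ^+ 2 by rewrite exprn_gt0.
have E : Num.max (ln s1 - ln (R2 0 z + eta ^+ 2)) 0 = 0.
  apply/max_idPr; rewrite subr_le0 R20 ler_ln ?posrE//; first lra.
  by have := Y_le1 z; lra.
split=> [|e]; rewrite /rad /rad2 E.
  by rewrite /ulog mulr0 oppr0 expR0; field.
by rewrite oppr0 expR0 subrr expr0n/=; ring.
Qed.

(** Below [s1] the Laplacian is [8 m / s1] minus a spike at the origin of width [eta], whose mass is
    bounded independently of [eta]. *)
Lemma rad_lap {R : realType} (s1 eta : R) z : 0 < s1 -> 0 < eta -> 0 < Y z ->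
  let s := R2 0 z + eta ^+ 2 in let L := rad2 s1 eta true z + rad2 s1 eta false z in
  let m := Num.max (1 - s / s1) 0 in
  8 / s1 * m - 8 * eta ^+ 2 / s ^+ 2 <= L /\ L <= 8 / s1 * m.
Proof.
move=> s0 eta0 Y0 s L m; have e2 : 0 < eta ^+ 2 by rewrite exprn_gt0.
have r0 : 0 <= R2 0 z by rewrite R20 subr_ge0 Y_le1.
have sp : 0 < s by rewrite /s ltr_wpDl.
have s2 : 0 < s ^+ 2 by rewrite exprn_gt0.
have s1i : 0 < 8 / s1 by rewrite divr_gt0.
have nn : 0 <= 8 * eta ^+ 2 / s ^+ 2 by rewrite divr_ge0 ?(ltW s2)// mulr_ge0// ltW.
have [sl|sl] := leP s1 s.
  have E : Num.max (ln s1 - ln (R2 0 z + eta ^+ 2)) 0 = 0.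
    by apply/max_idPr; rewrite subr_le0 ler_ln ?posrE.
  have L0 : L = 0 by rewrite /L /rad2 E oppr0 expR0 subrr expr0n/=; ring.
  have m0 : m = 0 by apply/max_idPr; rewrite subr_le0 ler_pdivlMr// mul1r.
  by rewrite L0 m0; split; lra.
have E : expR (- Num.max (ln s1 - ln s) 0) = s / s1.
  rewrite (elimT max_idPl); last by rewrite subr_ge0 ler_ln ?posrE// ltW.
  by rewrite opprB expRD expRN !lnK ?posrE.
have mE : m = 1 - s / s1.
  by apply/max_idPl; rewrite subr_ge0 ler_pdivrMr// mul1r ltW.
clearbody m.
have m0 : 0 < m by rewrite mE subr_gt0 ltr_pdivrMr// mul1r.
have m1 : m < 1 by rewrite mE ltrBlDr ltrDl divr_gt0.
have LE : L = 8 / s1 * m - 4 * (eta ^+ 2 / s ^+ 2) * (m ^+ 2 + 2 * (1 - m) * m).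
  have -> : L = m ^+ 2 * (- (4 / s) + 4 * R2 0 z / s ^+ 2) + 2 * (s / s1) * m * (4 * R2 0 z / s ^+ 2).
    have rE : R2 0 z = co true z ^+ 2 + co false z ^+ 2 by rewrite R20 -cos2.
    by rewrite /L /rad2 -/s E -mE rE; field; rewrite !gt_eqF.
  have -> : R2 0 z = s - eta ^+ 2 by rewrite /s; ring.
  by rewrite mE; field; rewrite !gt_eqF.
have b0 : 0 <= m ^+ 2 + 2 * (1 - m) * m <= 2 by apply/andP; split; nra.
have /andP[b1 b2] := b0.
have b3 : 4 * (eta ^+ 2 / s ^+ 2) * (m ^+ 2 + 2 * (1 - m) * m) <= 4 * (eta ^+ 2 / s ^+ 2) * 2.
  by rewrite ler_wpM2l// mulr_ge0// divr_ge0 ?ltW.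
have b4 : 0 <= 4 * (eta ^+ 2 / s ^+ 2) * (m ^+ 2 + 2 * (1 - m) * m).
  by rewrite mulr_ge0// mulr_ge0// divr_ge0 ?ltW.
by rewrite LE; split; lra.
Qed.

(** * The discrete Jensen inequality *)

(** The Laplacian of [ln (|z - a|^2 + d) / 2]: an approximation of [2 pi] times the Dirac mass at
    [a]. *)
Definition kern {R : realType} (d : R) (a : R[i]) (z : pt R) : R := 2 * d / (R2 a z + d) ^+ 2.

Lemma kern_ge0 {R : realType} (d : R) (a : R[i]) z : 0 <= d -> 0 <= kern d a z.
Proof. by move=> d0; rewrite /kern divr_ge0 ?sqr_ge0// mulr_ge0. Qed.

(** Regularizing each factor separately, instead of [f] itself, makes every listed zero contribute
    its own explicit kernel, with multiplicity. The result dominates [log|f|]. *)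
Definition vreg {R : realType} (s : seq R[i]) (g : R[i] -> R[i]) (d : R) (z : pt R) : R :=
  \sum_(a <- s) lnreg (fun w => w - a) d z + lnreg g d z.

Lemma R2_ge0 {R : realType} (a : R[i]) (z : pt R) : 0 <= R2 a z.
Proof. by rewrite addr_ge0 ?sqr_ge0. Qed.

Lemma lnreg_point {R : realType} (a : R[i]) (d y : R) : 0 < d -> 0 < y ->
  exists2 C, 1 <= C & forall z, y <= Y z -> `|lnreg (fun w => w - a) d z| <= C /\
    forall h, 0 < h -> h * C <= 1 ->
    h ^+ 2 * kern d a z - C * h ^+ 3 <= lap (lnreg (fun w => w - a) d) z h.
Proof.
move=> d0 y0.
have z1 (z : pt R) : y <= Y z -> cabs (cpx z) <= 1.
  by move=> yz; apply: ltW; rewrite -Y_gt0 (lt_le_trans y0).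
have J := gjetD (ujet_dist2 a z1) (gjet_cst _ d).
pose B := (1 + cabs a) ^+ 2 + d.
have range (i : bool * pt R) : y <= Y i.2 -> d <= R2 a i.2 + d <= B.
  move=> yi; rewrite lerDr R2_ge0 lerD2r R2_cabs; apply: lerXn2r; rewrite ?nnegrE ?cabs_ge0//.
    by have := cabs_ge0 a; lra.
  by apply: le_trans (cabsD _ _) _; rewrite cabsN; have := z1 _ yi; lra.
have J2 := gjetZ (1 / 2) (gjet_comp (utay_ln B d0) range J).
have J3 : ujet (fun z => y <= Y z) (lnreg (fun w => w - a) d)
   (fun e z => 1 / 2 * ((R2 a z + d)^-1 * (2 * (co e z - coc e a) + 0)))
   (fun e z => 1 / 2 * ((R2 a z + d)^-1 * (2 + 0) + - ((R2 a z + d) ^+ 2)^-1 * (2 * (co e z - coc e a) + 0) ^+ 2)).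
  have E z : 1 / 2 * ln (R2 a z + d) = lnreg (fun w => w - a) d z.
    by rewrite /lnreg R2_cabs; ring.
  by apply: gjet_ext J2 => // i *; exact: E.
have [C C1 HC] := gjet_le J3; have [D D1 HD] := ujet_lap J3.
exists (C + D) => [|z yz]; first lra.
split; first by have := HC (true, z) yz; rewrite /=; lra.
move=> h h0 hD; have hD' : h * D <= 1.
  by rewrite -(gtr0_norm h0); apply: (@scaled_le _ _ (C + D)); [lra|rewrite gtr0_norm].
have := HD z h yz h0 hD'; rewrite ler_norml => /andP[+ _].
set T := 1 / 2 * _ + _.
have -> : T = kern d a z.
  have s0 : R2 a z + d != 0 by rewrite gt_eqF// ltr_wpDl// R2_ge0.
  have E : R2 a z = (co true z - coc true a) ^+ 2 + (co false z - coc false a) ^+ 2 by [].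
  have -> : kern d a z = 2 / (R2 a z + d) - 2 * R2 a z / (R2 a z + d) ^+ 2.
    by rewrite /kern; field.
  by rewrite /T [X in 2 * X / _]E; field.
have : 0 <= C * h ^+ 3 by rewrite mulr_ge0 ?exprn_ge0 ?(ltW h0).
lra.
Qed.

Lemma lapD {R : realType} (F G : pt R -> R) z h :
  lap (fun z => F z + G z) z h = lap F z h + lap G z h.
Proof. by rewrite /lap; ring. Qed.

Lemma vreg_lap {R : realType} (s : seq R[i]) (g : R[i] -> R[i]) (d y : R) :
  0 < d -> 0 < y -> analytic_on_disc g ->
  exists2 C, 1 <= C & forall z, y <= Y z -> `|vreg s g d z| <= C /\
    forall h, 0 < h -> h * C <= 1 ->
    h ^+ 2 * (\sum_(a <- s) kern d a z) - C * h ^+ 3 <= lap (vreg s g d) z h.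
Proof.
move=> d0 y0 gA; elim: s => [|a s [C C1 IH]].
  have [C C1 H] := lap_lnreg_disc d0 y0 gA.
  pose D := C + `|ln d| + ln (C ^+ 2 + d).
  have n0 := normr_ge0 (ln d).
  have vE : vreg [::] g d = lnreg g d by apply/funext => z; rewrite /vreg big_nil add0r.
  exists (C + `|ln d| + `|ln (C ^+ 2 + d)|) => [|z yz].
    by have := normr_ge0 (ln (C ^+ 2 + d)); lra.
  have m0 := normr_ge0 (ln (C ^+ 2 + d)).
  have [gC lC] := H z yz; rewrite vE; split.
    have p0 : 0 < cabs (g (cpx z)) ^+ 2 + d by rewrite ltr_wpDl// sqr_ge0.
    have C2 : cabs (g (cpx z)) ^+ 2 <= C ^+ 2 by apply: lerXn2r; rewrite ?nnegrE ?cabs_ge0//; lra.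
    have k1 : ln d <= ln (cabs (g (cpx z)) ^+ 2 + d) by rewrite ler_ln ?posrE// lerDr sqr_ge0.
    have k2 : ln (cabs (g (cpx z)) ^+ 2 + d) <= ln (C ^+ 2 + d).
      by rewrite ler_ln ?posrE// ?lerD2r//; apply: lt_le_trans p0 _; rewrite lerD2r.
    have := ler_norm (ln (C ^+ 2 + d)); have := ler_norm (- ln d); rewrite normrN.
    by move=> *; rewrite /lnreg ler_norml; apply/andP; split; lra.
  move=> h h0 hC; rewrite big_nil mulr0 sub0r.
  have hC' : h * C <= 1.
    rewrite -(gtr0_norm h0); apply: (@scaled_le _ _ (C + `|ln d| + `|ln (C ^+ 2 + d)|)); first lra.
    by rewrite gtr0_norm.
  apply: le_trans (lC h h0 hC').
  by rewrite lerN2 ler_wpM2r ?exprn_ge0 ?(ltW h0)//; lra.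
have [D D1 HD] := lnreg_point a d0 y0.
exists (C + D) => [|z yz]; first lra.
have vE : vreg (a :: s) g d = fun z => lnreg (fun w => w - a) d z + vreg s g d z.
  by apply/funext => w; rewrite /vreg big_cons addrA.
have [v1 v2] := IH z yz; have [w1 w2] := HD z yz.
rewrite vE; split; first by apply: le_trans (ler_normD _ _) _; lra.
move=> h h0 hC; have hC1 : h * C <= 1.
  by rewrite -(gtr0_norm h0); apply: (@scaled_le _ _ (C + D)); [lra|rewrite gtr0_norm].
have hD1 : h * D <= 1.
  by rewrite -(gtr0_norm h0); apply: (@scaled_le _ _ (C + D)); [lra|rewrite gtr0_norm].
have := v2 h h0 hC1; have := w2 h h0 hD1.
by rewrite lapD big_cons; lra.
Qed.

Lemma Y_sh {R : realType} (y : R) : 0 < y -> exists2 C, 1 <= C &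
  forall e (z : pt R) t, `|t| * C <= 1 ->
   (y <= Y z -> y / 2 <= Y (sh e z t)) /\ (Y z < y / 2 -> Y (sh e z t) < y).
Proof.
move=> y0; have [D D1 HD] := gjet_lip (ujet_Y y0).
have q0 : 0 < 4 * D / y by rewrite divr_gt0// mulr_gt0//; lra.
exists (D + 4 * D / y) => [|e z t tC]; first lra.
have t1 : `|t| * D <= 1 by apply: scaled_le tC; lra.
have t2 : D * `|t| <= y / 4.
  have : `|t| * (4 * D / y) <= 1 by apply: scaled_le tC; lra.
  by rewrite mulrA ler_pdivrMr// mul1r; lra.
split=> yz.
  have := HD (e, z) t yz t1; rewrite /= ler_norml => /andP[+ _]; lra.
rewrite ltNge; apply/negP => yz'.
have := HD (e, sh e z t) (- t) yz'; rewrite normrN => /(_ t1) /=.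
have -> : sh e (sh e z t) (- t) = z by case: e {yz'} z {yz} => -[x1 x2]; rewrite /sh/= addrK.
rewrite ler_norml => /andP[+ _]; lra.
Qed.

(** Since [phi] vanishes for [Y <= y1], there is no boundary term, and for [Y < y1 / 2] the whole
    five-point stencil sees zeros. Replacing second differences by Laplacians costs [O(h)], with a
    constant depending on [f] and [s], and small [h] brings this below [tol]. *)
Lemma green_ineq {R : realType} (s : seq R[i]) (g : R[i] -> R[i]) (d : R) (phi : pt R -> R) F1 F2
    (y1 tol : R) : 0 < d -> 0 < y1 -> analytic_on_disc g ->
  (forall z, 0 <= phi z) -> (forall z, Y z <= y1 -> phi z = 0) ->
  ujet (fun z => y1 / 2 <= Y z) phi F1 F2 -> 0 < tol ->
  exists2 h0, 0 < h0 & forall N h, h * N%:R = 1 -> (0 < N)%N -> h <= h0 ->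
   gsum (4 * N) h (fun z => phi z * \sum_(a <- s) kern d a z) <=
   gsum (4 * N) h (fun z => if y1 / 2 <= Y z then vreg s g d z * (F2 true z + F2 false z) else 0) + tol.
Proof.
move=> d0 y10 gA phi0 phi_eq0 J tol0.
have y20 : 0 < y1 / 2 by rewrite divr_gt0.
have [Cv Cv1 Hv] := vreg_lap s d0 y20 gA.
have [Cp Cp0 Hp] := gjet_le J; have [Cl Cl1 Hl] := ujet_lap J.
have [Cy Cy1 Hy] := Y_sh y10.
(* 16 is the area of the lattice square; the two products are the errors from the stencils of [vreg]
   and of [phi]. *)
pose M := 16 * (Cp * Cv + Cv * Cl) + 1.
have pv : 0 <= Cp * Cv by rewrite mulr_ge0//; lra.
have vl : 0 <= Cv * Cl by rewrite mulr_ge0//; lra.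
have M0 : 0 < M by rewrite /M; lra.
exists (Num.min (Cv + Cl + Cy)^-1 (tol / M)) => [|N h hN N0].
  by rewrite lt_min invr_gt0 divr_gt0// andbT; lra.
rewrite le_min => /andP[hC hT].
have h0 : 0 < h.
  have Np : (0 : R) < N%:R by rewrite ltr0n.
  by rewrite -(pmulr_lgt0 _ Np) hN.
have {}hC : h * (Cv + Cl + Cy) <= 1 by rewrite -ler_pdivlMr ?mul1r//; lra.
have small C : C <= Cv + Cl + Cy -> h * C <= 1.
  move=> CC; rewrite -(gtr0_norm h0); apply: (scaled_le CC); by rewrite gtr0_norm.
have hv := small Cv (ltac:(lra)); have hl := small Cl (ltac:(lra)); have hy := small Cy (ltac:(lra)).
have hM : M * h <= tol by rewrite mulrC -ler_pdivlMr.
have lap0 z : Y z < y1 / 2 -> lap phi z h = 0.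
  move=> yz; rewrite /lap !phi_eq0 ?mulr0 ?subr0 ?addr0//.
  - by lra.
  - apply: ltW; apply: (proj2 (Hy false z (- h) _)) => //; by rewrite normrN gtr0_norm.
  - apply: ltW; apply: (proj2 (Hy false z h _)) => //; by rewrite gtr0_norm.
  - apply: ltW; apply: (proj2 (Hy true z (- h) _)) => //; by rewrite normrN gtr0_norm.
  - apply: ltW; apply: (proj2 (Hy true z h _)) => //; by rewrite gtr0_norm.
have out z : 1 <= `|z.1| \/ 1 <= `|z.2| -> phi z = 0.
  move=> oz; apply: phi_eq0; apply: (le_trans (y := 0)); last exact: ltW.
  rewrite /Y; case: oz => oz.
    have : 1 <= z.1 ^+ 2 by rewrite -[z.1 ^+ 2]real_normK ?num_real// exprn_ege1.
    by have := sqr_ge0 z.2; lra.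
  have : 1 <= z.2 ^+ 2 by rewrite -[z.2 ^+ 2]real_normK ?num_real// exprn_ege1.
  by have := sqr_ge0 z.1; lra.
have G := @gsum_lap R N h phi (vreg s g d) hN N0 out.
have h3 : 0 <= h ^+ 3 by rewrite exprn_ge0// ltW.
have h2 : 0 < h ^+ 2 by rewrite exprn_gt0.
pose A z : R := phi z * \sum_(a <- s) kern d a z.
pose B z : R := if y1 / 2 <= Y z then vreg s g d z * (F2 true z + F2 false z) else 0.
rewrite -/A -/B.
have left : h ^+ 2 * gsum (4 * N) h A - Cp * Cv * h ^+ 3 * 16 <= gsum (4 * N) h (fun z => phi z * lap (vreg s g d) z h).
  have -> : h ^+ 2 * gsum (4 * N) h A - Cp * Cv * h ^+ 3 * 16 =
     gsum (4 * N) h (fun z => h ^+ 2 * A z + - (Cp * Cv * h ^+ 3)).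
    by rewrite gsumD gsumZ gsum_cst//; ring.
  apply: ler_gsum => i j; move: (grid h i j) => z.
  have pvh : 0 <= Cp * Cv * h ^+ 3 by rewrite mulr_ge0.
  have [yz|yz] := leP (y1 / 2) (Y z); last first.
    by rewrite /A phi_eq0 ?mul0r ?mulr0; lra.
  have [_ /(_ h h0 hv) K] := Hv z yz.
  apply: le_trans (ler_wpM2l (phi0 z) K).
  have pC : phi z <= Cp by have := Hp (true, z) yz; rewrite /=; have := ler_norm (phi z); lra.
  have : phi z * (Cv * h ^+ 3) <= Cp * (Cv * h ^+ 3).
    by rewrite ler_wpM2r// mulr_ge0//; lra.
  by rewrite /A; lra.
have right : gsum (4 * N) h (fun z => vreg s g d z * lap phi z h) <= h ^+ 2 * gsum (4 * N) h B + Cv * Cl * h ^+ 3 * 16.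
  have -> : h ^+ 2 * gsum (4 * N) h B + Cv * Cl * h ^+ 3 * 16 =
     gsum (4 * N) h (fun z => h ^+ 2 * B z + Cv * Cl * h ^+ 3).
    by rewrite gsumD gsumZ gsum_cst//; ring.
  apply: ler_gsum => i j; move: (grid h i j) => z.
  have vlh : 0 <= Cv * Cl * h ^+ 3 by rewrite mulr_ge0.
  rewrite /B; have [yz|yz] := leP (y1 / 2) (Y z); last first.
    by rewrite lap0// !mulr0; lra.
  have [K _] := Hv z yz; have K' := Hl z h yz h0 hl.
  have -> : vreg s g d z * lap phi z h = h ^+ 2 * (vreg s g d z * (F2 true z + F2 false z)) +
     vreg s g d z * (lap phi z h - h ^+ 2 * (F2 true z + F2 false z)) by ring.
  rewrite lerD2l; apply: le_trans (ler_norm _) _; rewrite normrM -mulrA.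
  by apply: ler_pM.
rewrite -(ler_pM2l h2) mulrDr.
have : M * h * h ^+ 2 <= tol * h ^+ 2 by rewrite ler_wpM2r// ltW.
have -> : M * h * h ^+ 2 = 16 * (Cp * Cv * h ^+ 3) + 16 * (Cv * Cl * h ^+ 3) + h ^+ 3 by rewrite /M; ring.
move: left right; rewrite G; lra.
Qed.

(** On the square of half-side [l] around [a] the kernel is at least
    [2 l^2 / (3 l^2)^2 = 2 / (9 l^2)], and the lattice gives that square area at least [l^2]: hence
    2/9 in place of [2 pi]. The Lipschitz bound on [phi] accounts for [C * l]. *)
Lemma kern_lower {R : realType} (phi : pt R -> R) F1 F2 (y1 : R) : 0 < y1 ->
  (forall z, 0 <= phi z) -> (forall z, Y z <= y1 -> phi z = 0) ->
  ujet (fun z => y1 / 2 <= Y z) phi F1 F2 ->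
  exists2 C, 1 <= C & forall (a : R[i]) N h l, h * N%:R = 1 -> (0 < N)%N -> cabs a < 1 ->
    0 < l -> l <= 1 / 2 -> l * C <= 1 -> h <= l ->
    2 / 9 * (phi (complex.Re a, complex.Im a) - C * l) <=
    gsum (4 * N) h (fun z => phi z * kern (l ^+ 2) a z).
Proof.
move=> y10 phi0 phi_eq0 J.
have [D D1 HD] := gjet_lip J.
have [Cy Cy1 Hy] := Y_sh y10.
exists (2 * D + Cy) => [|a N h l hN N0 a1 l0 l2 lC hl]; first lra.
pose za : pt R := (complex.Re a, complex.Im a).
have k0 z : 0 <= phi z * kern (l ^+ 2) a z by rewrite mulr_ge0// kern_ge0// sqr_ge0.
have Cl0 : 0 <= (2 * D + Cy) * l by rewrite mulr_ge0 ?(ltW l0)//; lra.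
have [ya|ya] := leP (Y za) y1.
  apply: (le_trans (y := 0)); last exact: gsum_ge0.
  by rewrite phi_eq0//; lra.
have [small|big] := leP (phi za) ((2 * D + Cy) * l).
  apply: (le_trans (y := 0)); last exact: gsum_ge0.
  lra.
have nl (C t : R) : C <= 2 * D + Cy -> `|t| <= l -> `|t| * C <= 1.
  move=> CC tl; apply: (scaled_le CC); apply: le_trans lC; rewrite ler_wpM2r//; lra.
have near z : `|z.1 - za.1| <= l -> `|z.2 - za.2| <= l -> phi za - (2 * D + Cy) * l <= phi z.
  move=> z1 z2.
  pose w := sh true za (z.1 - za.1).
  have yw : y1 / 2 <= Y w by apply: (proj1 (Hy true za _ (nl Cy _ (ltac:(lra)) z1))); exact: ltW.
  have yza : y1 / 2 <= Y za by lra.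
  have h1 : `|phi w - phi za| <= D * `|z.1 - za.1| := HD (true, za) (z.1 - za.1) yza (nl D _ (ltac:(lra)) z1).
  have h2 : `|phi (sh false w (z.2 - za.2)) - phi w| <= D * `|z.2 - za.2| := HD (false, w) (z.2 - za.2) yw (nl D _ (ltac:(lra)) z2).
  have wz : sh false w (z.2 - za.2) = z.
    by rewrite /w /sh /=; case: (z) => z1' z2' /=; congr pair; ring.
  move: h1 h2; rewrite wz !ler_norml => /andP[h1 _] /andP[h2 _].
  have : D * `|z.1 - za.1| <= D * l by rewrite ler_wpM2l//; lra.
  have : D * `|z.2 - za.2| <= D * l by rewrite ler_wpM2l//; lra.
  have : 0 <= Cy * l by rewrite mulr_ge0 ?(ltW l0)//; lra.
  lra.
pose c := phi za - (2 * D + Cy) * l; have c0 : 0 < c by rewrite subr_gt0.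
have l20 : 0 < l ^+ 2 by rewrite exprn_gt0.
have q0 : 0 <= 2 / (9 * l ^+ 2).
  by apply: divr_ge0 => //; apply: mulr_ge0 => //; exact: ltW.
pose W (b x : R) : R := (`|x - b| <= l)%R%:R.
apply: (le_trans (y := gsum (4 * N) h (fun z => c * (2 / (9 * l ^+ 2)) * (W za.1 z.1 * W za.2 z.2)))); last first.
  apply: ler_gsum => i j; move: (grid h i j) => z; rewrite /W.
  case: (boolP (`|z.1 - za.1| <= l)) => z1; last by rewrite mul0r mulr0.
  case: (boolP (`|z.2 - za.2| <= l)) => z2; last by rewrite mulr0 mulr0.
  rewrite !mulr1; apply: ler_pM; [exact: ltW|exact: q0|exact: near|].
  have r2 : R2 a z <= 2 * l ^+ 2.
    have e1 : (z.1 - za.1) ^+ 2 <= l ^+ 2.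
      by rewrite -[X in X <= _]real_normK ?num_real//; apply: lerXn2r; rewrite ?nnegrE ?(ltW l0).
    have e2 : (z.2 - za.2) ^+ 2 <= l ^+ 2.
      by rewrite -[X in X <= _]real_normK ?num_real//; apply: lerXn2r; rewrite ?nnegrE ?(ltW l0).
    by rewrite /R2; rewrite /za/= in e1 e2; lra.
  have s0 : 0 < R2 a z + l ^+ 2 by rewrite ltr_wpDl// R2_ge0.
  have s2 : (R2 a z + l ^+ 2) ^+ 2 <= (3 * l ^+ 2) ^+ 2.
    by apply: lerXn2r; rewrite ?nnegrE ?(ltW s0) ?mulr_ge0 ?(ltW l20)//; lra.
  have -> : 2 / (9 * l ^+ 2) = 2 * l ^+ 2 / (3 * l ^+ 2) ^+ 2 by field; rewrite gt_eqF.
  rewrite /kern ler_pM2l ?mulr_gt0// lef_pV2// posrE ?exprn_gt0 ?mulr_gt0//.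
rewrite gsumZ gsum_prod.
have cw b : `|b| <= 1 -> l <= \sum_(1 <= i < (4 * N).+1) h * W b (i%:R * h - 2).
  by move=> b1; exact: count_window.
have K : l * l <= (\sum_(1 <= i < (4 * N).+1) h * W za.1 (i%:R * h - 2)) *
    (\sum_(1 <= j < (4 * N).+1) h * W za.2 (j%:R * h - 2)).
  apply: ler_pM; rewrite ?(ltW l0)//; apply: cw.
    by apply: le_trans (Re_le_cabs a) _; exact: ltW.
  by apply: le_trans (Im_le_cabs a) _; exact: ltW.
have p0 : 0 <= c * (2 / (9 * l ^+ 2)) by apply: mulr_ge0 => //; exact: ltW.
apply: le_trans (ler_wpM2l p0 K).
have -> : c * (2 / (9 * l ^+ 2)) * (l * l) = 2 / 9 * c by field; rewrite gt_eqF.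
exact: lexx.
Qed.

Lemma vreg_expE {R : realType} (s : seq R[i]) (g : R[i] -> R[i]) (d : R) z : 0 < d ->
  expR (2 * vreg s g d z) = (\prod_(a <- s) (R2 a z + d)) * (cabs (g (cpx z)) ^+ 2 + d).
Proof.
move=> d0.
have reg (q : R[i] -> R[i]) : expR (2 * lnreg q d z) = cabs (q (cpx z)) ^+ 2 + d.
  have -> : 2 * lnreg q d z = ln (cabs (q (cpx z)) ^+ 2 + d) by rewrite /lnreg; field.
  by rewrite lnK// posrE ltr_wpDl// sqr_ge0.
rewrite /vreg mulrDr expRD reg; congr (_ * _).
elim: s => [|a s IH]; first by rewrite !big_nil mulr0 expR0.
by rewrite !big_cons mulrDr expRD IH reg R2_cabs.
Qed.

Lemma prod_reg {R : realType} (s : seq R[i]) (y : R) : 0 < y ->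
  exists2 C, 0 <= C & forall z d, y <= Y z -> 0 <= d <= 1 ->
    0 <= \prod_(a <- s) R2 a z /\
    \prod_(a <- s) R2 a z <= \prod_(a <- s) (R2 a z + d) <= \prod_(a <- s) R2 a z + C * d /\
    \prod_(a <- s) R2 a z <= C + 1.
Proof.
move=> y0; elim: s => [|a s [C C0 IH]].
  exists 0 => // z d _ _; rewrite !big_nil; split => //; split; last lra.
  by apply/andP; split; lra.
pose B := (1 + cabs a) ^+ 2.
have B0 : 0 <= B by exact: sqr_ge0.
have BC := mulr_ge0 B0 C0.
exists (B * C + (C + 1) + C + B * (C + 1)) => [|z d yz d01]; first by have := mulr_ge0 B0 (ltac:(lra) : 0 <= C + 1); lra.
have [p0 [/andP[p1 p2] p3]] := IH z d yz d01.
have /andP[d0 d1] := d01.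
have r0 := R2_ge0 a z.
have rB : R2 a z <= B.
  have z1 : cabs (cpx z) < 1 by rewrite -Y_gt0 (lt_le_trans y0).
  rewrite R2_cabs; apply: lerXn2r; rewrite ?nnegrE ?cabs_ge0//.
    by have := cabs_ge0 a; lra.
  by apply: le_trans (cabsD _ _) _; rewrite cabsN; lra.
rewrite !big_cons; move: p0 p1 p2 p3; set P := \prod_(_ <- _) _; set Q := \prod_(_ <- _) _ => p0 p1 p2 p3.
split; first by rewrite mulr_ge0.
have Cd := mulr_ge0 C0 d0.
have k1 : R2 a z * Q <= R2 a z * (P + C * d) by rewrite ler_wpM2l.
have k2 : R2 a z * (C * d) <= B * (C * d) by rewrite ler_wpM2r.
have k3 : d * Q <= d * (P + C * d) by rewrite ler_wpM2l.
have k4 : d * P <= d * (C + 1) by rewrite ler_wpM2l.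
have k5 : d * (C * d) <= 1 * (C * d) by rewrite ler_wpM2r.
have k6 : R2 a z * P <= B * (C + 1) by rewrite ler_pM.
have k7 : R2 a z * P <= R2 a z * Q by rewrite ler_wpM2l.
have k8 : 0 <= d * Q by rewrite mulr_ge0//; lra.
have k9 : 0 <= B * (C + 1) * d by rewrite mulr_ge0// mulr_ge0//; lra.
split; last lra.
apply/andP; split; lra.
Qed.

(** Adding [d] in each factor changes [|f|^2] by at most [M d]. Because [u >= 0], this additive
    error is at most [M d exp (2 u)], hence only a small additive error in the exponent. *)
Lemma vreg_upper {R : realType} (f g : R[i] -> R[i]) (s : seq R[i]) (u : pt R -> R) (y sm : R) :
  0 < y -> 0 < sm -> analytic_on_disc g ->
  (forall z, f z = (\prod_(a <- s) (z - a)) * g z) ->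
  (forall z, y <= Y z -> 0 <= u z) ->
  (forall z, y <= Y z -> cabs (f (cpx z)) <= expR (u z)) ->
  exists2 d0, 0 < d0 & forall d, 0 < d <= d0 -> forall z, y <= Y z -> vreg s g d z <= u z + sm.
Proof.
move=> y0 sm0 gA fE u0 fu.
have [C C1 HC] := lap_lnreg_disc ltr01 y0 gA.
have [D D0 HD] := prod_reg s y0.
pose M := D * C ^+ 2 + (D + 1) + D + 1.
have C2 : 0 <= C ^+ 2 by exact: sqr_ge0.
have DC := mulr_ge0 D0 C2.
have M0 : 0 < M by rewrite /M; lra.
exists (Num.min 1 (2 * sm / M)) => [|d /andP[d0]]; first by rewrite lt_min ltr01 divr_gt0// mulr_gt0.
rewrite le_min => /andP[d1 dM] z yz.
have {}dM : M * d <= 2 * sm by rewrite mulrC -ler_pdivlMr.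
have [gC _] := HC z yz.
have d01 : 0 <= d <= 1 by rewrite (ltW d0) d1.
have [p0 [/andP[_ p2] p3]] := HD z d yz d01.
have g2 : cabs (g (cpx z)) ^+ 2 <= C ^+ 2.
  by apply: lerXn2r; rewrite ?nnegrE ?cabs_ge0//; lra.
have gg0 : 0 <= cabs (g (cpx z)) ^+ 2 by exact: sqr_ge0.
have fz : (\prod_(a <- s) R2 a z) * cabs (g (cpx z)) ^+ 2 = cabs (f (cpx z)) ^+ 2.
  rewrite fE cabsM cabs_prod exprMn; congr (_ * _).
  elim: (s) => [|a t IH]; first by rewrite !big_nil expr1n.
  by rewrite !big_cons exprMn IH R2_cabs.
have ez := vreg_expE s g z d0.
have fb : cabs (f (cpx z)) ^+ 2 <= expR (2 * u z).
  have -> : expR (2 * u z) = expR (u z) ^+ 2 by rewrite expr2 -expRD; congr expR; ring.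
  by apply: lerXn2r; rewrite ?nnegrE ?cabs_ge0 ?expR_ge0// fu.
have eu : 1 <= expR (2 * u z) by rewrite -expR0 ler_expR mulr_ge0// u0.
suff h : expR (2 * vreg s g d z) <= expR (2 * u z + M * d) by move: h; rewrite ler_expR; lra.
rewrite ez expRD.
apply: (le_trans (y := expR (2 * u z) * (1 + M * d))); last first.
  by rewrite ler_wpM2l ?expR_ge0// expR_ge1Dx.
move: p0 p2 p3 fz; set P := \prod_(_ <- _) _; set Q := \prod_(_ <- _) _ => p0 p2 p3 fz.
set G := cabs _ ^+ 2 in g2 gg0 fz *.
have k1 : Q * (G + d) <= (P + D * d) * (G + d) by rewrite ler_wpM2r//; lra.
have k2 : D * d * G <= D * d * C ^+ 2 by rewrite ler_wpM2l// mulr_ge0// ltW.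
have k3 : P * d <= (D + 1) * d by rewrite ler_wpM2r// ltW.
have k4 : D * d * d <= D * d * 1 by rewrite ler_wpM2l// mulr_ge0// ltW.
have k5 : M * d <= expR (2 * u z) * (M * d) by rewrite ler_peMl// mulr_ge0// ltW.
have k6 : M * d = D * d * C ^+ 2 + (D + 1) * d + D * d * 1 + d by rewrite /M; ring.
lra.
Qed.

(** Near 0, [vreg >= log|f|], and [(f - f 0) / z] is bounded with [|f 0| = 1]; farther out,
    boundedness of [vreg] suffices because [2 B |z| > 1]. The vanishing of the bound at 0 is what
    tames the spike of [rad]. *)
Lemma vreg_lower {R : realType} (f g : R[i] -> R[i]) (s : seq R[i]) (d y : R) :
  0 < d -> 0 < y -> analytic_on_disc f -> analytic_on_disc g ->
  (forall z, f z = (\prod_(a <- s) (z - a)) * g z) -> cabs (f 0) = 1 ->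
  exists2 C, 0 < C & forall z, y <= Y z -> - (C * cabs (cpx z)) <= vreg s g d z.
Proof.
move=> d0 y0 fA gA fE f0.
have [C C1 HC] := vreg_lap s d0 y0 gA.
have [c [rho cf]] : exists c rho, pseries_at f 0 c rho by apply: fA; rewrite cabs0.
have c0 := pseries_val cf.
have c0rho : pseries_at (fun z => f z - f 0) 0 (fun i => if i == 0%N then 0 else c i) rho.
  have [r0 H] := cf; split => // z zr; have := H z zr; rewrite -(cvg_shiftS (fun N => cabs _)) => Hs.
  rewrite -(cvg_shiftS (fun N => cabs _)).
  apply: cvg_trans Hs; apply: near_eq_cvg; near=> N; congr cabs.
  by rewrite !big_ord_recl/= c0 expr0; ring.
have [f1 [E1 f1A _ _]] : exists f1, [/\ forall z, f z - f 0 = (z - 0) * f1 z,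
    analytic_on_disc f1, vanishes_to f1 0 0 & forall w j, w != 0 -> vanishes_to (fun z => f z - f 0) w j -> vanishes_to f1 w j].
  apply: factor1.
    move=> w w1; have [cw [rw H]] := fA w w1.
    exists (fun i => if i == 0%N then cw 0%N - f 0 else cw i), rw.
    have [r0 K] := H; split => // z zr; have := K z zr; rewrite -(cvg_shiftS (fun N => cabs _)) => Hs.
    rewrite -(cvg_shiftS (fun N => cabs _)).
    apply: cvg_trans Hs; apply: near_eq_cvg; near=> N; congr cabs.
    by rewrite !big_ord_recl/= expr0; ring.
  by exists (fun i => if i == 0%N then 0 else c i), rho; split => // -[].
have [B B1 HB] := lap_lnreg_disc ltr01 y0 f1A.
have nB0 : 0 < B by lra.
exists (2 * B * (C + 1)) => [|z yz]; first by rewrite mulr_gt0 ?mulr_gt0//; lra.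
have [f1B _] := HB z yz; have [vC _] := HC z yz.
have zn0 := cabs_ge0 (cpx z).
have [zs|zb] := leP (2 * B * cabs (cpx z)) 1; last first.
  move: vC; rewrite ler_norml => /andP[vC _].
  have : (C + 1) * 1 <= (C + 1) * (2 * B * cabs (cpx z)) by rewrite ler_wpM2l//; lra.
  lra.
have fz : 1 - B * cabs (cpx z) <= cabs (f (cpx z)).
  have k := cabsD (f (cpx z)) (f 0 - f (cpx z)).
  rewrite [f (cpx z) + _]addrC subrK f0 cabsB E1 subr0 cabsM in k.
  have : cabs (cpx z) * cabs (f1 (cpx z)) <= cabs (cpx z) * B by rewrite ler_wpM2l.
  lra.
have fp : 0 < cabs (f (cpx z)) by lra.
have [D D0 HD] := prod_reg s y0.
have e1 : cabs (f (cpx z)) ^+ 2 <= expR (2 * vreg s g d z).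
  rewrite vreg_expE// fE cabsM cabs_prod exprMn; apply: ler_pM; rewrite ?sqr_ge0//; last by rewrite lerDl ltW.
  elim: (s) => [|a t IH]; first by rewrite !big_nil expr1n.
  rewrite !big_cons exprMn; apply: ler_pM; rewrite ?sqr_ge0//.
  by rewrite R2_cabs lerDl ltW.
have e2 : 2 * ln (cabs (f (cpx z))) <= 2 * vreg s g d z.
  rewrite -ler_expR; apply: le_trans e1.
  have -> : 2 * ln (cabs (f (cpx z))) = ln (cabs (f (cpx z))) + ln (cabs (f (cpx z))) by ring.
  by rewrite expRD lnK ?posrE// expr2.
have e3 : - (2 * B * cabs (cpx z)) <= ln (cabs (f (cpx z))).
  set t := cabs (f _) in fz fp *.
  have := @le_ln1Dx R (t^-1 - 1); rewrite subrKC lnV ?posrE// => H.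
  have ti : 0 < t^-1 by rewrite invr_gt0.
  have {}H := H (ltac:(lra)).
  have : t^-1 <= 1 + 2 * B * cabs (cpx z).
    rewrite -[t^-1]mul1r ler_pdivrMr//.
    apply: (le_trans (y := (1 + 2 * B * cabs (cpx z)) * (1 - B * cabs (cpx z)))).
      have Bz : 0 <= B * cabs (cpx z) by rewrite mulr_ge0//; lra.
      have : 0 <= (B * cabs (cpx z)) * (1 - 2 * B * cabs (cpx z)) by rewrite mulr_ge0//; lra.
      lra.
    by rewrite ler_wpM2l//; have : 0 <= B * cabs (cpx z) by [rewrite mulr_ge0//; lra]; lra.
  lra.
have : 2 * B * cabs (cpx z) <= 2 * B * (C + 1) * cabs (cpx z).
  have -> : 2 * B * (C + 1) * cabs (cpx z) = 2 * B * cabs (cpx z) + 2 * B * C * cabs (cpx z) by ring.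
  by rewrite lerDl !mulr_ge0//; lra.
lra.
Unshelve. all: by end_near. Qed.

(* The error committed by the regularized pole at 0 of the test function is
   O(sqrt eta) because |z| eta^2 / (|z|^2 + eta^2)^2 <= eta^(1/2) (|z|^2 + eta^2)^(-3/4). *)
Lemma gsum_pole {R : realType} :
  exists2 C : R, 0 < C & forall N (h eta : R), h * N%:R = 1 -> (0 < N)%N -> 0 < eta -> h <= eta ->
   gsum (4 * N) h (fun z => cabs (cpx z) * (eta ^+ 2 / (R2 0 z + eta ^+ 2) ^+ 2)) <= C * eta `^ (1 / 2).
Proof.
(* This value makes [1 / 2 - 2 * th = - 1], while each one-dimensional sum still has an exponent
   below 1. *)
pose th : R := 3 / 4.
have th01 : 0 <= th < 1 by apply/andP; split; rewrite /th; lra.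
have th1 : 0 <= th <= 1 by apply/andP; split; rewrite /th; lra.
have [C C0 HC] := sum_bump th01.
exists (4 * (C * C)) => [|N h eta hN N0 eta0 he]; first by rewrite !mulr_gt0.
have h0 : 0 < h.
  have Np : (0 : R) < N%:R by rewrite ltr0n.
  by rewrite -(pmulr_lgt0 _ Np) hN.
apply: (le_trans (y := gsum (4 * N) h (fun z => 4 * eta `^ (1 / 2) * (bump th h z.1 * bump th h z.2)))); last first.
  rewrite gsumZ gsum_prod.
  have K : \sum_(1 <= i < (4 * N).+1) h * bump th h (i%:R * h - 2) <= C.
    have := HC N h 0 hN N0; rewrite normr0 => /(_ (ltac:(lra))).
    by under eq_bigr do rewrite subr0.
  have K0 : 0 <= \sum_(1 <= i < (4 * N).+1) h * bump th h (i%:R * h - 2).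
    by apply: sumr_ge0 => i _; rewrite mulr_ge0 ?bump_ge0 ?(ltW h0).
  have -> : 4 * (C * C) * eta `^ (1 / 2) = 4 * eta `^ (1 / 2) * (C * C) by ring.
  by rewrite ler_wpM2l ?mulr_ge0 ?powR_ge0// ler_pM.
apply: ler_gsum => i j; move: (grid h i j) => z.
have r0 := R2_ge0 (0 : R[i]) z.
have e2 : 0 < eta ^+ 2 by rewrite exprn_gt0.
pose s := Num.sqrt (R2 0 z + eta ^+ 2).
have s2 : s ^+ 2 = R2 0 z + eta ^+ 2 by rewrite sqr_sqrtr//; lra.
have s0 : 0 < s by rewrite sqrtr_gt0; lra.
have zs : cabs (cpx z) <= s.
  have zn := cabs_ge0 (cpx z).
  rewrite -(@ler_pXn2r _ 2)// ?nnegrE ?(ltW s0)// s2.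
  by have := R2_cabs 0 z; rewrite subr0 => <-; lra.
have es : eta <= s by rewrite -(@ler_pXn2r _ 2)// ?nnegrE ?(ltW s0) ?(ltW eta0)// s2 lerDr.
have b1 : s `^ (- th) <= 2 * bump th h z.1.
  apply: bump_le => //; [|exact: le_trans es].
  by apply: le_trans zs; have := Re_le_cabs (cpx z).
have b2 : s `^ (- th) <= 2 * bump th h z.2.
  apply: bump_le => //; [|exact: le_trans es].
  by apply: le_trans zs; have := Im_le_cabs (cpx z).
have -> : 4 * eta `^ (1 / 2) * (bump th h z.1 * bump th h z.2) =
   eta `^ (1 / 2) * ((2 * bump th h z.1) * (2 * bump th h z.2)) by ring.
apply: (le_trans (y := eta `^ (1 / 2) * (s `^ (- th) * s `^ (- th)))); last first.
  by rewrite ler_wpM2l ?powR_ge0// ler_pM ?powR_ge0.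
rewrite -s2.
apply: (le_trans (y := s * (eta ^+ 2 / (s ^+ 2) ^+ 2))).
  by rewrite ler_wpM2r// divr_ge0 ?(ltW e2)// sqr_ge0.
have hs : (eta / s) ^+ 2 <= (eta / s) `^ (1 / 2).
  have q0 : 0 < eta / s by rewrite divr_gt0.
  rewrite -powR_mulrn ?(ltW q0)//.
  have q1 : eta / s <= 1 by rewrite ler_pdivrMr// mul1r.
  by apply: ger_powR; [rewrite q0 q1|lra].
have E1 : s * (eta ^+ 2 / (s ^+ 2) ^+ 2) = (eta / s) ^+ 2 * s^-1 by field; rewrite gt_eqF.
have E2 : eta `^ (1 / 2) = (eta / s) `^ (1 / 2) * s `^ (1 / 2).
  by rewrite -powRM ?divr_ge0 ?(ltW s0) ?(ltW eta0)// divfK// gt_eqF.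
have E3 : s `^ (1 / 2) * (s `^ (- th) * s `^ (- th)) = s^-1.
  rewrite -!powRD ?(gt_eqF s0) ?implybT//.
  have -> : 1 / 2 + (- th - th) = -1 by rewrite /th; field.
  by rewrite powR_inv1// ltW.
rewrite E1 E2 -mulrA E3 ler_wpM2r// invr_ge0 ltW//.
Qed.

Lemma exists_step {R : realType} (e : R) : 0 < e ->
  exists N (h : R), [/\ h * N%:R = 1, (0 < N)%N, 0 < h & h <= e].
Proof.
move=> e0; have ei : 0 <= e^-1 by rewrite invr_ge0 ltW.
have := archi_boundP ei; set N := Num.bound _ => eN.
have N0 : (0 : R) < N%:R by apply: le_lt_trans eN.
exists N, N%:R^-1; split; rewrite ?invr_gt0//.
- by rewrite mulVf// gt_eqF.
- by rewrite -[e]invrK lef_pV2 ?posrE ?invr_gt0// ltW.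
Qed.

(* Adding [A / (2 Y0) * rad] makes the Laplacian bound nonnegative in the middle of the disc. *)
Lemma rad_compensates {R : realType} (L1 A Y0 eta : R) (z : pt R) :
  0 < Y0 -> Y0 <= 1 -> 0 <= A -> eta ^+ 2 <= Y0 / 2 ->
  (Y z <= Y0 -> 0 <= L1) -> - A <= L1 ->
  let s1 := 1 - Y0 / 4 in let m := Num.max (1 - (R2 0 z + eta ^+ 2) / s1) 0 in
  0 <= L1 + A / (2 * Y0) * (8 / s1 * m) <= L1 + (if Y0 / 4 <= Y z then 8 * A / Y0 else 0).
Proof.
move=> Yp Y01 A0 etaY Lpos Llow /=; set s1 := 1 - Y0 / 4; set m := Num.max _ 0.
have s10 : 0 < s1 by rewrite /s1; lra.
have s34 : 3 / 4 <= s1 by rewrite /s1; lra.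
have s11 : s1 <= 1 by rewrite /s1; lra.
have e8 : 0 <= 8 / s1 by apply: divr_ge0 => //; exact: ltW.
set A1 := A / (2 * Y0).
have A10 : 0 <= A1 by rewrite divr_ge0// mulr_ge0// ltW.
have A8 : A1 * (8 / s1) <= 8 * A / Y0.
  have -> : A1 * (8 / s1) = (A / Y0) * (4 / s1) by rewrite /A1; field; rewrite !gt_eqF.
  have -> : 8 * A / Y0 = (A / Y0) * 8 by ring.
  apply: ler_wpM2l; first by rewrite divr_ge0// ltW.
  by rewrite ler_pdivrMr//; lra.
have S0 : 0 <= R2 0 z + eta ^+ 2 by rewrite addr_ge0 ?R2_ge0 ?sqr_ge0.
have m0 : 0 <= m by rewrite le_max lexx orbT.
have m1 : m <= 1 by rewrite ge_max ler01 andbT gerBl divr_ge0// ltW.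
apply/andP; split.
  have [yY|yY] := leP (Y z) Y0.
    by apply: addr_ge0; [exact: Lpos|apply: mulr_ge0 => //; exact: mulr_ge0].
  have mm : Y0 / 4 <= m.
    rewrite le_max; apply/orP; left.
    have : (R2 0 z + eta ^+ 2) / s1 <= 1 - Y0 / 4.
      rewrite ler_pdivrMr// R20 -/s1.
      have : 0 <= Y0 * Y0 by rewrite mulr_ge0// ltW.
      rewrite /s1; lra.
    lra.
  have : A <= A1 * (8 / s1 * m).
    have -> : A = A1 * (2 * Y0) by rewrite /A1; field; rewrite gt_eqF.
    apply: ler_wpM2l => //.
    have : 8 * m <= 8 / s1 * m.
      by rewrite ler_wpM2r// ler_pdivlMr//; lra.
    lra.
  lra.
rewrite lerD2l; case: ifP => yY.
  by rewrite mulrA; apply: le_trans A8; rewrite ler_piMr//; exact: mulr_ge0.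
have -> : m = 0.
  apply/max_idPr; rewrite subr_le0 ler_pdivlMr// mul1r R20 /s1.
  move/negbT: yY; rewrite -ltNge => yY; have := sqr_ge0 eta; lra.
by rewrite !mulr0.
Qed.

(** The upper bound on [v] is used against the positive part [P] of the Laplacian, the lower bound
    against the negative spike [A * N]. *)
Lemma signed_product_le {R : realType} (v u sm P Q Pm N c A e : R) :
  v <= u + sm -> - c <= v -> 0 <= c -> 0 <= u -> 0 <= sm -> 0 <= P -> P <= Q -> P <= Pm ->
  0 <= A -> 0 <= N -> N <= e ->
  v * (P - A * N) <= u * Q + sm * Pm + c * (A * e).
Proof.
move=> vu vl c0 u0 sm0 P0 PQ PPm A0 N0 Ne.
have AN : 0 <= A * N by rewrite mulr_ge0.
have k1 : v * P <= (u + sm) * P by rewrite ler_wpM2r.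
have k2 : sm * P <= sm * Pm by rewrite ler_wpM2l.
have k3 : u * P <= u * Q by rewrite ler_wpM2l.
have k4 : - v * (A * N) <= c * (A * N) by rewrite ler_wpM2r//; lra.
have k5 : c * (A * N) <= c * (A * e) by rewrite ler_wpM2l// ler_wpM2l.
lra.
Qed.

(** The constants for [f], [s] and [phi] enter only through errors that disappear as [l], [eta] and
    [h] are chosen small, so the conclusion retains [B] alone. The width [eta] comes after [d],
    because the constant of [vreg_lower] depends on [d]. *)
Lemma jensen_bound {R : realType} (f g : R[i] -> R[i]) (s : seq R[i]) (u : pt R -> R)
    (phi : pt R -> R) F1 F2 (y1 Y0 A B h1 : R) :
  0 < y1 -> y1 < Y0 / 4 -> Y0 <= 1 -> 0 <= A ->
  (forall z, 0 <= phi z) -> (forall z, Y z <= y1 -> phi z = 0) ->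
  ujet (fun z => y1 / 2 <= Y z) phi F1 F2 ->
  (forall z, y1 / 2 <= Y z -> Y z <= Y0 -> 0 <= F2 true z + F2 false z) ->
  (forall z, y1 / 2 <= Y z -> - A <= F2 true z + F2 false z) ->
  analytic_on_disc f -> analytic_on_disc g ->
  (forall z, f z = (\prod_(a <- s) (z - a)) * g z) -> cabs (f 0) = 1 ->
  (forall a, a \in s -> cabs a < 1) ->
  (forall z, y1 / 2 <= Y z -> 0 <= u z) ->
  (forall z, y1 / 2 <= Y z -> cabs (f (cpx z)) <= expR (u z)) ->
  0 < h1 ->
  (forall N h, h * N%:R = 1 -> (0 < N)%N -> h <= h1 ->
    gsum (4 * N) h (fun z => if y1 / 2 <= Y z then
      u z * (F2 true z + F2 false z + (if Y0 / 4 <= Y z then 8 * A / Y0 else 0)) else 0) <= B) ->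
  2 / 9 * \sum_(a <- s) phi (complex.Re a, complex.Im a) <= B.
Proof.
move=> y10 y1Y Y01 A0 phi0 phi_eq0 J Lpos Llow fA gA fE f0 s1d u0 fu h10 HB.
have Yp : 0 < Y0 by lra.
have y20 : 0 < y1 / 2 by rewrite divr_gt0.
(* [tol] is spent in four quarters: the Lipschitz loss of [kern_lower] through [l], the lattice
   error of [green_ineq], the excess [sm] of [vreg_upper], and the spike of [rad] through [w]. *)
apply/ler_addgt0Pr => tol tol0.
have [CF CF1 HF] := J.
pose A1 := A / (2 * Y0).
have A10 : 0 <= A1 by rewrite divr_ge0// mulr_ge0// ltW.
pose s1 := 1 - Y0 / 4.
have s10 : 0 < s1 by rewrite /s1; lra.
have AY : 0 <= 8 * A / Y0 by rewrite divr_ge0 ?(ltW Yp)// mulr_ge0.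
pose Pm := 2 * CF + 8 * A / Y0.
have Pm0 : 0 < Pm by rewrite /Pm; lra.
pose sm := tol / 4 / (16 * Pm).
have sm0 : 0 < sm by rewrite /sm divr_gt0 ?mulr_gt0// divr_gt0.
have [d0 d00 Hup] := @vreg_upper R f g s u (y1 / 2) sm y20 sm0 gA fE u0 fu.
have [Ck Ck1 Hk] := kern_lower y10 phi0 phi_eq0 J.
pose ns : R := (size s)%:R.
have ns0 : 0 <= ns by rewrite ler0n.
pose l := Num.min (Num.min (1 / 2) d0) (Num.min Ck^-1 (tol / 4 / (ns * Ck + 1))).
have nC : 0 < ns * Ck + 1 by rewrite ltr_wpDl// mulr_ge0//; lra.
have Ck0 : 0 < Ck by exact: lt_le_trans Ck1.
have l0 : 0 < l by rewrite !lt_min d00 invr_gt0 Ck0 !divr_gt0.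
have l2 : l <= 1 / 2 by rewrite !ge_min lexx.
have ld : l <= d0 by rewrite !ge_min lexx !orbT.
have lC : l * Ck <= 1.
  by rewrite -ler_pdivlMr// mul1r !ge_min lexx !orbT.
have lt : l * (ns * Ck + 1) <= tol / 4.
  by rewrite -ler_pdivlMr//; rewrite !ge_min lexx !orbT.
clearbody l.
(* This ties the regularization of the logarithm to the window of width [l] used by [kern_lower]. *)
pose d := l ^+ 2; have dp : 0 < d by rewrite exprn_gt0.
have dd0 : d <= d0.
  by apply: le_trans ld; rewrite /d expr2 ler_piMr ?(ltW l0)//; lra.
have dd : 0 < d <= d0 by rewrite dp dd0.
have [Cv Cv0 Hlow] := @vreg_lower R f g s d (y1 / 2) dp y20 fA gA fE f0.
have [Cp Cp0 Hp] := @gsum_pole R.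
pose K := Cv * A1 * 8 * Cp.
have CA : 0 <= Cv * A1 by apply: mulr_ge0 => //; exact: ltW.
have CA8 : 0 <= Cv * A1 * 8 by apply: mulr_ge0.
have K0 : 0 <= K by apply: mulr_ge0 => //; exact: ltW.
pose w := Num.min (Y0 / 2) (tol / 4 / (K + 1)).
have K1 : 0 < K + 1 by rewrite ltr_wpDl.
have w0 : 0 < w by rewrite lt_min !divr_gt0.
have wY : w <= Y0 / 2 by rewrite ge_min lexx.
have wK : K * w <= tol / 4.
  have : w * (K + 1) <= tol / 4 by rewrite -ler_pdivlMr// ge_min lexx orbT.
  by clear -w0; lra.
clearbody w.
(* The spike error is of order [eta^(1/2)], so that [w] measures it directly. *)
pose eta := w ^+ 2; have eta0 : 0 < eta by rewrite exprn_gt0.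
have etaw : eta `^ (1 / 2) = w.
  rewrite /eta -powR_mulrn ?(ltW w0)// -powRrM.
  have -> : 2%:R * (1 / 2) = 1 :> R by field.
  by rewrite powRr1// ltW.
have etaY : eta ^+ 2 <= Y0 / 2.
  have w1 : w <= 1 by clear -wY Y01; lra.
  have ew : eta <= w by rewrite /eta expr2 ler_piMr// ltW.
  apply: le_trans (le_trans ew wY); rewrite expr2 ler_piMr ?(ltW eta0)//; exact: le_trans w1.
pose Phi z := phi z + A1 * rad s1 eta z.
have JP := gjetD J (gjetZ A1 (ujet_rad s1 y20 eta0)).
pose G2 e z := F2 e z + A1 * rad2 s1 eta e z.
have {}JP : ujet (fun z => y1 / 2 <= Y z) Phi (fun e z => F1 e z + A1 * rad1 s1 eta e z) G2 by exact: JP.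
have Phi0 z : 0 <= Phi z by rewrite addr_ge0// mulr_ge0// rad_ge0.
have Phi_eq0 z : Y z <= y1 -> Phi z = 0.
  move=> yz; rewrite /Phi phi_eq0//.
  have ys : Y z <= 1 - s1 by rewrite /s1; clear -yz y1Y; lra.
  have [-> _] := rad_eq0 s10 eta0 ys.
  by rewrite mulr0 addr0.
have E3 (a b c e : R) : a * b * 8 * (c * e) = a * c * (b * (8 * e)) by ring.
have t40 : 0 < tol / 4 by rewrite divr_gt0.
have [h0 h00 Hg] := green_ineq s dp y10 gA Phi0 Phi_eq0 JP t40.
have hm0 : 0 < Num.min (Num.min h0 h1) (Num.min l eta) by rewrite !lt_min h00 h10 l0 eta0.
have [N [h [hN N0 hp]]] := exists_step hm0.
rewrite !le_min => /andP[/andP[hh0 hh1] /andP[hl he]].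
have {}Hg := Hg N h hN N0 hh0.
have {}HB := HB N h hN N0 hh1.
have {}Hp := Hp N h eta hN N0 eta0 he.
have lower : 2 / 9 * \sum_(a <- s) phi (complex.Re a, complex.Im a) - tol / 4 <=
   gsum (4 * N) h (fun z => Phi z * \sum_(a <- s) kern d a z).
  apply: (le_trans (y := gsum (4 * N) h (fun z => \sum_(a <- s) phi z * kern d a z))); last first.
    apply: ler_gsum => i j; move: (grid h i j) => z; rewrite -mulr_sumr.
    apply: ler_wpM2r; first by apply: sumr_ge0 => a _; apply: kern_ge0; exact: ltW.
    by rewrite lerDl mulr_ge0// rad_ge0.
  rewrite gsum_big.
  apply: (le_trans (y := \sum_(a <- s) (2 / 9 * (phi (complex.Re a, complex.Im a) - Ck * l)))); last first.
    rewrite big_seq [leRHS]big_seq; apply: ler_sum => a /s1d a1.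
    exact: Hk.
  rewrite -mulr_sumr sumrB big_const_seq count_predT iter_addr_0 -[_ *+ size s]mulr_natl -/ns.
  have : 0 <= l * ns * Ck by apply: mulr_ge0; [apply: mulr_ge0 => //|]; exact: ltW.
  by clear -lt l0; lra.
have upper : gsum (4 * N) h (fun z => if y1 / 2 <= Y z then vreg s g d z * (G2 true z + G2 false z) else 0)
   <= B + tol / 4 + tol / 4.
  pose Bf z : R := if y1 / 2 <= Y z then
      u z * (F2 true z + F2 false z + (if Y0 / 4 <= Y z then 8 * A / Y0 else 0)) else 0.
  apply: (le_trans (y := gsum (4 * N) h (fun z => Bf z + sm * Pm +
     Cv * A1 * 8 * (cabs (cpx z) * (eta ^+ 2 / (R2 0 z + eta ^+ 2) ^+ 2))))); last first.
    rewrite !gsumD (gsum_cst _ hN) gsumZ.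
    have -> : 16 * (sm * Pm) = tol / 4 by rewrite /sm; field; rewrite !gt_eqF.
    have : Cv * A1 * 8 * gsum (4 * N) h (fun z => cabs (cpx z) * (eta ^+ 2 / (R2 0 z + eta ^+ 2) ^+ 2)) <=
       Cv * A1 * 8 * (Cp * eta `^ (1 / 2)) by exact: ler_wpM2l.
    rewrite etaw.
    have -> : Cv * A1 * 8 * (Cp * w) = K * w by rewrite /K; ring.
    move: HB; rewrite -/Bf; clear -wK; lra.
  apply: ler_gsum => i j; move: (grid h i j) => z.
  have pole0 : 0 <= eta ^+ 2 / (R2 0 z + eta ^+ 2) ^+ 2 by rewrite divr_ge0 ?sqr_ge0.
  have sP0 : 0 <= sm * Pm by rewrite mulr_ge0 ?ltW.
  have zn := cabs_ge0 (cpx z).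
  rewrite /Bf; case: ifP => yz; last first.
    have : 0 <= Cv * A1 * 8 * (cabs (cpx z) * (eta ^+ 2 / (R2 0 z + eta ^+ 2) ^+ 2)).
      by apply: mulr_ge0 => //; exact: mulr_ge0.
    clear -sP0; lra.
  have Yz : 0 < Y z by exact: lt_le_trans yz.
  have := rad_lap s10 eta0 Yz; rewrite /=.
  set S := R2 0 z + eta ^+ 2 in pole0 *.
  set m := Num.max _ _; set L2 := rad2 _ _ _ _ + _ => -[r1 r2].
  pose L1 := F2 true z + F2 false z.
  have GE : G2 true z + G2 false z = L1 + A1 * L2 by rewrite /G2 /L1 /L2; ring.
  pose P := L1 + A1 * (8 / s1 * m).
  have /andP[P0 Pbound] : 0 <= P <= L1 + (if Y0 / 4 <= Y z then 8 * A / Y0 else 0).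
    by apply: rad_compensates => //; [exact: Lpos|exact: Llow].
  have PPm : P <= Pm.
    have [_ _ q1 _] := HF (true, z) yz; have [_ _ q2 _] := HF (false, z) yz.
    apply: le_trans Pbound _; rewrite /Pm /L1; move: q1 q2; rewrite /= !ler_norml.
    by move=> /andP[_ q1] /andP[_ q2]; clear -q1 q2 AY; case: ifP => _; lra.
  pose Nn := 8 / s1 * m - L2.
  have N0' : 0 <= Nn by rewrite subr_ge0.
  have N1 : Nn <= 8 * (eta ^+ 2 / S ^+ 2) by rewrite /Nn; clear -r1; lra.
  have vu := Hup d dd z yz; have vl := Hlow z yz.
  rewrite GE (_ : L1 + A1 * L2 = P - A1 * Nn); last by rewrite /P /Nn; ring.
  apply: le_trans (signed_product_le vu vl _ _ _ P0 Pbound PPm A10 N0' N1) _ => //.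
  - by apply: mulr_ge0 => //; exact: ltW.
  - exact: u0.
  - exact: ltW.
  - rewrite (E3 Cv A1 (cabs (cpx z))); exact: lexx.
clear -Hg lower upper; lra.
Qed.

(** * Summation over the zeros *)

Lemma powR_expR {R : realType} (x y : R) : 0 < x -> x `^ y = expR (y * ln x).
Proof. by move=> x0; rewrite /powR gt_eqF. Qed.

Lemma ln_leB1 {R : realType} (x : R) : 0 < x -> ln x <= x - 1.
Proof.
move=> x0; have -> : ln x = ln (1 + (x - 1)) by congr ln; ring.
by apply: le_ln1Dx; lra.
Qed.

Lemma pos_lower {R : realType} (I : finType) (F : I -> R) : (forall i, 0 < F i) ->
  exists2 c, 0 < c <= 1 & forall i, c <= F i.
Proof.
move=> F0; exists (\big[Num.min/1]_i F i).
  apply/andP; split; last exact: bigmin_le_id.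
  by apply: lt_bigmin => // i _.
by move=> i; exact: bigmin_le_cond.
Qed.

Lemma seq_lower {R : realType} (I : eqType) (s : seq I) (F : I -> R) :
  exists c, forall i, i \in s -> c <= F i.
Proof.
elim: s => [|a s [c H]]; first by exists 0.
exists (Num.min (F a) c) => i; rewrite inE => /orP[/eqP->|/H]; rewrite ge_min ?lexx//.
by move=> ->; rewrite orbT.
Qed.

Lemma prod_expR {R : realType} (n : nat) (x y : 'I_n -> R) : (forall i, 0 < x i) ->
  \prod_i x i `^ y i = expR (\sum_i y i * ln (x i)).
Proof. by move=> x0; rewrite expR_sum; apply: eq_bigr => i _; rewrite powR_expR. Qed.

(* At most one factor is small, so the product of negative powers is controlled by their sum. *)
Lemma prod_le_sum {R : realType} (n : nat) (w : 'I_n -> R[i]) (c : 'I_n -> R) :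
  injective w -> (forall i, 0 <= c i) ->
  exists2 C, 0 < C & forall z, (forall i, 0 < cabs (z - w i)) ->
   \prod_i cabs (z - w i) `^ (- c i) <= C * (1 + \sum_i cabs (z - w i) `^ (- c i)).
Proof.
move=> wi c0.
have [|d /andP[d0 d1] Hd] := @pos_lower R _ (fun ij : 'I_n * 'I_n =>
    if ij.1 == ij.2 then 1 else cabs (w ij.1 - w ij.2) / 2).
  move=> [i j] /=; case: eqVneq => // ij; rewrite divr_gt0//.
  by rewrite lt_neqAle cabs_ge0 andbT eq_sym cabs_eq0 subr_eq0 (inj_eq wi).
have dc i : 1 <= d `^ (- c i).
  by have := powRN_le (c0 i) d0 d1; rewrite powR1.
exists (\prod_i d `^ (- c i)); first by apply: prodr_gt0 => i _; rewrite powR_gt0.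
move=> z z0.
have P1 : 1 <= \prod_i d `^ (- c i) by apply: (big_ind (fun x => 1 <= x)) => // x y; exact: mulr_ege1.
have S0 : 0 <= \sum_i cabs (z - w i) `^ (- c i) by apply: sumr_ge0 => i _; exact: powR_ge0.
have [[i zi]|near0] := pselect (exists i, cabs (z - w i) < d); last first.
  have far i : d <= cabs (z - w i) by rewrite leNgt; apply/negP => h; apply: near0; exists i.
  apply: (le_trans (y := \prod_i d `^ (- c i))).
    apply: ler_prod => i _; by rewrite powR_ge0 powRN_le ?far.
  by rewrite ler_peMr ?lerDl//; exact: le_trans ler01 P1.
rewrite (bigD1 i)//= mulrC [\prod_i _ in leRHS](bigD1 i)//=.
apply: ler_pM.
- by apply: prodr_ge0 => j _; exact: powR_ge0.
- exact: powR_ge0.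
- apply: (le_trans (y := \prod_(j | j != i) d `^ (- c j))).
    apply: ler_prod => j ji; rewrite powR_ge0 powRN_le//.
    have := Hd (i, j); rewrite /= eq_sym (negbTE ji) => wd.
    have : cabs (w i - w j) <= cabs (z - w i) + cabs (z - w j).
      rewrite (_ : w i - w j = - (z - w i) + (z - w j)); last by ring.
      by rewrite -[cabs (z - w i)]cabsN cabsD.
    lra.
  by rewrite ler_peMl// prodr_ge0// => j _; exact: powR_ge0.
rewrite (bigD1 i)//=; have : 0 <= \sum_(j | j != i) cabs (z - w j) `^ (- c j).
  by apply: sumr_ge0 => j _; exact: powR_ge0.
lra.
Qed.

Lemma lnY_le0 {R : realType} (z : pt R) : 0 < Y z -> ln (Y z) <= 0.
Proof. by move=> z0; have := ln_leB1 z0; have := Y_le1 z; lra. Qed.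

Lemma dist_gt0 {R : realType} (w : R[i]) (z : pt R) : cabs w = 1 -> 0 < Y z -> 0 < cabs (cpx z - w).
Proof. by move=> w1 z0; have := Y_le_dist w1 z0; lra. Qed.

Lemma lndist {R : realType} (w : R[i]) (z : pt R) : cabs w = 1 -> 0 < Y z ->
  ln (R2 w z) = 2 * ln (cabs (cpx z - w)) /\ ln (Y z) - 1 <= ln (cabs (cpx z - w)) <= 1.
Proof.
move=> w1 z0; have d0 := dist_gt0 w1 z0; split.
  by rewrite R2_cabs lnXn// mulr_natl.
have zd := Y_le_dist w1 z0.
have : ln (Y z) <= ln (2 * cabs (cpx z - w)) by rewrite ler_ln ?posrE// mulr_gt0.
rewrite lnM ?posrE// => h1.
have h2 : ln 2 <= 1 :> R.
  by have := @ln_leB1 R 2 (ltr0n _ _); lra.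
have h3 := ln_leB1 d0.
have : cabs (cpx z - w) <= 2.
  apply: le_trans (cabsD _ _) _; rewrite cabsN w1.
  by have : cabs (cpx z) < 1; [rewrite -Y_gt0|lra].
by move=> ?; apply/andP; split; lra.
Qed.

(** The last bound uses [|z - zt| >= Y / 2] and [a - b >= 1]; it keeps the set where the weight
    exceeds a given level away from the circle. *)
Lemma lamw_upper {R : realType} (m : nat) (xi : 'I_m -> R[i]) (beta : 'I_m -> R)
   (zt : R[i]) (a b gam kap : R) :
  (forall k, cabs (xi k) = 1) -> cabs zt = 1 -> (forall k, 0 <= beta k) ->
  0 <= b -> 1 <= a - b -> 0 < gam <= 1 -> 0 < kap ->
  exists2 C, 0 < C & forall z, 0 < Y z ->
   `|lamw xi beta zt a b gam kap z - (a * ln (Y z) +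
      \sum_k beta k * ln (cabs (cpx z - xi k)) - b * ln (cabs (cpx z - zt)))| <= C /\
   expR (lamw xi beta zt a b gam kap z) <= C * Y z.
Proof.
move=> x1 t1 be0 b0 ab g0 k0.
have [C C0 H] := lamw_weight xi beta a t1 b0 g0 k0.
have CC : C <= Num.max C (expR (b + \sum_k beta k + C)) by rewrite le_max lexx.
exists (Num.max C (expR (b + \sum_k beta k + C))); first exact: lt_le_trans CC.
move=> z z0; have := H z z0.
have -> : \sum_k beta k / 2 * ln (R2 (xi k) z) = \sum_k beta k * ln (cabs (cpx z - xi k)).
  apply: eq_bigr => k _; have [-> _] := lndist (x1 k) z0; by field.
have [-> /andP[t2 t3]] := lndist t1 z0.
rewrite (_ : b / 2 * (2 * _) = b * ln (cabs (cpx z - zt))); last by field.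
move=> HC; split; first exact: le_trans CC.
apply: (le_trans (y := expR (b + \sum_k beta k + C) * Y z)); last first.
  by rewrite ler_wpM2r ?(ltW z0)// le_max lexx orbT.
rewrite -[X in _ <= _ * X]lnK ?posrE// -expRD ler_expR.
move: HC; rewrite ler_norml => /andP[_ HC].
have s1 : \sum_k beta k * ln (cabs (cpx z - xi k)) <= \sum_k beta k.
  apply: ler_sum => k _; have [_ /andP[_ h]] := lndist (x1 k) z0.
  by rewrite ler_piMr.
have s2 : b * (ln (Y z) - 1) <= b * ln (cabs (cpx z - zt)) by rewrite ler_wpM2l.
have s3 : (a - b - 1) * - ln (Y z) >= 0 by rewrite mulr_ge0 ?oppr_ge0 ?lnY_le0//; lra.
lra.
Qed.

(** Exponents are added up: [Y] gets [- p + a - 2 = eps - 1], the powers at [zt] cancel, and each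
    [xi k] gets [beta k - q k >= eps - 1]. All are at least [- th]; the cap 1/2 keeps [th]
    nonnegative when [eps] is large. *)
Lemma density_le {R : realType} (m : nat) (xi : 'I_m -> R[i]) (q : 'I_m -> R)
   (zt : R[i]) (p b eps gam kap : R) :
  injective xi -> (forall k, cabs (xi k) = 1) -> cabs zt = 1 -> 0 < eps ->
  0 <= b -> b <= p -> 0 < gam <= 1 -> 0 < kap ->
  exists2 C, 0 < C & forall z, 0 < Y z ->
   expR (- (p * ln (Y z)) + b * ln (cabs (cpx z - zt)) - \sum_k q k * ln (cabs (cpx z - xi k))) *
   (expR (lamw xi (fun k => Num.max (q k - 1 + eps) 0) zt (p + 1 + eps) b gam kap z) / Y z ^+ 2) <=
   C * (Y z `^ (- (1 - Num.min eps (1 / 2))) *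
        (1 + \sum_k cabs (cpx z - xi k) `^ (- (1 - Num.min eps (1 / 2))))).
Proof.
move=> xii x1 t1 e0 b0 bp g0 k0; set th := 1 - Num.min eps (1 / 2).
have e1 : Num.min eps (1 / 2) <= eps by rewrite ge_min lexx.
have e2 : Num.min eps (1 / 2) <= 1 / 2 by rewrite ge_min lexx orbT.
have e3 : 0 < Num.min eps (1 / 2) by rewrite lt_min e0; lra.
have th0 : 0 <= th by rewrite /th; lra.
set beta := fun k => Num.max (q k - 1 + eps) 0.
have be0 k : 0 <= beta k by rewrite le_max lexx orbT.
have beq k : 0 <= beta k - q k + th.
  have : q k - 1 + eps <= beta k by rewrite le_max lexx.
  rewrite /th; lra.
have [|C C0 H] := @lamw_upper R m xi beta zt (p + 1 + eps) b gam kap x1 t1 be0 b0 _ g0 k0; first lra.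
have [D D0 HD] := prod_le_sum (c := fun=> th) xii (fun=> th0).
exists (expR (C + \sum_k (beta k - q k + th)) * D); first by rewrite mulr_gt0// expR_gt0.
move=> z z0; have [{}H _] := H z z0.
have dk k := dist_gt0 (x1 k) z0.
have := HD _ dk; rewrite prod_expR// => {}HD.
have lY := lnY_le0 z0.
have -> : (Y z ^+ 2)^-1 = expR (- (2 * ln (Y z))).
  by rewrite expRN expRM_natl lnK ?posrE.
rewrite -!expRD.
apply: (le_trans (y := expR (C + \sum_k (beta k - q k + th)) *
   (Y z `^ (- th) * expR (\sum_k - th * ln (cabs (cpx z - xi k)))))); last first.
  rewrite -!mulrA ler_wpM2l ?expR_ge0// mulrCA ler_wpM2l ?powR_ge0//.
rewrite powR_expR// -!expRD ler_expR.
move: H; rewrite ler_norml => /andP[_ H].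
have s1 : \sum_k (beta k - q k) * ln (cabs (cpx z - xi k)) <=
   \sum_k (beta k - q k + th) + \sum_k - th * ln (cabs (cpx z - xi k)).
  rewrite -big_split/=; apply: ler_sum => k _; have [_ /andP[_ h]] := lndist (x1 k) z0.
  have : (beta k - q k + th) * (1 - ln (cabs (cpx z - xi k))) >= 0 by rewrite mulr_ge0//; lra.
  lra.
have s2 : \sum_k (beta k - q k) * ln (cabs (cpx z - xi k)) =
    \sum_k beta k * ln (cabs (cpx z - xi k)) - \sum_k q k * ln (cabs (cpx z - xi k)).
  by rewrite -sumrB; apply: eq_bigr => k _; rewrite mulrBl.
have s3 : (eps - 1 + th) * - ln (Y z) >= 0.
  by apply: mulr_ge0; rewrite ?oppr_ge0// /th; lra.
lra.
Qed.

Lemma cut_params {R : realType} (b S eps : R) : 0 <= b -> 0 <= S -> 0 < eps ->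
  exists gam kap Y0, [/\ 0 < gam <= 1, 0 < kap, 0 < Y0 <= 1,
    4 * b * gam <= eps /\ 8 * b * kap <= eps & 4 * (Y0 * S) <= eps].
Proof.
move=> b0 S0 e0.
have key (x : R) : 0 <= x -> 0 < eps / (eps + x) <= 1 /\ x * (eps / (eps + x)) <= eps.
  move=> x0; have ex : 0 < eps + x by lra.
  rewrite divr_gt0// ler_pdivrMr// mul1r lerDl x0; split=> //.
  by rewrite mulrCA ler_piMr ?(ltW e0)// ler_pdivrMr// mul1r lerDr ltW.
have [|k1 k2] := key (4 * b); first lra.
have [|k3 k4] := key (8 * b); first lra.
have [|k5 k6] := key (4 * S); first lra.
exists (eps / (eps + 4 * b)), (eps / (eps + 8 * b)), (eps / (eps + 4 * S)).
by split=> //; [case/andP: k3|rewrite -mulrA (mulrC S) in k6].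
Qed.

(** The majorant keeps a single point [zt], with exponent [b]. The constant is fixed before [f], [K]
    and [s]: it is built from bounds on [lam] and [M] only, and these are uniform in the truncation
    level. *)
Lemma zero_sum_local {R : realType} (m : nat) (xi : 'I_m -> R[i]) (q : 'I_m -> R)
    (zt : R[i]) (p b eps CM : R) (M : R[i] -> R) :
  injective xi -> (forall k, cabs (xi k) = 1) -> cabs zt = 1 -> 0 < eps ->
  0 <= b -> b <= p -> (forall k, 0 <= q k) ->
  (forall z, 0 <= M z) ->
  (forall z, 0 < Y z -> M (cpx z) <= expR (CM - p * ln (Y z) + b * ln (cabs (cpx z - zt))
      - \sum_k q k * ln (cabs (cpx z - xi k)))) ->
  exists2 C, 0 < C & forall f K s, analytic_on_disc f -> cabs (f 0) = 1 -> 0 < K ->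
   (forall z, cabs z < 1 -> cabs (f z) <= expR (K * M z)) ->
   (forall a, a \in s -> cabs a < 1) ->
   (forall a, a \in s -> vanishes_to f a (count_mem a s)) ->
   \sum_(a <- s) expR ((p + 1 + eps) * ln (1 - cabs a ^+ 2)
     + \sum_k Num.max (q k - 1 + eps) 0 * ln (cabs (a - xi k)) - b * ln (cabs (a - zt))) <= C * K.
Proof.
move=> xii x1 t1 e0 b0 bp q0 M0 MM.
set beta := fun k => Num.max (q k - 1 + eps) 0.
set a := p + 1 + eps.
have be0 k : 0 <= beta k by rewrite le_max lexx orbT.
have p0 : 0 <= p by lra.
have a0 : 0 <= a by rewrite /a; lra.
have ab : 1 + eps <= a - b by rewrite /a; lra.
have S0 : 0 <= 2 * a + \sum_k beta k / 2.
  by apply: addr_ge0; [rewrite mulr_ge0|apply: sumr_ge0 => k _; rewrite divr_ge0].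
have [gam [kap [Y0 [g0 k0 /andP[Yp Y01] [bg bk] YS]]]] := cut_params b0 S0 e0.
have gp : 0 < gam by case/andP: g0.
set lam := lamw xi beta zt a b gam kap.
have sub z := @lamw_subharm R m xi beta zt a b gam kap eps Y0 z x1 t1 be0 b0 e0 ab g0 k0 bg bk YS.
have [|Cb Cb1 Hb] := @lamw_bounds R m xi beta zt a b gam kap x1 t1 be0 b0 _ g0; first lra.
have [|C1 C10 H1] := @lamw_upper R m xi beta zt a b gam kap x1 t1 be0 b0 _ g0 k0; first lra.
have [Cd Cd0 Hd] := density_le q xii x1 t1 e0 b0 bp g0 k0.
rewrite -/beta -/a -/lam in Hd H1 Hb sub.
have Cb00 : 0 < Cb by exact: lt_le_trans Cb1.
have Cb0 := ltW Cb00.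
set th := 1 - Num.min eps (1 / 2) in Hd.
have e2 : Num.min eps (1 / 2) <= 1 / 2 by rewrite ge_min lexx orbT.
have e3 : 0 < Num.min eps (1 / 2) by rewrite lt_min e0; lra.
have th01 : 0 <= th < 1 by rewrite /th; clear -e2 e3; apply/andP; split; lra.
have [Cw Cw0 Hw] := gsum_weight th01 x1.
pose W z := Y z `^ (- th) * (1 + \sum_k cabs (cpx z - xi k) `^ (- th)).
have W1 z : 0 < Y z -> 1 <= W z.
  move=> z0; have : 1 <= Y z `^ (- th).
    by case/andP: th01 => th0 _; have := powRN_le th0 z0 (Y_le1 z); rewrite powR1.
  have : 0 <= \sum_k cabs (cpx z - xi k) `^ (- th) by apply: sumr_ge0 => k _; exact: powR_ge0.
  move=> s0 p1; apply: le_trans p1 _; rewrite /W ler_peMr ?powR_ge0//; lra.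
pose A := 2 * Cb * C1 / Y0 ^+ 2.
have A0 : 0 <= A by rewrite divr_ge0 ?sqr_ge0// !mulr_ge0// ltW.
have far z : Y0 / 4 <= Y z -> M (cpx z) <= expR (CM + (p + \sum_k q k) * (1 - ln (Y0 / 4)) + b).
  move=> yz; have Y40 : 0 < Y0 / 4 by rewrite divr_gt0.
  have z0 : 0 < Y z by exact: lt_le_trans yz.
  apply: le_trans (MM z z0) _; rewrite ler_expR.
  have ly : ln (Y0 / 4) <= ln (Y z) by rewrite ler_ln.
  have s1 : \sum_k q k * (ln (Y0 / 4) - 1) <= \sum_k q k * ln (cabs (cpx z - xi k)).
    apply: ler_sum => k _; have [_ /andP[h _]] := lndist (x1 k) z0.
    by rewrite ler_wpM2l//; clear -h ly; lra.
  rewrite -mulr_suml in s1.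
  have s2 : b * ln (cabs (cpx z - zt)) <= b.
    by have [_ /andP[_ h]] := lndist t1 z0; rewrite ler_piMr.
  have s3 : p * (ln (Y0 / 4) - 1) <= p * ln (Y z) by rewrite ler_wpM2l//; clear -ly; lra.
  clear -s1 s2 s3; lra.
set CF := expR (CM + _ + b) in far.
have CF0 : 0 < CF by rewrite expR_gt0.
pose C := expR CM * (2 * Cb) * Cd + CF * (8 * A / Y0).
have AY : 0 <= 8 * A / Y0 by rewrite divr_ge0 ?(ltW Yp)// mulr_ge0.
have Cp : 0 < C.
  apply: ltr_pwDl; last by rewrite mulr_ge0// ltW.
  by rewrite !mulr_gt0 ?expR_gt0.
(* The majorant times the Laplacian bound is controlled by the summable [W]; the extra term of the
   radial correction lives where [Y >= Y0 / 4], where [M] is at most [CF]. *)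
have pw z L : 0 < Y z -> L <= 2 * (Cb / Y z ^+ 2) * expR (lam z) ->
   M (cpx z) * (L + (if Y0 / 4 <= Y z then 8 * A / Y0 else 0)) <= C * W z.
  move=> z0 HL; have -> : C * W z = expR CM * (2 * Cb) * Cd * W z + CF * (8 * A / Y0) * W z.
    exact: mulrDl.
  rewrite [leLHS](mulrDr (M (cpx z)) L); apply: lerD.
    apply: le_trans (ler_wpM2l (M0 _) HL) _.
    have e0' : 0 <= 2 * (Cb / Y z ^+ 2) * expR (lam z).
      by rewrite mulr_ge0 ?expR_ge0// mulr_ge0// divr_ge0 ?sqr_ge0.
    apply: le_trans (ler_wpM2r e0' (MM z z0)) _.
    have := Hd z z0; rewrite -/(W z).
    set E := expR (_ + _ - _) => hE.
    have -> : expR (CM - p * ln (Y z) + b * ln (cabs (cpx z - zt)) -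
       \sum_k q k * ln (cabs (cpx z - xi k))) = expR CM * E by rewrite -expRD; congr expR; ring.
    have -> : expR CM * E * (2 * (Cb / Y z ^+ 2) * expR (lam z)) =
      expR CM * (2 * Cb) * (E * (expR (lam z) / Y z ^+ 2)) by ring.
    by rewrite -[leRHS]mulrA ler_wpM2l// mulr_ge0 ?expR_ge0// mulr_ge0.
  have CA : 0 <= CF * (8 * A / Y0) by rewrite mulr_ge0// ltW.
  case: ifP => yz; last by rewrite mulr0 mulr_ge0//; exact: le_trans ler01 (W1 _ z0).
  apply: (le_trans (y := CF * (8 * A / Y0))); first by rewrite ler_wpM2r// far.
  by rewrite ler_peMr// W1.
(* The 9 combines the factor 2 of [ptest_big] with the 2/9 of [jensen_bound]. *)
exists (9 * expR C1 * (C * Cw)); first by rewrite !mulr_gt0 ?expR_gt0.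
move=> f K s fA f0 K0 fM s1 sv.
have [g gA fE] := factor_zeros fA sv.
pose P (w : R[i]) : pt R := (complex.Re w, complex.Im w).
have cP w : cpx (P w) = w by case: w.
have sY w : w \in s -> 0 < Y (P w) by move=> ws; rewrite Y_gt0 cP s1.
(* The level is put 16 below the least value of [lam] on the list, so every zero keeps at least half
   of its weight. It depends on [s], unlike the bounds on the Laplacian of [ptest]. *)
have [ld Hld] := @seq_lower R _ s (fun w => lam (P w) - 16).
pose dl := expR ld; have dl0 : 0 < dl by rewrite expR_gt0.
have lnd : ln dl = ld by rewrite /dl expRK.
(* For [Y <= dl / C1] the weight is below [dl], so the test function vanishes there. *)
pose y1 := Num.min (Y0 / 8) (dl / C1).
have y10 : 0 < y1 by rewrite lt_min !divr_gt0.
have y1Y : y1 < Y0 / 4.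
  have : y1 <= Y0 / 8 by rewrite ge_min lexx.
  clear -Yp; lra.
have y1d : C1 * y1 <= dl by rewrite mulrC -ler_pdivlMr// ge_min lexx orbT.
clearbody y1.
have y20 : 0 < y1 / 2 by rewrite divr_gt0.
have J := ujet_ptest dl y20 (@ujet_lamw R m xi beta zt a b gam kap (y1 / 2) x1 t1 gp y20).
set F1 := ptest1 _ _ _ in J; set F2 := ptest2 _ _ _ _ in J.
have pos z : y1 / 2 <= Y z -> 0 < Y z by exact: lt_le_trans.
have Fle z : 0 < Y z -> `|F2 true z + F2 false z| <= 2 * (Cb / Y z ^+ 2) * expR (lam z).
  move=> z0; have [b1 b2] := Hb z z0; apply: ptest_lap_le => //.
  by rewrite divr_ge0 ?sqr_ge0.
have Fpos z : y1 / 2 <= Y z -> Y z <= Y0 -> 0 <= F2 true z + F2 false z.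
  by move=> /pos z0 zY; apply: ptest_lap_ge0 => //; exact: sub.
have Flow z : y1 / 2 <= Y z -> - A <= F2 true z + F2 false z.
  move=> yz; have z0 := pos z yz; case: (leP (Y z) Y0) => zY.
    by have := Fpos z yz zY; clear -A0; lra.
  have := Fle z z0; rewrite ler_norml => /andP[h _]; apply: le_trans h; rewrite lerN2.
  have [_ h] := H1 z z0.
  apply: (le_trans (y := 2 * (Cb / Y0 ^+ 2) * C1)); last by rewrite /A le_eqVlt; apply/orP; left; apply/eqP; ring.
  apply: ler_pM.
  - by rewrite mulr_ge0// divr_ge0 ?sqr_ge0.
  - exact: expR_ge0.
  - rewrite ler_wpM2l// ler_wpM2l ?lef_pV2 ?posrE ?exprn_gt0//.
    by rewrite lerXn2r// ?nnegrE ltW.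
  - by apply: le_trans h _; rewrite ler_piMr ?Y_le1// ltW.
have := @jensen_bound R f g s (fun z => K * M (cpx z)) (ptest lam dl) F1 F2 y1 Y0 A
   (K * (C * Cw)) (y1 / 4) y10 y1Y Y01 A0.
move=> /(_ (fun z => ptest_ge0 lam z dl0)) /(_ _ J Fpos Flow fA gA fE f0 s1) HJ.
have {}HJ : 2 / 9 * \sum_(w <- s) ptest lam dl (P w) <= K * (C * Cw).
  apply: HJ.
  - move=> z zy; apply: ptest_eq0 => z0; have [_ h] := H1 z z0.
    rewrite lnd -ler_expR; apply: le_trans h _; apply: le_trans y1d.
    by rewrite ler_wpM2l// ltW.
  - by move=> z _; rewrite mulr_ge0// ltW.
  - by move=> z /pos z0; apply: fM; rewrite -Y_gt0.
  - by rewrite divr_gt0.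
  - move=> N h hN N0 hy.
    have h2 : 2 * h <= y1 / 2 by clear -hy; lra.
    apply: (le_trans (y := gsum (4 * N) h (fun z => K * C *
       (if y1 / 2 <= Y z then W z else 0)))); last first.
      by rewrite gsumZ -mulrA ler_wpM2l ?(ltW K0)// ler_wpM2l ?(ltW Cp)// Hw.
    apply: ler_gsum => i j; case: ifP => yz; last by rewrite mulr0.
    rewrite -(mulrA K (M _)) -(mulrA K C) ler_wpM2l ?(ltW K0)//; apply: pw; first exact: pos.
    exact: le_trans (ler_norm _) (Fle _ (pos _ yz)).
have : \sum_(w <- s) expR (a * ln (1 - cabs w ^+ 2)
     + \sum_k beta k * ln (cabs (w - xi k)) - b * ln (cabs (w - zt))) <=
   expR C1 * (2 * \sum_(w <- s) ptest lam dl (P w)).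
  rewrite !mulr_sumr big_seq [leRHS]big_seq; apply: ler_sum => w ws.
  have w0 := sY _ ws; have [h _] := H1 _ w0.
  apply: (le_trans (y := expR C1 * expR (lam (P w)))).
    move: h; rewrite Y_cabs cP -expRD ler_expR ler_norml => /andP[h _]; clear -h; lra.
  rewrite ler_wpM2l ?expR_ge0//; apply: ptest_big => //.
  by have := Hld _ ws; rewrite lnd; clear -ws; lra.
move/le_trans; apply.
rewrite (_ : 9 * expR C1 * (C * Cw) * K = expR C1 * (9 * (K * (C * Cw)))); last by ring.
by rewrite ler_wpM2l ?expR_ge0//; clear -HJ; lra.
Qed.

(** * Combination of the estimates for the individual points [zeta j] *)

Definition majorant {R : realType} (n m : nat) (zeta : 'I_n -> R[i]) (xi : 'I_m -> R[i])
    (p : R) (q : 'I_m -> R) (r : 'I_n -> R) (z : R[i]) : R :=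
  (\prod_j cabs (z - zeta j) `^ r j) / (\prod_k cabs (z - xi k) `^ q k) / (1 - cabs z) `^ p.

Lemma majorant_ge0 {R : realType} (n m : nat) (zeta : 'I_n -> R[i]) (xi : 'I_m -> R[i])
    (p : R) q r z : 0 <= majorant zeta xi p q r z.
Proof.
by rewrite /majorant !divr_ge0 ?powR_ge0// prodr_ge0// => i _; exact: powR_ge0.
Qed.

Lemma majorant_le {R : realType} (n m : nat) (zeta : 'I_n -> R[i]) (xi : 'I_m -> R[i])
    (p x : R) (q : 'I_m -> R) (r : 'I_n -> R) z :
  (forall j, cabs (zeta j) = 1) -> (forall k, cabs (xi k) = 1) -> 0 <= p -> 0 < Y z ->
  \sum_j r j * ln (cabs (cpx z - zeta j)) <= \sum_j r j + x ->
  majorant zeta xi p q r (cpx z) <=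
  expR (p + \sum_j r j - p * ln (Y z) + x - \sum_k q k * ln (cabs (cpx z - xi k))).
Proof.
move=> z1 x1 p0 z0 H; have z0' := z0; rewrite Y_gt0 in z0'.
have dz j := dist_gt0 (z1 j) z0; have dx k := dist_gt0 (x1 k) z0.
have z1' : 0 < 1 - cabs (cpx z) by lra.
rewrite /majorant !prod_expR// powR_expR// -!expRN -!expRD ler_expR.
have lz : ln (Y z) - 1 <= ln (1 - cabs (cpx z)).
  have : ln (Y z) <= ln (2 * (1 - cabs (cpx z))).
    rewrite ler_ln ?posrE ?mulr_gt0// Y_cabs.
    have : (1 - cabs (cpx z)) * cabs (cpx z) <= (1 - cabs (cpx z)) * 1 by rewrite ler_wpM2l ?(ltW z1')// ltW.
    lra.
  rewrite lnM ?posrE//; have := @ln_leB1 R 2 (ltr0n _ _); lra.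
have : p * (ln (Y z) - 1) <= p * ln (1 - cabs (cpx z)) by rewrite ler_wpM2l.
lra.
Qed.

(** Each logarithm is at most 1, since distances in the disc are at most 2. Hence all factors but
    one can be discarded, and the exponent of the remaining one lowered from [r j] to [b], at the
    cost of a constant. *)
Lemma sum_log_le {R : realType} (n : nat) (zeta : 'I_n -> R[i]) (r : 'I_n -> R) (z : pt R) :
  (forall j, cabs (zeta j) = 1) -> (forall j, 0 <= r j) -> 0 < Y z ->
  \sum_j r j * ln (cabs (cpx z - zeta j)) <= \sum_j r j /\
  forall j b, 0 <= b -> b <= r j -> \sum_j r j * ln (cabs (cpx z - zeta j)) <=
    \sum_j r j + b * ln (cabs (cpx z - zeta j)).
Proof.
move=> z1 r0 z0.
have le1 j : r j * ln (cabs (cpx z - zeta j)) <= r j.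
  by have [_ /andP[_ h]] := lndist (z1 j) z0; rewrite ler_piMr.
split; first by apply: ler_sum.
move=> j b b0 br; rewrite (bigD1 j)//= [\sum_j r j](bigD1 j)//=.
have : \sum_(i | i != j) r i * ln (cabs (cpx z - zeta i)) <= \sum_(i | i != j) r i by exact: ler_sum.
have [_ /andP[_ h]] := lndist (z1 j) z0.
have : 0 <= (r j - b) * (1 - ln (cabs (cpx z - zeta j))) by rewrite mulr_ge0//; lra.
lra.
Qed.

(** By [prod_le_sum] the full product of negative powers is at most a constant times 1 plus the
    single powers. [zero_sum_local] is applied once with exponent 0 for the term 1, and once for
    every [zeta j]. *)
Lemma zero_sum_bound {R : realType} (n m : nat) (zeta : 'I_n -> R[i]) (xi : 'I_m -> R[i])
    (p : R) (q : 'I_m -> R) (r : 'I_n -> R) (eps : R) :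
  injective zeta -> injective xi ->
  (forall j, cabs (zeta j) = 1) -> (forall k, cabs (xi k) = 1) ->
  0 <= p -> (forall k, 0 <= q k) -> (forall j, 0 <= r j) -> 0 < eps ->
  exists2 C, 0 < C & forall f K s, analytic_on_disc f -> cabs (f 0) = 1 -> 0 < K ->
   (forall z, cabs z < 1 -> cabs (f z) <= expR (K * majorant zeta xi p q r z)) ->
   (forall a, a \in s -> cabs a < 1) ->
   (forall a, a \in s -> vanishes_to f a (count_mem a s)) ->
   \sum_(a <- s) ((1 - cabs a) `^ (p + 1 + eps) *
        ((\prod_(k < m) cabs (a - xi k) `^ Num.max (q k - 1 + eps) 0) /
         (\prod_(j < n) cabs (a - zeta j) `^ Num.min p (r j)))) <= C * K.
Proof.
move=> zi xii z1 x1 p0 q0 r0 e0.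
pose b j := Num.min p (r j).
have b0 j : 0 <= b j by rewrite le_min p0 r0.
have bp j : b j <= p by rewrite ge_min lexx.
have br j : b j <= r j by rewrite ge_min lexx orbT.
have Mx := majorant_ge0 zeta xi p q r.
pose E zt b a := expR ((p + 1 + eps) * ln (1 - cabs a ^+ 2)
     + \sum_k Num.max (q k - 1 + eps) 0 * ln (cabs (a - xi k)) - b * ln (cabs (a - zt))).
(* The estimate without any factor [zeta j]; the boundary point 1 merely fills the place of [zt],
   with exponent 0. *)
have M0 (z : pt R) : 0 < Y z -> majorant zeta xi p q r (cpx z) <=
    expR (p + \sum_j r j - p * ln (Y z) + 0 * ln (cabs (cpx z - 1)) - \sum_k q k * ln (cabs (cpx z - xi k))).
  move=> z0; rewrite mul0r; apply: majorant_le => //.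
  by rewrite addr0; have [] := sum_log_le z1 r0 z0.
have Mj j (z : pt R) : 0 < Y z -> majorant zeta xi p q r (cpx z) <=
    expR (p + \sum_j r j - p * ln (Y z) + b j * ln (cabs (cpx z - zeta j)) - \sum_k q k * ln (cabs (cpx z - xi k))).
  by move=> z0; apply: majorant_le => //; have [_] := sum_log_le z1 r0 z0; apply.
have [C0 C00 H0] := zero_sum_local xii x1 cabs1 e0 (lexx 0) p0 q0 Mx M0.
have /choice[Cj Hj] : forall j, exists C, 0 < C /\ forall f K s,
   analytic_on_disc f -> cabs (f 0) = 1 -> 0 < K ->
   (forall z, cabs z < 1 -> cabs (f z) <= expR (K * majorant zeta xi p q r z)) ->
   (forall a, a \in s -> cabs a < 1) ->
   (forall a, a \in s -> vanishes_to f a (count_mem a s)) ->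
   \sum_(a <- s) E (zeta j) (b j) a <= C * K.
  move=> j; have [C Cp H] := zero_sum_local xii x1 (z1 j) e0 (b0 j) (bp j) q0 Mx (Mj j).
  by exists C.
have [D Dp HD] := prod_le_sum zi b0.
exists (D * (C0 + \sum_j Cj j)).
  rewrite mulr_gt0// ltr_pwDl// sumr_ge0// => j _; exact: ltW (Hj j).1.
move=> f K s fA f0 K0 fM s1 sv.
apply: (le_trans (y := \sum_(a <- s) D * (E 1 0 a + \sum_j E (zeta j) (b j) a))).
  rewrite big_seq [leRHS]big_seq; apply: ler_sum => a as_; have a1 := s1 _ as_.
  pose z : pt R := (complex.Re a, complex.Im a).
  have cz : cpx z = a by rewrite /cpx /z; case: (a).
  have z0 : 0 < Y z by rewrite Y_gt0 cz.
  have dz j : 0 < cabs (a - zeta j) by rewrite -cz; exact: dist_gt0.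
  have dx k : 0 < cabs (a - xi k) by rewrite -cz; exact: dist_gt0.
  pose G := expR ((p + 1 + eps) * ln (1 - cabs a ^+ 2)
     + \sum_k Num.max (q k - 1 + eps) 0 * ln (cabs (a - xi k))).
  have EG zt c : E zt c a = G * expR (- (c * ln (cabs (a - zt)))) by rewrite -expRD.
  have -> : E 1 0 a + \sum_j E (zeta j) (b j) a = G * (1 + \sum_j cabs (a - zeta j) `^ (- b j)).
    rewrite EG mul0r oppr0 expR0 [RHS]mulrDr mulr_sumr; congr (_ + _).
    by apply: eq_bigr => j _; rewrite EG powR_expR// mulNr.
  rewrite [leRHS]mulrCA; have := HD a dz => {}HD.
  rewrite mulrA; apply: ler_pM.
  - by rewrite mulr_ge0 ?powR_ge0// prodr_ge0// => k _; exact: powR_ge0.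
  - by rewrite invr_ge0 prodr_ge0// => k _; exact: powR_ge0.
  - rewrite prod_expR// /G expRD ler_wpM2r ?expR_ge0// -powR_expR; last by rewrite -cz -Y_cabs.
    apply: ge0_ler_powR; rewrite ?nnegrE; try lra.
    + by rewrite -cz -Y_cabs ltW.
    + by have := cabs_ge0 a; rewrite expr2 => h; have : cabs a * cabs a <= cabs a * 1 by [rewrite ler_wpM2l// ltW]; lra.
  - apply: le_trans HD; rewrite -prodfV le_eqVlt; apply/orP; left; apply/eqP.
    by apply: eq_bigr => j _; rewrite powRN.
rewrite -mulr_sumr -mulrA ler_wpM2l ?(ltW Dp)// big_split/= mulrDl mulr_suml exchange_big/=.
by apply: lerD; [exact: (H0 f)|apply: ler_sum => j _; exact: ((Hj j).2 f)].
Qed.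

(** * Multiplicities: from pairs of a zero and an index to lists of zeros *)

Lemma size_le_mem (ks : seq nat) : uniq ks -> (forall k, k \in ks -> (0 < k)%N) -> ks != [::] ->
  exists2 k, k \in ks & (size ks <= k)%N.
Proof.
move=> u p0 n0; apply: contrapT => H.
have sub : {subset ks <= iota 1 (size ks).-1}.
  move=> k kk; rewrite mem_iota p0//= add1n prednK ?lt0n ?size_eq0//.
  by rewrite ltnNge; apply/negP => h; apply: H; exists k.
have := uniq_leq_size u sub; rewrite size_iota leqNgt prednK ?leqnn//.
by rewrite lt0n size_eq0.
Qed.

(** The indices paired with [a] in a finite subset of [zeros_mult] need not form an initial segment.
    Being distinct and positive, the largest is at least their number, and vanishing to that order
    implies vanishing to the order counted. *)
Lemma vanishes_to_count {R : realType} (f : R[i] -> R[i]) (X : seq (R[i] * nat)) a :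
  uniq X -> (forall x, x \in X -> zeros_mult f x) -> a \in [seq x.1 | x <- X] ->
  vanishes_to f a (count_mem a [seq x.1 | x <- X]).
Proof.
move=> u XZ aX; pose ks := [seq x.2 | x <- X & x.1 == a].
have mk k : k \in ks -> (a, k) \in X.
  by move=> /mapP[[a' k']]; rewrite mem_filter/= => /andP[/eqP -> h] ->.
have uk : uniq ks.
  rewrite map_inj_in_uniq ?filter_uniq// => -[a1 k1] [a2 k2].
  by rewrite !mem_filter/= => /andP[/eqP -> _] /andP[/eqP -> _] ->.
have sk : size ks = count_mem a [seq x.1 | x <- X].
  by rewrite size_map size_filter count_map; apply: eq_count.
have [||k kk] := size_le_mem uk.
- by move=> k /mk /XZ[_ []].
- by rewrite -size_eq0 sk -lt0n -has_count; apply/hasP; exists a => /=.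
rewrite sk => le; have /XZ[_ [_ [c [rho [h1 h2]]]]] := mk k kk.
by exists c, rho; split=> // i ik; apply: h2; exact: leq_trans le.
Qed.

Unset Implicit Arguments.

Theorem theorem0p2 (R : realType) (n m : nat)
    (zeta : 'I_n -> R[i]) (xi : 'I_m -> R[i])
    (p : R) (q : 'I_m -> R) (r : 'I_n -> R) :
  injective zeta -> injective xi ->
  (forall j, cabs (zeta j) = 1) -> (forall k, cabs (xi k) = 1) ->
  (forall j k, zeta j != xi k) ->
  0 <= p -> (forall k, 0 <= q k) -> (forall j, 0 <= r j) ->
  forall eps : R, 0 < eps ->
  exists C3 : R, 0 < C3 /\
  forall (f : R[i] -> R[i]) (K : R),
    analytic_on_disc f -> cabs (f 0) = 1 -> 0 < K ->
    (forall z : R[i], cabs z < 1 ->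
       ln (cabs (f z)) <=
         K / (1 - cabs z) `^ p *
         ((\prod_(j < n) cabs (z - zeta j) `^ r j) /
          (\prod_(k < m) cabs (z - xi k) `^ q k))) ->
    (\esum_(ak in zeros_mult f)
       ((1 - cabs ak.1) `^ (p + 1 + eps) *
        ((\prod_(k < m) cabs (ak.1 - xi k) `^ Num.max (q k - 1 + eps) 0) /
         (\prod_(j < n) cabs (ak.1 - zeta j) `^ Num.min p (r j))))%:E
     <= (C3 * K)%:E)%E.
Proof.
move=> zi xii z1 x1 _ p0 q0 r0 eps e0.
have [C C0 H] := zero_sum_bound zi xii z1 x1 p0 q0 r0 e0.
exists C; split=> // f K fA f0 K0 fln.
(* The infinite sum is a supremum over finite subsets, so a bound uniform over finite lists of zeros
   is enough. *)
apply: ge_ereal_sup => _ [A [Afin AZ] <-].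
rewrite fsbig_finite//= sumEFin lee_fin.
pose X : seq (R[i] * nat) := finmap.enum_fset (fset_set A).
have XZ x : x \in X -> zeros_mult f x.
  by move=> xX; apply: AZ; apply: set_mem; rewrite -(in_fset_set Afin); exact: xX.
have := H f K [seq x.1 | x <- X] fA f0 K0; rewrite big_map; apply.
(* Where [f] vanishes the logarithmic hypothesis carries no information, [ln 0] being 0 by
   convention, but the exponential bound on [|f|] is trivial. *)
- move=> z z0; have [->|fz] := eqVneq (f z) 0; first by rewrite cabs0 expR_ge0.
  have fz0 : 0 < cabs (f z) by rewrite lt_neqAle cabs_ge0 andbT eq_sym cabs_eq0.
  rewrite -[cabs (f z)]lnK ?posrE// ler_expR; apply: le_trans (fln z z0) _.
  by rewrite /majorant le_eqVlt; apply/orP; left; apply/eqP; ring.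
- by move=> a /mapP[x /XZ[x1' _] ->].
- by move=> a; apply: vanishes_to_count => //; exact: finmap.fset_uniq.
Qed.
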